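(* Let $\gamma:S^1\to\mathbb{R}^2$ be a closed Lipschitz curve, and for $0<\varepsilon\le1$ let $\gamma_\varepsilon(t)=(\gamma(t),\varepsilon\cos t,\varepsilon\sin t)\in\mathbb{R}^4$. Let $\varepsilon_j\downarrow0$, let $u_{\varepsilon_j}:D^2\to\mathbb{R}^4$ be Douglas minimizers spanning the lifted curves $\gamma_{\varepsilon_j}$, and suppose $u_{\varepsilon_j}\rightharpoonup u_0$ weakly in $W^{1,2}(D^2)$. Then $u_0$ minimizes area among all competitors spanning the limiting boundary curve $u_0|_{\partial D^2}$; that is, $\operatorname{Area}(u_0)\le\operatorname{Area}(v)$ for every Lipschitz map $v:\overline{D^2}\to\mathbb{R}^4$ with $v|_{\partial D^2}=u_0|_{\partial D^2}$.
   Context: $D^2$ is the unit disk in $\mathbb{R}^2$, $\partial D^2=S^1$, and $S^1=\{(\cos t,\sin t):t\in[0,2\pi)\}$ is parametrized by the angle $t$. For every $\varepsilon>0$ the lifted curve $\gamma_\varepsilon$ is injective on $S^1$, hence a Jordan curve in $\mathbb{R}^4$. The restriction of $u_0$ to $\partial D^2$ is understood in the sense of Sobolev traces. Area: $\operatorname{Area}(v)=\int_{D^2}J_v(x)\,d\mathcal{H}^2(x)$ with $J_v=\sqrt{\det(Dv^TDv)}$. Spanning and Douglas minimizers: a map $u:\overline{D^2}\to\mathbb{R}^4$, continuous on $\overline{D^2}$ and in $W^{1,2}(D^2)$, spans the Jordan curve given by $\gamma_\varepsilon$ if $u|_{\partial D^2}=\gamma_\varepsilon\circ\phi$ for some continuous,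 surjective, weakly monotone map $\phi:S^1\to S^1$. A Douglas minimizer spanning it is a spanning map $u$ that is harmonic and (weakly) conformal in $D^2$ and minimizes area among all spanning maps; equivalently it minimizes the Dirichlet energy $\mathscr{E}(u)=\frac12\int_{D^2}|\nabla u|^2$ among them. *)

(* Defs.v *)
From HB Require Import structures.
From mathcomp Require Import all_boot all_order all_algebra.
From mathcomp Require Import all_classical all_reals all_analysis.

Set Implicit Arguments.
Unset Strict Implicit.
Unset Printing Implicit Defensive.

Import Order.TTheory GRing.Theory Num.Theory.
Import numFieldNormedType.Exports.

Local Open Scope classical_set_scope.
Local Open Scope ring_scope.

Section Plane.
Context {R : realType}.

Notation plane := (R * R)%type.
Notation dx := ((@lebesgue_measure R) \x (@lebesgue_measure R))%E.

(* The norm of R * R in the library is the sup norm, so the disk is given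
   by its equation; continuity and the Lipschitz property do not depend on
   the choice between the two norms. *)
Definition disk : set plane := [set x | x.1 ^+ 2 + x.2 ^+ 2 < 1].
Definition cdisk : set plane := [set x | x.1 ^+ 2 + x.2 ^+ 2 <= 1].
Definition circle : set plane := [set x | x.1 ^+ 2 + x.2 ^+ 2 = 1].

Definition angle (t : R) : plane := (cos t, sin t).

(* Squared Euclidean (Frobenius) norm; the norm of the library on matrices is
   the sup norm. *)
Definition sqnorm (m n : nat) (A : 'M[R]_(m, n)) : R :=
  \sum_(i < m) \sum_(j < n) A i j ^+ 2.

Definition basis_vec (k : 'I_2) : plane := if k == 0 then (1, 0) else (0, 1).

Definition partial (k : 'I_2) (f : plane -> R) : plane -> R :=
  fun x => 'D_(basis_vec k) f x.

(* [Ck_on A m f] : f is of class C^m on the open set A. *)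
Fixpoint Ck_on (A : set plane) (m : nat) (f : plane -> R) : Prop :=
  {in A, continuous f} /\
  (if m is m'.+1 then
     forall k : 'I_2,
       (forall x, A x -> derivable f x (basis_vec k)) /\
       Ck_on A m' (partial k f)
   else True).

Definition smooth_on (A : set plane) (f : plane -> R) : Prop :=
  forall m, Ck_on A m f.

Definition test_function (f : plane -> R) : Prop :=
  smooth_on setT f /\
  exists K : set plane,
    [/\ compact K, K `<=` disk & forall x, ~ K x -> f x = 0].

Definition loc_integrable (f : plane -> R) : Prop :=
  measurable_fun disk f /\
  forall K : set plane, compact K -> K `<=` disk ->
    dx.-integrable K (EFin \o f).

Definition square_integrable (m n : nat) (F : plane -> 'M[R]_(m, n)) : Prop :=
  forall i j, measurable_fun disk (fun x => F x i j) /\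
    dx.-integrable disk (fun x => (F x i j ^+ 2)%:E).

Section Maps.
Context {n : nat}.

Definition is_wgrad (u : plane -> 'rV[R]_n) (G : plane -> 'M[R]_(n, 2)) :
    Prop :=
  forall (i : 'I_n) (k : 'I_2),
    [/\ loc_integrable (fun x => u x 0 i),
        loc_integrable (fun x => G x i k) &
        forall f, test_function f ->
          \int[dx]_(x in disk) (u x 0 i * partial k f x) =
          - \int[dx]_(x in disk) (G x i k * f x)].

(* The weak differential Du, determined up to a null set; it is the zero map
   if u has none. *)
Definition wgrad (u : plane -> 'rV[R]_n) : plane -> 'M[R]_(n, 2) :=
  xget (fun=> 0) [set G | is_wgrad u G].

Definition W12 (u : plane -> 'rV[R]_n) : Prop :=
  square_integrable u /\
  exists G, is_wgrad u G /\ square_integrable G.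

Definition W12norm (u : plane -> 'rV[R]_n) : R :=
  Num.sqrt (\int[dx]_(x in disk) (sqnorm (u x) + sqnorm (wgrad u x))).

Definition W12_dual (l : (plane -> 'rV[R]_n) -> R) : Prop :=
  (forall (a : R) u v, W12 u -> W12 v ->
     l (fun x => a *: u x + v x) = a * l u + l v) /\
  exists C : R, forall u, W12 u -> `|l u| <= C * W12norm u.

Definition weak_cvg_W12 (u_ : nat -> plane -> 'rV[R]_n)
    (u : plane -> 'rV[R]_n) : Prop :=
  [/\ forall j, W12 (u_ j), W12 u &
      forall l, W12_dual l -> (fun j => l (u_ j)) @ \oo --> l u].

(* Squared distance in L^2 of the circle. *)
Definition circle_dist2 (f g : plane -> 'rV[R]_n) : \bar R :=
  (\int[@lebesgue_measure R]_(t in [set` `[0, 2 * pi]%R])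
     (sqnorm (f (angle t) - g (angle t)))%:E)%E.

(* [is_trace u g] : the Sobolev trace of u on the circle is the restriction of
   g, almost everywhere.  The trace operator is the continuous extension to
   W^{1,2} of the restriction of functions that are smooth up to the boundary. *)
Definition is_trace (u g : plane -> 'rV[R]_n) : Prop :=
  [/\ W12 u,
      forall i, measurable_fun `[0, 2 * pi] (fun t : R => g (angle t) 0 i) &
      exists w : nat -> plane -> 'rV[R]_n,
        [/\ forall m i, smooth_on setT (fun x => w m x 0 i),
            (fun m => W12norm (fun x => w m x - u x)) @ \oo --> (0 : R) &
            (fun m => circle_dist2 (w m) g) @ \oo --> 0%E]].

Definition area (u : plane -> 'rV[R]_n) : \bar R :=
  (\int[dx]_(x in disk)
     (Num.sqrt (\det ((wgrad u x)^T *m wgrad u x)))%:E)%E.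

Definition harmonic (u : plane -> 'rV[R]_n) : Prop :=
  forall i, let f := fun x => u x 0 i in
    Ck_on disk 2 f /\
    forall x, disk x -> \sum_(k < 2) partial k (partial k f) x = 0.

Definition jacobian_mx (u : plane -> 'rV[R]_n) (x : plane) : 'M[R]_(n, 2) :=
  \matrix_(i, k) partial k (fun y => u y 0 i) x.

(* |u_x| = |u_y| and <u_x, u_y> = 0. *)
Definition weakly_conformal (u : plane -> 'rV[R]_n) : Prop :=
  forall x, disk x ->
    let g := (jacobian_mx u x)^T *m jacobian_mx u x in
    g 0 0 = g 1 1 /\ g 0 1 = 0.

(* A weakly monotone map of the circle goes around once in a constant
   direction, possibly standing still: in the angular coordinate it lifts to a
   continuous monotone function whose variation over a period is 2 pi. *)
Definition weakly_monotone (phi : plane -> plane) : Prop :=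
  exists theta : R -> R,
    [/\ continuous theta,
        forall t, phi (angle t) = angle (theta t) &
        ({homo theta : s t / s <= t} /\
         forall t, theta (t + 2 * pi) = theta t + 2 * pi) \/
        ({homo theta : s t / s <= t >-> t <= s} /\
         forall t, theta (t + 2 * pi) = theta t - 2 * pi)].

Definition spans (c : plane -> 'rV[R]_n) (u : plane -> 'rV[R]_n) : Prop :=
  [/\ {within cdisk, continuous u}, W12 u &
      exists phi : plane -> plane,
        [/\ {within circle, continuous phi},
            phi @` circle = circle,
            weakly_monotone phi &
            forall x, circle x -> u x = c (phi x)]].

Definition douglas_minimizer (c u : plane -> 'rV[R]_n) : Prop :=
  [/\ spans c u, harmonic u, weakly_conformal u &
      forall w, spans c w -> (area u <= area w)%E].

End Maps.

(* A curve is a function of the point (cos t, sin t) of the circle. *)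
Definition lifted_curve (gamma : plane -> plane) (eps : R) :
    plane -> 'rV[R]_4 :=
  fun x => \row_(i < 4) [:: (gamma x).1; (gamma x).2; eps * x.1; eps * x.2]`_i.

End Plane.

(* Main.v *)
Require Import Defs.
From HB Require Import structures.
From mathcomp Require Import all_boot all_order all_algebra.
From mathcomp Require Import all_classical all_reals all_analysis.
From mathcomp Require Import measurable_realfun.
From mathcomp Require Import ring lra.

Set Implicit Arguments.
Unset Strict Implicit.
Unset Printing Implicit Defensive.

Import Order.TTheory GRing.Theory Num.Theory.
Import numFieldNormedType.Exports.

Local Open Scope classical_set_scope.
Local Open Scope ring_scope.

(** Write J(A) = sqrt (det (A^T A)) for the area integrand ([jac] below), u_j
    for the minimizers, u0 for their weak limit and D for weak gradients.

    The minimizers are compared with interior variations only.  If z is of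
    class C^1 with compact support in the disk, then u_j + z has the boundary
    values of u_j, so it spans the same curve and the integral of J(Du_j) is at
    most the integral of J(Du_j + Dz).  Here j tends to infinity while z stays
    fixed.  Weak convergence of the gradients does not allow this by itself,
    since J is not weakly continuous; the minimizers, however, are harmonic.
    A derivative of a harmonic function is at every point its own average
    against a bounded kernel ([mean_value], [harmonic_kernel]).  Weak
    convergence therefore yields pointwise convergence of Du_j, with bounds that
    are uniform on every smaller disk, and the pointwise limit is Du0 almost
    everywhere ([limit_gradient_ae]).  The bounds need a uniform estimate for
    the energies: by conformality |Du_j|^2 = 2 J(Du_j), and the area of u_j is
    at most that of a Lipschitz disk obtained by extending gamma
    ([minimizers_energy_bound]).  As J(Du_j + Dz) - J(Du_j) vanishes off the
    support of z, dominated convergence shows that the integral of J(Du0) is at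
    most the integral of J(Du0 + Dz) ([interior_minimality]).

    A Lipschitz map v with the trace of u0 is then reached by such variations:
    v - u0 has zero trace, so that Dv - Du0 is a limit of gradients Dz in the
    mean square.  Indeed v is a uniform limit of C^1 functions whose gradients
    converge to Dv in the mean square ([lipschitz_gradient]), the definition of
    the trace provides smooth maps that approximate u0, and the differences f_n
    of the two have boundary values tending to zero in the mean square.
    Multiplying f_n by a cutoff that drops to zero in a collar of the circle of
    width d costs the integral of f_n^2 / d^2 over the collar; a Hardy inequality
    ([hardy]) bounds this by the boundary values of f_n and by its energy in the
    collar, and both can be made small ([zero_trace_approx]).  The integral of J
    is continuous under convergence of gradients in the mean square
    ([jac_perturbation]), so the inequality for Dz becomes area u0 <= area v. *)

(** * Elementary inequalities *)

Section Arithmetic.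
Context {R : realFieldType}.

Lemma sqr_triangle3 (a b c e : R) : a = b + c - e ->
  a ^+ 2 <= 3 * (b ^+ 2 + c ^+ 2 + e ^+ 2).
Proof.
move=> ->; have := sqr_ge0 (b - c); have := sqr_ge0 (b + e).
have := sqr_ge0 (c + e); lra.
Qed.

(** The error of a gradient after the cutoff: eta and zeta stand for the cutoff
    and its derivative, s for the weight of the collar. *)
Lemma cutoff_pointwise (g h f eta zeta s q : R) :
  (1 - eta) ^+ 2 <= 2 * s -> zeta ^+ 2 <= q * s ->
  (h - (eta * g + f * zeta)) ^+ 2 <=
  3 * (g - h) ^+ 2 + (6 * (s * g ^+ 2) + 3 * q * (s * f ^+ 2)).
Proof.
move=> h1 h2.
apply: le_trans (@sqr_triangle3 _ (h - g) ((1 - eta) * g) (f * zeta) _) _.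
  by ring.
have : (1 - eta) ^+ 2 * g ^+ 2 <= 2 * s * g ^+ 2 by rewrite ler_wpM2r ?sqr_ge0.
have : zeta ^+ 2 * f ^+ 2 <= q * s * f ^+ 2 by rewrite ler_wpM2r ?sqr_ge0.
rewrite -(sqrrN (h - g)) opprB !exprMn.
lra.
Qed.

Lemma collar_pointwise (s a b : R) : 0 <= s -> s <= 1 ->
  s * a ^+ 2 <= 2 * (a - b) ^+ 2 + 2 * (s * b ^+ 2).
Proof.
move=> s0 s1.
have : 0 <= (1 - s) * (a - b) ^+ 2 by rewrite mulr_ge0 ?subr_ge0 ?sqr_ge0.
have : 0 <= s * (a - 2 * b) ^+ 2 by rewrite mulr_ge0 ?sqr_ge0.
lra.
Qed.

Lemma hardy_arith (c d L A G0 G1 : R) : 0 < d -> 0 < c -> L < c * d ->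
  G0 + G1 <= 8 * c -> A <= 10 * d * L + 4 * d ^+ 2 * (G0 + G1) ->
  A <= d ^+ 2 * (42 * c).
Proof.
move=> d0 c0 hL hG hA.
have d20 : 0 <= 4 * d ^+ 2 by rewrite mulr_ge0 ?sqr_ge0.
have t1 : 10 * d * L <= 10 * d * (c * d) by rewrite ler_wpM2l ?(ltW hL)// mulr_ge0// ltW.
have t2 : 4 * d ^+ 2 * (G0 + G1) <= 4 * d ^+ 2 * (8 * c) by rewrite ler_wpM2l.
apply: (le_trans hA); lra.
Qed.

Lemma sum_arith (c e G qA : R) : 0 < c -> e < c -> G <= 4 * c ->
  qA <= 512 * (42 * c) -> 3 * e + (6 * G + 3 * qA) < 10 ^+ 5 * c.
Proof. lra. Qed.

End Arithmetic.

Lemma sqr_triangle2 (R : realFieldType) (a b c p q : R) : (a - c) ^+ 2 <= p -> (b - c) ^+ 2 <= q ->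
  (a - b) ^+ 2 <= 2 * p + 2 * q.
Proof.
have -> : (a - b) ^+ 2 = 2 * (a - c) ^+ 2 + 2 * (b - c) ^+ 2 - ((a - c) + (b - c)) ^+ 2 by ring.
by have := sqr_ge0 ((a - c) + (b - c)); lra.
Qed.

(** Instead of a minimizing ratio s / t, which would require p or r to be
    nonzero, the pairs (r, -q), (q, -p) and (1, -q) are tested. *)
Lemma quadratic_discriminant (R : realFieldType) (p q r : R) :
  (forall s t, 0 <= p * s ^+ 2 + 2 * q * s * t + r * t ^+ 2) -> q ^+ 2 <= p * r.
Proof.
move=> h; have h10 := h 1 0; have h01 := h 0 1.
have h1 := h r (- q); have h2 := h q (- p); have h3 := h 1 (- q).
have [r0|r0] := ltP 0 r.
  by rewrite -(ler_pM2l r0); nra.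
have [p0|p0] := ltP 0 p.
  by rewrite -(ler_pM2l p0); nra.
have er : r = 0 by lra.
have ep : p = 0 by lra.
by subst r p; nra.
Qed.

(** * Real-valued integrals and square integrable functions *)

Section RealIntegral.
Context d (T : measurableType d) (R : realType).
Variables (mu : {measure set T -> \bar R}) (D : set T).
Hypothesis mD : measurable D.

Local Notation intg f := (mu.-integrable D (EFin \o f)).
Local Notation I f := (\int[mu]_(x in D) f x).
Implicit Types f g h : T -> R.

Lemma intg_measurable f : intg f -> measurable_fun D f.
Proof. by move=> /measurable_int/measurable_EFinP. Qed.

Lemma intgD f g : intg f -> intg g -> intg (fun x => f x + g x).
Proof.
move=> If Ig; apply: (eq_integrable mD (((EFin \o f) \+ (EFin \o g))%E)) => //.
exact: integrableD.
Qed.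

Lemma intgZ (k : R) f : intg f -> intg (fun x => k * f x).
Proof.
move=> If; apply: (eq_integrable mD ((fun x => k%:E * (EFin \o f) x)%E)) => //.
exact: integrableZl.
Qed.

Lemma intgN f : intg f -> intg (fun x => - f x).
Proof.
move=> If; apply: (eq_integrable mD (EFin \o (fun x => -1 * f x))).
  by move=> x _ /=; rewrite mulN1r.
exact: intgZ.
Qed.

Lemma intgB f g : intg f -> intg g -> intg (fun x => f x - g x).
Proof. by move=> If Ig; apply: intgD => //; exact: intgN. Qed.

Lemma intg_le f g : measurable_fun D f -> (forall x, D x -> `|f x| <= g x) ->
  intg g -> intg f.
Proof.
move=> mf fg; apply: le_integrable => //; first exact/measurable_EFinP.
move=> x Dx /=; rewrite lee_fin (le_trans (fg _ Dx)) //.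
exact: ler_norm.
Qed.

Lemma intg_bounded f (M : R) : (mu D < +oo)%E -> measurable_fun D f ->
  (forall x, D x -> `|f x| <= M) -> intg f.
Proof.
move=> fD mf bf; apply: measurable_bounded_integrable => //.
exists M; split; first exact: num_real.
by move=> y My x Dx; exact: le_trans (bf _ Dx) (ltW My).
Qed.

Lemma intgM_bounded f g (M : R) : measurable_fun D f ->
  (forall x, D x -> `|f x| <= M) -> intg g -> intg (fun x => f x * g x).
Proof.
move=> mf bf Ig; apply: (@intg_le _ (fun x => M * `|g x|)).
- by apply: measurable_funM => //; exact: intg_measurable.
- by move=> x Dx; rewrite normrM ler_wpM2r// bf.
- by apply: intgZ; exact: integrable_norm.
Qed.

Lemma ID f g : intg f -> intg g -> I (fun x => f x + g x) = I f + I g.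
Proof. exact: RintegralD. Qed.

Lemma IB f g : intg f -> intg g -> I (fun x => f x - g x) = I f - I g.
Proof. exact: RintegralB. Qed.

Lemma IZ k f : intg f -> I (fun x => k * f x) = k * I f.
Proof. by move=> If; rewrite RintegralZl. Qed.

Lemma le_I f g : intg f -> intg g -> (forall x, D x -> f x <= g x) ->
  I f <= I g.
Proof. exact: le_Rintegral. Qed.

Lemma I_ge0 f : (forall x, D x -> 0 <= f x) -> 0 <= I f.
Proof. exact: Rintegral_ge0. Qed.

Lemma I_norm f : intg f -> `|I f| <= I (fun x => `|f x|).
Proof. exact: le_normr_Rintegral. Qed.

Lemma eq_I f g : (forall x, D x -> f x = g x) -> I f = I g.
Proof. by move=> fg; apply: eq_Rintegral => x /set_mem/fg. Qed.

Lemma eq_intg f g : (forall x, D x -> f x = g x) -> intg f -> intg g.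
Proof.
by move=> fg; apply: eq_integrable => // x /set_mem Dx; congr EFin; exact: fg.
Qed.

Lemma ae_eq_I f g : measurable_fun D f -> measurable_fun D g ->
  ae_eq mu D f g -> I f = I g.
Proof.
move=> mf mg fg; rewrite /Rintegral; congr fine.
apply: ae_eq_integral => //; [exact/measurable_EFinP.. |].
by move: fg; apply: filterS => x fg Dx; rewrite /= fg.
Qed.

Lemma ae_intg f g : measurable_fun D g -> ae_eq mu D f g -> intg f -> intg g.
Proof.
move=> mg fg If; have mf := intg_measurable If.
apply/integrableP; split; first exact/measurable_EFinP.
move/integrableP : If => [_]; congr (_ < _)%E.
apply: ae_eq_integral => //; [apply: measurableT_comp => //; exact/measurable_EFinP..|].
by move: fg; apply: filterS => x fg Dx; rewrite /= fg.
Qed.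

Lemma EFin_I f : intg f -> (I f)%:E = (\int[mu]_(x in D) (f x)%:E)%E.
Proof. by move=> If; rewrite /Rintegral fineK//; exact: integrable_fin_num. Qed.

Definition sqint f := measurable_fun D f /\ intg (fun x => f x ^+ 2).

Lemma sqint_bounded f (M : R) : (mu D < +oo)%E -> measurable_fun D f ->
  (forall x, D x -> `|f x| <= M) -> sqint f.
Proof.
move=> fD mf bf; split => //; apply: (@intg_bounded _ (M ^+ 2)) => //.
  exact: measurable_funX.
by move=> x Dx; rewrite normrX lerXn2r ?nnegrE ?(le_trans _ (bf _ Dx)) ?bf.
Qed.

Lemma sqintM f g : sqint f -> sqint g -> intg (fun x => f x * g x).
Proof.
move=> [mf If] [mg Ig]; apply: (@intg_le _ (fun x => f x ^+ 2 + g x ^+ 2)).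
- exact: measurable_funM.
- by move=> x Dx; rewrite ler_norml; apply/andP; split; nra.
- exact: intgD.
Qed.

Lemma sqintD f g : sqint f -> sqint g -> sqint (fun x => f x + g x).
Proof.
move=> Sf Sg; have [mf If] := Sf; have [mg Ig] := Sg.
split; first exact: measurable_funD.
apply: (@eq_intg (fun x => f x ^+ 2 + (2 * (f x * g x) + g x ^+ 2))).
  by move=> x _; ring.
by do 2 apply: intgD => //; apply: intgZ; exact: sqintM.
Qed.

Lemma sqintZ k f : sqint f -> sqint (fun x => k * f x).
Proof.
move=> [mf If]; split; first exact: measurable_funM.
apply: (@eq_intg (fun x => k ^+ 2 * f x ^+ 2)); first by move=> x _; ring.
exact: intgZ.
Qed.

Lemma sqintN f : sqint f -> sqint (fun x => - f x).
Proof.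
move=> [mf If]; split; first exact: measurable_funN.
by apply: eq_intg If => x _; rewrite sqrrN.
Qed.

Lemma sqintB f g : sqint f -> sqint g -> sqint (fun x => f x - g x).
Proof. by move=> Sf Sg; apply: sqintD => //; exact: sqintN. Qed.

Lemma ae_sqint f g : measurable_fun D g -> ae_eq mu D f g ->
  sqint f -> sqint g.
Proof.
move=> mg fg [mf If]; split => //; apply: ae_intg If.
  exact: measurable_funX.
by move: fg; apply: filterS => x fg Dx; rewrite /= fg.
Qed.

Lemma sqint_intg f : (mu D < +oo)%E -> sqint f -> intg f.
Proof.
move=> fD Sf; apply: (@eq_intg (fun x => f x * 1)).
  by move=> x _; rewrite mulr1.
apply: sqintM => //; apply: (@sqint_bounded _ 1) => //.
by move=> x _; rewrite normr1.
Qed.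

(** The integral of (s f + t g)^2 is a nonnegative quadratic form in s and t. *)
Lemma cauchy_schwarz_I f g : sqint f -> sqint g ->
  I (fun x => f x * g x) ^+ 2 <=
  I (fun x => f x ^+ 2) * I (fun x => g x ^+ 2).
Proof.
move=> Sf Sg; have [_ If] := Sf; have [_ Ig] := Sg; have Ifg := sqintM Sf Sg.
apply: quadratic_discriminant => s t.
have J1 := intgZ (s ^+ 2) If; have J2 := intgZ (2 * s * t) Ifg; have J3 := intgZ (t ^+ 2) Ig.
have <- : I (fun x => s ^+ 2 * f x ^+ 2 + 2 * s * t * (f x * g x) + t ^+ 2 * g x ^+ 2) =
    I (fun x => f x ^+ 2) * s ^+ 2 + 2 * I (fun x => f x * g x) * s * t +
    I (fun x => g x ^+ 2) * t ^+ 2.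
  by rewrite (ID (intgD J1 J2) J3) (ID J1 J2) !IZ//; ring.
apply: I_ge0 => x _; have := sqr_ge0 (s * f x + t * g x).
by congr (_ <= _); ring.
Qed.

Lemma I_dominated (f_ : nat -> T -> R) (f g : T -> R) :
  (forall n, measurable_fun D (f_ n)) -> measurable_fun D f ->
  {ae mu, forall x, D x -> f_ n x @[n --> \oo] --> f x} ->
  intg g -> (forall n x, D x -> `|f_ n x| <= g x) ->
  intg f /\ (fun n => I (f_ n)) @ \oo --> I f.
Proof.
move=> mf_ mf cv ig bd.
have mF_ n : measurable_fun D (EFin \o f_ n) by exact/measurable_EFinP.
have mF : measurable_fun D (EFin \o f) by exact/measurable_EFinP.
have cvF : {ae mu, forall x, D x -> (EFin \o f_ n) x @[n --> \oo] --> (EFin \o f) x}.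
  move: cv; apply: filterS => x /[apply] cx.
  by apply/fine_cvgP; split; [exact: nearW|].
have bdF : {ae mu, forall x, forall n, D x -> (`|(EFin \o f_ n) x| <= (EFin \o g) x)%E}.
  by apply: aeW => x n Dx; rewrite /= lee_fin; exact: bd.
have [If _ cI] := dominated_convergence mD mF_ mF cvF ig bdF.
split=> //.
have : (fun n => fine (\int[mu]_(x in D) (EFin \o f_ n) x)%E) @ \oo --> I f.
  apply: fine_cvg; rewrite (EFin_I If); exact: cI.
by [].
Qed.

End RealIntegral.

Lemma I_sum d (T : measurableType d) (R : realType) (mu : {measure set T -> \bar R})
    (D : set T) (J : Type) (s : seq J) (f : J -> T -> R) : measurable D ->
  (forall j, mu.-integrable D (EFin \o f j)) ->
  mu.-integrable D (EFin \o (fun x => \sum_(j <- s) f j x)) /\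
  \int[mu]_(x in D) (\sum_(j <- s) f j x) = \sum_(j <- s) \int[mu]_(x in D) f j x.
Proof.
move=> mD jf; elim: s => [|j s [IH1 IH2]].
  have -> : (fun x => \sum_(j <- [::]) f j x) = (fun=> 0).
    by apply/funext => x; rewrite big_nil.
  by rewrite big_nil /Rintegral integral0; split=> //; exact: integrable0.
have -> : (fun x => \sum_(i <- j :: s) f i x) = (fun x => f j x + \sum_(i <- s) f i x).
  by apply/funext => x; rewrite big_cons.
by rewrite big_cons (ID mD (jf j) IH1) IH2; split=> //; exact: intgD.
Qed.

Lemma ae_eq_family d (T : measurableType d) (R : realType) (mu : {measure set T -> \bar R})
    (D : set T) (I J : finType) (V : Type) (f g : I -> J -> T -> V) :
  (forall i j, ae_eq mu D (f i j) (g i j)) ->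
  {ae mu, forall x, D x -> forall i j, f i j x = g i j x}.
Proof.
move=> h; suff : {ae mu, forall x, forall i j, D x -> f i j x = g i j x}.
  by apply: filterS => x hx Dx i j; exact: hx.
by apply: filter_forall => i; apply: filter_forall => j; exact: h.
Qed.

Lemma lipschitz_const (R : realType) (V W : normedModType R) (f : V -> W) (A : set V) :
  [lipschitz f x | x in A] ->
  exists2 L : R, 1 <= L & forall x y, A x -> A y -> `|f x - f y| <= L * `|x - y|.
Proof.
move=> [M [_ HM]]; exists (Num.max M 0 + 1); first by rewrite lerDr le_max lexx orbT.
move=> x y Ax Ay; apply: (HM (Num.max M 0 + 1) _ (x, y)); last by split.
by rewrite ltr_pwDr// le_max lexx.
Qed.

(** * The disk and functions of class C^1 *)

Section Plane.
Context {R : realType}.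
Local Notation plane := (R * R)%type.
Local Notation mplane := (measurableTypeR R * measurableTypeR R)%type.
Local Notation leb := (@lebesgue_measure R).
Local Notation mu2 := ((@lebesgue_measure R) \x (@lebesgue_measure R))%E.
Local Notation I f := (\int[mu2]_(x in disk) f x).
Local Notation sqintD2 f := (sqint mu2 disk f).
Local Notation pi := (@trigo.pi R).

Lemma ord2P (k : 'I_2) : k = ord0 \/ k = 1.
Proof. by case: k => [[|[|]]]//= ?; [left|right]; exact/val_inj. Qed.

(** The squares with rational centers and radii 1 / (n + 1) that are contained
    in an open set cover it, and there are countably many of them. *)
Lemma open_measurable_plane (A : set plane) : open A -> measurable A.
Proof.
move=> oA.
pose sq (i : rat * rat * nat) : set plane :=
  ball (ratr i.1.1 : R) i.2.+1%:R^-1 `*` ball (ratr i.1.2 : R) i.2.+1%:R^-1.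
pose F i := if `[< sq i `<=` A >] then sq i else set0.
have -> : A = \bigcup_i F i.
  apply/seteqP; split=> [[x y] Axy|z [i _]]; last first.
    by rewrite /F; case: asboolP => // + Fz; exact.
  have /nbhs_ballP[e /= e0 eA] : nbhs (x, y) A by exact: open_nbhs_nbhs.
  have [n ne] : exists n, 2 * n.+1%:R^-1 < e.
    have e2 : 0 < e / 2 by rewrite divr_gt0.
    have [n _ /(_ n (leqnn n)) /= h] := near_infty_natSinv_lt (PosNum e2).
    by exists n; rewrite mulrC -ltr_pdivlMr.
  have n0 : 0 < n.+1%:R^-1 :> R by rewrite invr_gt0.
  have [p xp] : exists p : rat, ball (ratr p : R) n.+1%:R^-1 x.
    have h : ball x n.+1%:R^-1 !=set0 by exists x; exact: ballxx.
    have [z [bz [p _ pz]]] := @dense_rat R _ h (@ball_open _ _ _ _).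
    by exists p; rewrite pz; exact: ball_sym.
  have [q yq] : exists q : rat, ball (ratr q : R) n.+1%:R^-1 y.
    have h : ball y n.+1%:R^-1 !=set0 by exists y; exact: ballxx.
    have [z [bz [q _ pz]]] := @dense_rat R _ h (@ball_open _ _ _ _).
    by exists q; rewrite pz; exact: ball_sym.
  exists (p, q, n) => //; rewrite /F asboolT//.
  move=> [x' y'] [/= x'p y'q]; apply: eA; split=> /=.
    apply: le_ball (ltW ne) _ _; rewrite mulrDl mul1r.
    by apply: ball_triangle x'p; exact: ball_sym.
  apply: le_ball (ltW ne) _ _; rewrite mulrDl mul1r.
  by apply: ball_triangle y'q; exact: ball_sym.
apply: countable_bigcupT_measurable => // i.
rewrite /F; case: ifP => // _; apply: measurableX; exact: measurable_ball.
Qed.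

Lemma cont_measurable (A : set plane) (f : plane -> R) : open A ->
  {in A, continuous f} -> measurable_fun A f.
Proof.
move=> oA; rewrite -(continuous_open_subspace f oA) => /continuousP cf.
apply: (measurability _ (RGenOpens.measurableE R)).
move=> _ [_ [a [b ->] <-]].
have /open_subspaceP[V oV VA] := cf _ (@interval_open R (BRight a) (BLeft b) erefl erefl).
rewrite setIC -VA; apply: measurableI; exact: open_measurable_plane.
Qed.

Lemma cont_fst : continuous (@fst R R).
Proof. by move=> x; exact: cvg_fst. Qed.

Lemma cont_snd : continuous (@snd R R).
Proof. by move=> x; exact: cvg_snd. Qed.

Lemma cont_sqr (f : plane -> R) : continuous f -> continuous (fun x => f x ^+ 2).
Proof. by move=> cf x; apply: cvgM; exact: cf. Qed.

Lemma cont_rad : continuous (fun x : plane => x.1 ^+ 2 + x.2 ^+ 2).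
Proof.
by move=> x; apply: cvgD; apply: cont_sqr; [exact: cont_fst|exact: cont_snd].
Qed.

Lemma disk_open : open (@disk R).
Proof.
have -> : @disk R = (fun x => x.1 ^+ 2 + x.2 ^+ 2) @^-1` [set r | r < 1] by [].
apply: open_comp; last exact: open_lt.
by move=> x _; exact: cont_rad.
Qed.

Lemma disk_measurable :
  measurable (@disk R : set (measurableTypeR R * measurableTypeR R)).
Proof. by apply: open_measurable_plane; exact: disk_open. Qed.

Lemma disk_bound (x : plane) : disk x -> `|x.1| <= 1 /\ `|x.2| <= 1.
Proof.
by rewrite /disk /= => h; split; rewrite ler_norml; apply/andP; split; nra.
Qed.

Lemma disk_finite : (mu2 (@disk R) < +oo)%E.
Proof.
have m1 : measurable (`[-1, 1]%classic : set R) by exact: measurable_itv.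
apply: (@le_lt_trans _ _ (mu2 (`[-1, 1]%classic `*` `[-1, 1]%classic))).
  apply: le_measure; rewrite ?inE.
  - exact: disk_measurable.
  - exact: measurableX.
  move=> x /disk_bound[]; rewrite !ler_norml => h1 h2.
  by split; rewrite /= in_itv.
rewrite product_measure1E//= lebesgue_measure_itv/=.
by case: ifP => _; rewrite ?mule0// -EFinD -EFinM ltry.
Qed.

Let mD := disk_measurable.
Let fD := disk_finite.

Lemma cont_itv_intg (p : R -> R) (a b : R) : continuous p ->
  leb.-integrable `[a, b] (EFin \o p).
Proof.
move=> cp; apply: continuous_compact_integrable; first exact: segment_compact.
exact: continuous_subspaceT.
Qed.

Lemma derive_cont (phi phi' : R -> R) :
  (forall t : R, is_derive t (1 : R) phi (phi' t)) -> continuous phi.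
Proof.
move=> d t; apply: differentiable_continuous; apply/derivable1_diffP.
by have [] := d t.
Qed.

Lemma derive_LR (phi phi' : R -> R) (a b : R) :
  (forall t : R, is_derive t (1 : R) phi (phi' t)) -> derivable_oo_LRcontinuous phi a b.
Proof.
move=> d; have c := derive_cont d; split; first by move=> t _; have [] := d t.
- by apply: cvg_at_right_filter; exact: c.
- by apply: cvg_at_left_filter; exact: c.
Qed.

Section C1.
Implicit Types (A B : set plane) (f : plane -> R) (g : 'I_2 -> plane -> R).

(** The partial derivatives are carried along as functions, so that explicit
    formulas for them pass through sums, products and compositions. *)
Definition is_C1 A f g :=
  [/\ {in A, continuous f}, forall k, {in A, continuous (g k)} &
      forall k x, A x -> is_derive x (basis_vec k) f (g k x)].

Lemma Ck_is_C1 A f : Ck_on A 1 f -> is_C1 A f (fun k => partial k f).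
Proof.
move=> [cf h]; split=> // k; first by have [_ []] := h k.
move=> x Ax; have [d _] := h k; exact/derivableP/d.
Qed.

Lemma is_C1_partial A f g k x : is_C1 A f g -> A x -> partial k f x = g k x.
Proof. by move=> [_ _ d] Ax; rewrite /partial; have [] := d k x Ax. Qed.

Lemma is_C1_sub A B f g : B `<=` A -> is_C1 A f g -> is_C1 B f g.
Proof.
move=> BA [cf cg d]; split.
- by move=> x xB; apply: cf; move: xB; rewrite !inE => /BA.
- by move=> k x xB; apply: cg; move: xB; rewrite !inE => /BA.
- by move=> k x /BA; exact: d.
Qed.

Lemma is_C1_eq A f g g' : (forall k x, g k x = g' k x) -> is_C1 A f g ->
  is_C1 A f g'.
Proof.
move=> e; have -> // : g = g'.
by apply/funext => k; apply/funext => x.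
Qed.

Lemma is_C1_cst A (c : R) : is_C1 A (fun=> c) (fun _ _ => 0).
Proof.
split=> [x _|k x _|k x _]; [exact: cvg_cst..|].
exact: is_derive_cst.
Qed.

Lemma is_C1_fst A : is_C1 A fst (fun k _ => (basis_vec k).1).
Proof.
split=> [x _|k x _|k x _]; [exact: cont_fst|exact: cvg_cst|].
have d : differentiable (@fst R R) x.
  by apply: (@linear_differentiable _ _ _ (@fst R R)); exact: cont_fst.
apply: DeriveDef; first exact: diff_derivable.
by rewrite deriveE// diff_lin//; exact: cont_fst.
Qed.

Lemma is_C1_snd A : is_C1 A snd (fun k _ => (basis_vec k).2).
Proof.
split=> [x _|k x _|k x _]; [exact: cont_snd|exact: cvg_cst|].
have d : differentiable (@snd R R) x.
  by apply: (@linear_differentiable _ _ _ (@snd R R)); exact: cont_snd.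
apply: DeriveDef; first exact: diff_derivable.
by rewrite deriveE// diff_lin//; exact: cont_snd.
Qed.

Lemma is_C1D A f1 g1 f2 g2 : is_C1 A f1 g1 -> is_C1 A f2 g2 ->
  is_C1 A (fun x => f1 x + f2 x) (fun k x => g1 k x + g2 k x).
Proof.
move=> [c1 cg1 d1] [c2 cg2 d2]; split=> [x Ax|k x Ax|k x Ax].
- exact: cvgD (c1 x Ax) (c2 x Ax).
- exact: cvgD (cg1 k x Ax) (cg2 k x Ax).
- exact: is_deriveD (d1 k x Ax) (d2 k x Ax).
Qed.

Lemma is_C1M A f1 g1 f2 g2 : is_C1 A f1 g1 -> is_C1 A f2 g2 ->
  is_C1 A (fun x => f1 x * f2 x) (fun k x => f1 x * g2 k x + f2 x * g1 k x).
Proof.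
move=> [c1 cg1 d1] [c2 cg2 d2]; split=> [x Ax|k x Ax|k x Ax].
- exact: cvgM (c1 x Ax) (c2 x Ax).
- by apply: cvgD; apply: cvgM; [exact: c1|exact: cg2|exact: c2|exact: cg1].
- exact: is_deriveM (d1 k x Ax) (d2 k x Ax).
Qed.

Lemma is_C1Z A (c : R) f g : is_C1 A f g ->
  is_C1 A (fun x => c * f x) (fun k x => c * g k x).
Proof.
move=> C; apply: is_C1_eq (is_C1M (is_C1_cst A c) C) => k x.
by rewrite mulr0 addr0.
Qed.

Lemma is_C1B A f1 g1 f2 g2 : is_C1 A f1 g1 -> is_C1 A f2 g2 ->
  is_C1 A (fun x => f1 x - f2 x) (fun k x => g1 k x - g2 k x).
Proof.
move=> [c1 cg1 d1] [c2 cg2 d2]; split=> [x Ax|k x Ax|k x Ax].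
- exact: cvgB (c1 x Ax) (c2 x Ax).
- exact: cvgB (cg1 k x Ax) (cg2 k x Ax).
- exact: is_deriveB (d1 k x Ax) (d2 k x Ax).
Qed.

(** This gives access to the calculus of one variable, notably the chain rule. *)
Lemma is_derive_line (V : normedModType R) (f : V -> R) (x v : V) (a : R) :
  is_derive x v f a <-> is_derive (0 : R) 1 (fun h : R => f (h *: v + x)) a.
Proof.
have E : 'D_v f x = 'D_1 (fun h : R => f (h *: v + x)) 0.
  rewrite /derive; apply: (f_equal (fun g : R -> R => lim (g @ 0^'))); apply/funext => h /=.
  by rewrite scale0r add0r addr0 /GRing.scale /= mulr1.
split=> -[dv <-].
  by apply: DeriveDef; [exact: (derivable1P f x v).1|rewrite -E].
by apply: DeriveDef; [exact: (derivable1P f x v).2|rewrite E].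
Qed.

Lemma is_C1_comp A f g (phi phi' : R -> R) :
  is_C1 A f g -> continuous phi' ->
  (forall t : R, is_derive t (1 : R) phi (phi' t)) ->
  is_C1 A (fun x => phi (f x)) (fun k x => phi' (f x) * g k x).
Proof.
move=> [cf cg d] cp dp; have cphi := derive_cont dp.
split=> [x Ax|k x Ax|k x Ax].
- by apply: (continuous_comp (cf x Ax)); exact: cphi.
- apply: cvgM; last exact: cg.
  by apply: (continuous_comp (cf x Ax)); exact: cp.
- apply/is_derive_line.
  have /is_derive_line df := d k x Ax.
  have h : is_derive ((fun h : R => f (h *: basis_vec k + x)) 0) 1 phi (phi' (f x)).
    by rewrite /= scale0r add0r; exact: dp.
  exact: is_derive1_comp h df.
Qed.

Lemma is_C1_near A f1 f2 g : open A -> (forall x, A x -> f1 x = f2 x) ->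
  is_C1 A f1 g -> is_C1 A f2 g.
Proof.
move=> oA e [cf cg d].
have nA x : A x -> \near x, f1 x = f2 x.
  move=> Ax; have : nbhs x A by exact: open_nbhs_nbhs.
  by apply: filterS => y /e.
split=> // [x xA|k x Ax].
  have Ax := set_mem xA.
  rewrite /continuous_at -(e _ Ax).
  by apply: cvg_trans (cf x xA); apply: near_eq_cvg; exact: nA.
by apply: near_eq_is_derive (d k x Ax); exact: nA.
Qed.

End C1.

Section PosPow.
Implicit Types (m : nat) (t : R).

(** The power of the positive part.  It is of class C^(m-1), which yields cutoffs
    and kernels with explicit derivatives. *)
Definition ppow m t : R := Num.max t 0 ^+ m.

Lemma ppow_ge0 m t : 0 <= ppow m t.
Proof. by rewrite exprn_ge0// le_max lexx orbT. Qed.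

Lemma ppow_eq0 m t : t <= 0 -> ppow m.+1 t = 0.
Proof. by move=> t0; rewrite /ppow max_r// expr0n. Qed.

Lemma ppowE m t : 0 <= t -> ppow m t = t ^+ m.
Proof. by move=> t0; rewrite /ppow max_l. Qed.

Lemma ppowS m t : ppow m.+2 t = ppow m.+1 t * t.
Proof.
have [t0|/ltW t0] := leP 0 t; first by rewrite !ppowE// [LHS]exprSr.
by rewrite !ppow_eq0// mul0r.
Qed.

Lemma ppow_cont m : continuous (ppow m).
Proof.
move=> t; rewrite /ppow.
have c : {for t, continuous (fun u : R => Num.max u 0)}.
  by apply: continuous_max => //; exact: cvg_cst.
exact: (@continuous_comp _ _ _ (fun u : R => Num.max u 0) (fun y : R => y ^+ m) t c (@exprn_continuous R m _)).
Qed.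

Lemma ppow_derive m t :
  is_derive t (1 : R) (ppow m.+2) (m.+2%:R * ppow m.+1 t).
Proof.
have [t0|t0|t0] := ltgtP t 0.
- rewrite (ppow_eq0 _ (ltW t0)) mulr0.
  apply: (@near_eq_is_derive _ _ _ (cst 0)).
  near=> u; rewrite ppow_eq0// ltW//.
  by near: u; exact: lt_nbhsl.
- rewrite ppowE ?(ltW t0)//.
  have D : is_derive t (1 : R) (fun u : R => u ^+ m.+2) (m.+2%:R * t ^+ m.+1).
    apply: DeriveDef; first exact: exprn_derivable.
    by rewrite exp_derive /GRing.scale /= mulr1.
  apply: near_eq_is_derive D.
  near=> u; rewrite ppowE// ltW//.
  by near: u; exact: lt_nbhsr.
- rewrite t0 ppow_eq0// mulr0.
  (* At 0 the difference quotient is the next lower power. *)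
  apply/is_derive1_caratheodory; exists (ppow m.+1); split.
  + by move=> z; rewrite subr0 ppowS (@ppow_eq0 _ 0)// subr0.
  + exact: ppow_cont.
  + exact: ppow_eq0.
Unshelve. all: by end_near. Qed.

End PosPow.

Definition rad2 (x : plane) : R := x.1 ^+ 2 + x.2 ^+ 2.
Definition odisk r : set plane := [set x | rad2 x < r].
Definition ddisk r : set plane := [set x | rad2 x <= r].

Lemma ddisk_closed r : closed (ddisk r).
Proof.
have -> : ddisk r = rad2 @^-1` [set t | t <= r] by [].
by apply: closed_comp; [move=> x _; exact: cont_rad|exact: closed_le].
Qed.

Lemma odisk_open r : open (odisk r).
Proof.
have -> : odisk r = rad2 @^-1` [set t | t < r] by [].
by apply: open_comp; [move=> x _; exact: cont_rad|exact: open_lt].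
Qed.

Lemma ddisk_compact r : r <= 1 -> compact (ddisk r).
Proof.
move=> r1; pose I := (`[-1, 1]%classic : set R).
have cI : compact (I `*` I) by apply: compact_setX; exact: segment_compact.
apply: (subclosed_compact _ cI); first exact: ddisk_closed.
move=> x; rewrite /ddisk /rad2 /= => h.
by split; rewrite /I /= in_itv /=; apply/andP; split; nra.
Qed.

Lemma ddisk_disk r : r < 1 -> ddisk r `<=` disk.
Proof. by move=> r1 x; rewrite /ddisk /rad2 /disk /= => /le_lt_trans; exact. Qed.

Lemma odisk_ddisk r : odisk r `<=` ddisk r.
Proof. by move=> x /ltW. Qed.

Lemma cont_bounded_compact (K : set plane) (f : plane -> R) : compact K ->
  {in K, continuous f} -> exists M, forall x, K x -> `|f x| <= M.
Proof.
move=> cK cf; have : compact (f @` K).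
  by apply: continuous_compact => //; exact: continuous_in_subspaceT.
by move=> /compact_bounded[M [_ HM]]; exists (M + 1) => x Kx; apply: HM; [rewrite ltrDl|exists x].
Qed.

(** * The divergence theorem on the disk *)

Section Green.
Implicit Types (f F : plane -> R) (G : 'I_2 -> plane -> R).

Lemma cont_bounded_cdisk f : continuous f ->
  exists M, forall x, cdisk x -> `|f x| <= M.
Proof.
by move=> cf; apply: (@cont_bounded_compact (ddisk 1)) => [|x _]; [exact: ddisk_compact|exact: cf].
Qed.

Lemma disk_cdisk : @disk R `<=` cdisk.
Proof. by move=> x /ltW. Qed.

Lemma cont_measurable_disk f : continuous f -> measurable_fun disk f.
Proof.
by move=> cf; apply: cont_measurable; [exact: disk_open|move=> x _; exact: cf].
Qed.

Lemma cont_intg f : continuous f -> mu2.-integrable disk (EFin \o f).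
Proof.
move=> cf; have [M HM] := cont_bounded_cdisk cf.
apply: (@intg_bounded _ _ _ _ _ _ _ M).
- exact: disk_measurable.
- exact: disk_finite.
- exact: cont_measurable_disk.
- by move=> x /disk_cdisk; exact: HM.
Qed.

(** Half the length of the chord of the disk at height y, zero if |y| > 1. *)
Definition halfwidth (y : R) := Num.sqrt (1 - y ^+ 2).

Lemma disk_slice (x y : R) :
  (x ^+ 2 + y ^+ 2 < 1) = (x \in `]- halfwidth y, halfwidth y[).
Proof.
rewrite in_itv /= -ltr_norml /halfwidth -sqrtr_sqr.
have [h|h] := ltP 0 (1 - y ^+ 2); first by rewrite ltr_sqrt// ltrBrDr.
rewrite (ler0_sqrtr h) [RHS]ltNge sqrtr_ge0 /=; apply/negbTE; rewrite -leNgt.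
by have := sqr_ge0 x; lra.
Qed.

Lemma mem_disk (x y : R) :
  ((x, y) \in (disk : set plane)) = (x \in `]- halfwidth y, halfwidth y[).
Proof. by apply/idP/idP; rewrite inE /disk /= disk_slice. Qed.

Lemma disk_sym (x y : R) :
  ((x, y) \in (disk : set plane)) = ((y, x) \in (disk : set plane)).
Proof. by apply/idP/idP; rewrite !inE /disk /= addrC. Qed.

Lemma is_derive_fst F (x y a : R) : is_derive (x, y) (basis_vec ord0) F a ->
  is_derive x (1 : R) (fun t : R => F (t, y)) a.
Proof.
move=> /is_derive_line h; apply/is_derive_line.
suff -> : (fun h : R => F (h *: (1 : R) + x, y)) =
          (fun h : R => F (h *: basis_vec ord0 + (x, y))) by [].
apply/funext => t; congr F; rewrite /basis_vec /=.
by congr (_, _); rewrite /= /GRing.scale /= mulr0 add0r.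
Qed.

Lemma is_derive_snd F (x y a : R) : is_derive (x, y) (basis_vec 1) F a ->
  is_derive y (1 : R) (fun t : R => F (x, t)) a.
Proof.
move=> /is_derive_line h; apply/is_derive_line.
suff -> : (fun h : R => F (x, h *: (1 : R) + y)) =
          (fun h : R => F (h *: basis_vec 1 + (x, y))) by [].
apply/funext => t; congr F; rewrite /basis_vec /=.
by congr (_, _); rewrite /= /GRing.scale /= mulr0 add0r.
Qed.

Lemma ftc_slice (phi phi' : R -> R) (r : R) : 0 <= r -> continuous phi' ->
  (forall t : R, is_derive t (1 : R) phi (phi' t)) ->
  (\int[leb]_(x in [set` `]- r, r[%R]) (phi' x)%:E)%E = (phi r - phi (- r))%:E.
Proof.
rewrite le_eqVlt => /predU1P[<-|r0] cp dp.
  by rewrite oppr0 subrr set_itvoo0 integral_set0.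
have mp : measurable_fun setT phi' by exact: continuous_measurable_fun.
rewrite -(@integral_itv_bndoo _ _ _ _ true false); last first.
  by apply/measurable_EFinP; exact: measurable_funS mp.
have Nrr : - r < r by lra.
rewrite (continuous_FTC2 Nrr (F := phi)).
- by rewrite EFinB.
- by apply: continuous_subspaceT.
- exact: derive_LR dp.
- by move=> t _; rewrite derive1E; have [] := dp t.
Qed.

Lemma cont_pairl (f : plane -> R) (y : R) : continuous f ->
  continuous (fun x => f (x, y)).
Proof.
move=> cf x; apply: (@continuous_comp _ _ _ (fun x => (x, y)) f); last exact: cf.
by apply: (@cvg_pair _ _ _ (nbhs x) (nbhs x) (nbhs y)); [exact: cvg_id|exact: cvg_cst].
Qed.

Lemma cont_pairr (f : plane -> R) (x : R) : continuous f ->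
  continuous (fun y => f (x, y)).
Proof.
move=> cf y; apply: (@continuous_comp _ _ _ (fun y => (x, y)) f); last exact: cf.
by apply: (@cvg_pair _ _ _ (nbhs y) (nbhs x) (nbhs y)); [exact: cvg_cst|exact: cvg_id].
Qed.

Lemma is_C1T F G : is_C1 setT F G ->
  [/\ continuous F, forall k, continuous (G k) &
      forall k x, is_derive x (basis_vec k) F (G k x)].
Proof.
move=> [cF cG d]; split=> [x|k x|k x]; [apply: cF|apply: cG|apply: d] => //.
  by rewrite inE.
by rewrite inE.
Qed.

Lemma fubini_snd (f : plane -> \bar R) : mu2.-integrable setT f ->
  (\int[mu2]_z f z = \int[leb]_y \int[leb]_x f (x, y))%E.
Proof.
move=> h; exact: (esym (integral21_prod_meas1 (m1 := leb) (m2 := leb) h)).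
Qed.

Lemma fubini_fst (f : plane -> \bar R) : mu2.-integrable setT f ->
  (\int[mu2]_z f z = \int[leb]_x \int[leb]_y f (x, y))%E.
Proof.
move=> h; exact: (esym (integral12_prod_meas1 (m1 := leb) (m2 := leb) h)).
Qed.

(** Fubini, and the fundamental theorem of calculus on every chord. *)
Lemma green_fst F G : is_C1 setT F G ->
  (\int[mu2]_(z in disk) (G ord0 z)%:E =
   \int[leb]_y (F (halfwidth y, y) - F (- halfwidth y, y))%:E)%E.
Proof.
move=> /is_C1T[cF cG d].
have := (integrable_mkcond _ disk_measurable).1 (cont_intg (cG ord0)).
move=> /fubini_snd h; rewrite integral_mkcond {}h.
apply: eq_integral => y _.
have /= <- := @ftc_slice (fun t => F (t, y)) (fun t => G ord0 (t, y)) (halfwidth y)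
  (sqrtr_ge0 _) (@cont_pairl _ y (cG ord0)) (fun t => is_derive_fst (d ord0 (t, y))).
rewrite [RHS]integral_mkcond; apply: eq_integral => x _.
by rewrite !patchE mem_disk mem_setE.
Qed.

Lemma green_snd F G : is_C1 setT F G ->
  (\int[mu2]_(z in disk) (G 1 z)%:E =
   \int[leb]_x (F (x, halfwidth x) - F (x, - halfwidth x))%:E)%E.
Proof.
move=> /is_C1T[cF cG d].
have := (integrable_mkcond _ disk_measurable).1 (cont_intg (cG 1)).
move=> /fubini_fst h; rewrite integral_mkcond {}h.
apply: eq_integral => x _.
have /= <- := @ftc_slice (fun t => F (x, t)) (fun t => G 1 (x, t)) (halfwidth x)
  (sqrtr_ge0 _) (@cont_pairr _ x (cG 1)) (fun t => is_derive_snd (d 1 (x, t))).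
rewrite [RHS]integral_mkcond; apply: eq_integral => y _.
by rewrite !patchE disk_sym mem_disk mem_setE.
Qed.

Lemma halfwidth_ndisk (y : R) :
  [/\ ~ disk (halfwidth y, y), ~ disk (- halfwidth y, y),
      ~ disk (y, halfwidth y) & ~ disk (y, - halfwidth y)].
Proof.
have h : ~ disk (halfwidth y, y).
  by move=> /=; rewrite /disk /= disk_slice in_itv /= ltxx andbF.
by move: h; rewrite /disk /= sqrrN [y ^+ 2 + _]addrC.
Qed.

Lemma green_compact F G k : is_C1 setT F G -> (forall x, ~ disk x -> F x = 0) ->
  \int[mu2]_(z in disk) G k z = 0.
Proof.
move=> C F0; rewrite /Rintegral.
suff -> : (\int[mu2]_(z in disk) (G k z)%:E = 0)%E by [].
have [->|->] := ord2P k.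
- rewrite (green_fst C); apply: integral0_eq => y _.
  by have [h1 h2 _ _] := halfwidth_ndisk y; rewrite !F0// subrr.
- rewrite (green_snd C); apply: integral0_eq => y _.
  by have [_ _ h1 h2] := halfwidth_ndisk y; rewrite !F0// subrr.
Qed.

Lemma is_C1_setU (A B : set plane) F G : is_C1 A F G -> is_C1 B F G ->
  is_C1 (A `|` B) F G.
Proof.
move=> [cA gA dA] [cB gB dB]; split=> [x|k x|k x].
- by rewrite inE => -[h|h]; [apply: cA|apply: cB]; rewrite inE.
- by rewrite inE => -[h|h]; [apply: gA|apply: gB]; rewrite inE.
- by move=> [h|h]; [apply: dA|apply: dB].
Qed.

Lemma is_C1_grad0 (A : set plane) F G : open A -> is_C1 A F G ->
  (forall x, A x -> F x = 0) -> forall k x, A x -> G k x = 0.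
Proof.
move=> oA C F0 k x Ax.
rewrite -(is_C1_partial k C Ax).
have C0 : is_C1 A F (fun _ _ => 0).
  by apply: is_C1_near (is_C1_cst A 0) => // y /F0.
by rewrite (is_C1_partial k C0 Ax).
Qed.

(** A product extended by zero is of class C^1, because the open sets disk and
    ~` K cover the plane and it is so on both. *)
Lemma is_C1_cutoff (K : set plane) f g F G : closed K -> K `<=` disk ->
  is_C1 disk f g -> is_C1 setT F G -> (forall x, ~ K x -> F x = 0) ->
  is_C1 setT (fun x => f x * F x) (fun k x => f x * G k x + F x * g k x).
Proof.
move=> cK KD Cf CF F0.
have oK : open (~` K) by exact: closed_openC.
have CFK : is_C1 (~` K) F G by apply: is_C1_sub CF.
have G0 := is_C1_grad0 oK CFK F0.
have <- : disk `|` ~` K = setT.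
  apply/seteqP; split=> // x _; have [/KD|] := pselect (K x); by [left|right].
apply: is_C1_setU; first by apply: is_C1M => //; exact: is_C1_sub CF.
apply: (@is_C1_near _ (cst 0)) => //.
  by move=> x /F0 ->; rewrite mulr0.
have [c0 _ d0] := is_C1_cst (~` K) 0.
have Z k x : (~` K) x -> f x * G k x + F x * g k x = 0.
  by move=> Kx; rewrite F0// G0// mulr0 mul0r addr0.
split=> [|k x xK|k x Kx]; first exact: c0.
  have Kx := set_mem xK; rewrite /continuous_at Z//.
  apply: cvg_near_cst.
  have : nbhs x (~` K) by exact: open_nbhs_nbhs.
  by apply: filterS => y /Z.
by rewrite Z//; exact: d0.
Qed.

Lemma cont_cutoff (K : set plane) f F : closed K -> K `<=` disk ->
  {in disk, continuous f} -> continuous F -> (forall x, ~ K x -> F x = 0) ->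
  continuous (fun x => f x * F x).
Proof.
move=> cK KD cf cF F0 x; have [Kx|Kx] := pselect (K x).
  by apply: cvgM; [apply: cf; rewrite inE; exact: KD|exact: cF].
rewrite /continuous_at F0// mulr0.
apply: cvg_near_cst.
have : nbhs x (~` K) by apply: open_nbhs_nbhs; split => //; exact: closed_openC.
by apply: filterS => y Ky; rewrite F0// mulr0.
Qed.

(** The product f F extends by zero to the plane, and its derivatives have
    integral zero. *)
Lemma integration_by_parts_disk (K : set plane) f g F G k :
  closed K -> K `<=` disk ->
  is_C1 disk f g -> is_C1 setT F G -> (forall x, ~ K x -> F x = 0) ->
  \int[mu2]_(x in disk) (f x * G k x) = - \int[mu2]_(x in disk) (g k x * F x).
Proof.
move=> cK KD Cf CF F0.
have C := is_C1_cutoff cK KD Cf CF F0.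
have oK : open (~` K) by exact: closed_openC.
have CFK : is_C1 (~` K) F G by apply: is_C1_sub CF.
have G0 := is_C1_grad0 oK CFK F0.
have [cF cG _] := is_C1T CF; have [cf cg _] := Cf.
have I1 : mu2.-integrable disk (EFin \o (fun x => f x * G k x)).
  by apply: cont_intg; apply: (cont_cutoff cK) => //; exact: G0.
have I2 : mu2.-integrable disk (EFin \o (fun x => g k x * F x)).
  by apply: cont_intg; apply: (cont_cutoff cK) => //; exact: cg.
apply/eqP; rewrite -addr_eq0; apply/eqP.
rewrite -(ID disk_measurable I1 I2).
rewrite -(green_compact k C); last by move=> x /= nD; rewrite F0 ?mulr0// => /KD.
by apply: eq_I => // x _; rewrite [F x * _]mulrC.
Qed.

End Green.

(** * Smooth functions with prescribed support *)

Section FlatFunction.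
Implicit Types (p q : {poly R}) (t : R).

(** The functions q(1/t) exp(-1/t), with q a polynomial, extended by zero to
    t <= 0; with all q at once the family is closed under differentiation. *)
Definition flat p t : R := if 0 < t then p.[t^-1] * expR (- t^-1) else 0.

Definition flat_deriv p : {poly R} := 'X^2 * (p - p^`()).

Lemma flat_le0 p t : t <= 0 -> flat p t = 0.
Proof. by rewrite /flat leNgt => /negbTE ->. Qed.

(** The exponential series dominates its term of degree n + 1. *)
Lemma flat_monomial n t : 0 < t -> t^-1 ^+ n * expR (- t^-1) <= n.+1`!%:R * t.
Proof.
move=> t0; have s0 : 0 < t^-1 by rewrite invr_gt0.
have := expR_ge1Dxn n (ltW s0).
have f0 : 0 < n.+1`!%:R :> R by rewrite ltr0n fact_gt0.
rewrite expRN => h.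
rewrite ler_pdivrMr ?expR_gt0//.
have h2 : t^-1 ^+ n.+1 / n.+1`!%:R <= expR t^-1 by lra.
rewrite ler_pdivrMr// in h2.
rewrite -(ler_pM2r s0) -exprSr (le_trans h2)//.
suff -> : n.+1`!%:R * t * expR t^-1 * t^-1 = expR t^-1 * n.+1`!%:R by [].
by field; rewrite gt_eqF.
Qed.

Lemma flat_bound p : exists C, forall t, 0 < t -> `|flat p t| <= C * t.
Proof.
exists (\sum_(i < size p) `|p`_i| * i.+1`!%:R) => t t0.
rewrite /flat t0 horner_coef !mulr_suml (le_trans (ler_norm_sum _ _ _))//.
apply: ler_sum => i _; rewrite -mulrA normrM -mulrA ler_wpM2l//.
rewrite ger0_norm ?flat_monomial//.
by rewrite mulr_ge0 ?expR_ge0// exprn_ge0// invr_ge0 ltW.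
Qed.

Lemma flat_cont0 p : {for 0, continuous (flat p)}.
Proof.
have [C HC] := flat_bound p.
rewrite /prop_for /continuous_at flat_le0//.
apply/cvgr0Pnorm_lt => e e0; near=> t.
have [t0|t0] := ltP 0 t; last by rewrite flat_le0// normr0.
apply: le_lt_trans (HC _ t0) _.
apply: (@le_lt_trans _ _ ((`|C| + 1) * t)).
  by rewrite ler_pM2r// (le_trans (ler_norm C))// lerDl.
rewrite mulrC -ltr_pdivlMr ?ltr_wpDl//.
near: t; apply: lt_nbhsl; rewrite divr_gt0 ?ltr_wpDl//.
Unshelve. all: by end_near. Qed.

Lemma flat_derive p t : is_derive t (1 : R) (flat p) (flat (flat_deriv p) t).
Proof.
have [t0|t0|->] := ltgtP t 0.
- rewrite (flat_le0 _ (ltW t0)).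
  apply: (@near_eq_is_derive _ _ _ (cst 0)).
  near=> u; rewrite flat_le0// ltW//.
  by near: u; exact: lt_nbhsl.
- have tn0 : t != 0 by rewrite gt_eqF.
  have dV : is_derive t (1 : R) (fun u : R => u^-1) (- t ^- 2).
    have := @is_deriveV R id t 1 1 tn0 (is_derive_id _ _).
    by rewrite /GRing.scale /= mulr1.
  have dp : is_derive t^-1 (1 : R) (horner p) (p^`()).[t^-1].
    apply: DeriveDef; first exact: derivable_horner.
    by rewrite -derive1E -derivE.
  have dNV : is_derive t (1 : R) (fun u : R => - u^-1) (t ^- 2).
    have := is_deriveN dV; rewrite opprK; exact.
  have d1 := is_derive1_comp dp dV.
  have d2 := @is_derive1_comp R expR (fun u : R => - u^-1) t _ _ (is_derive_expR (- t^-1)) dNV.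
  have d := is_deriveM d1 d2.
  rewrite {1}/flat_deriv /flat t0 hornerM hornerXn hornerD hornerN.
  apply: near_eq_is_derive; last first.
    apply: is_derive_eq d _.
    by rewrite /GRing.scale /= exprVn; ring.
  near=> u; have u0 : 0 < u by near: u; exact: lt_nbhsr.
  by rewrite u0.
- rewrite flat_le0//; apply/is_derive1_caratheodory.
  (* The difference quotient at 0 belongs to the family, too. *)
  exists (flat ('X * p)); split.
  + move=> z; rewrite subr0 (flat_le0 _ (lexx 0)) subr0 /flat.
    case: ifPn => z0; last by rewrite mul0r.
    by rewrite hornerM hornerX; field; rewrite gt_eqF.
  + exact: flat_cont0.
  + exact: flat_le0.
Unshelve. all: by end_near. Qed.

Lemma flat_cont p : continuous (flat p).
Proof. exact: derive_cont (flat_derive p). Qed.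

Lemma flat1_gt0 t : 0 < t -> 0 < flat 1 t.
Proof. by move=> t0; rewrite /flat t0 hornerC mul1r expR_gt0. Qed.

Lemma flat1_ge0 t : 0 <= flat 1 t.
Proof.
by have [/flat1_gt0/ltW|/flat_le0 ->] := ltP 0 t.
Qed.

End FlatFunction.

Section Smooth.
Implicit Types (f g : plane -> R) (m : nat).
Local Notation Ck := (@Ck_on R setT).

Lemma CkS m f : Ck m.+1 f -> Ck m f.
Proof.
elim: m f => [|m IH] f [cf h]; first by split.
by split=> // k; have [d c] := h k; split=> //; exact: IH.
Qed.

Lemma Ck_cont m f : Ck m f -> continuous f.
Proof. by case: m => [|m] [cf _] x; apply: cf; rewrite inE. Qed.

Lemma Ck_derivable m f k x : Ck m.+1 f -> derivable f x (basis_vec k).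
Proof. by move=> [_ /(_ k)[h _]]; exact: h. Qed.

Lemma Ck_partial m f k : Ck m.+1 f -> Ck m (partial k f).
Proof. by move=> [_ /(_ k)[]]. Qed.

Lemma Ck_intro m f (g : 'I_2 -> plane -> R) : continuous f ->
  (forall k x, is_derive x (basis_vec k) f (g k x)) ->
  (forall k, Ck m (g k)) -> Ck m.+1 f.
Proof.
move=> cf d C; split; first by move=> x _; exact: cf.
move=> k; split; first by move=> x _; have [] := d k x.
suff -> : partial k f = g k by exact: C.
by apply/funext => x; rewrite /partial; have [] := d k x.
Qed.

Lemma Ck_is_derive m f k x : Ck m.+1 f ->
  is_derive x (basis_vec k) f (partial k f x).
Proof. by move=> C; exact/derivableP/Ck_derivable/C. Qed.

Lemma smooth_cst (c : R) : smooth_on setT (fun _ : plane => c).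
Proof.
move=> m; elim: m c => [|m IH] c; first by split=> // x _; exact: cvg_cst.
have [cc _ d] := is_C1T (is_C1_cst (setT : set plane) c).
by apply: (Ck_intro cc d) => k; exact: IH.
Qed.

Lemma smooth_fst : smooth_on setT (@fst R R).
Proof.
have [c _ d] := is_C1T (is_C1_fst (setT : set plane)).
case=> [|m]; first by split=> // x _; exact: c.
by apply: (Ck_intro c d) => k; exact: smooth_cst.
Qed.

Lemma smooth_snd : smooth_on setT (@snd R R).
Proof.
have [c _ d] := is_C1T (is_C1_snd (setT : set plane)).
case=> [|m]; first by split=> // x _; exact: c.
by apply: (Ck_intro c d) => k; exact: smooth_cst.
Qed.

Lemma CkD m f g : Ck m f -> Ck m g -> Ck m (fun x => f x + g x).
Proof.
elim: m f g => [|m IH] f g Cf Cg; have cf := Ck_cont Cf; have cg := Ck_cont Cg.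
  by split=> // x _; apply: cvgD; [exact: cf|exact: cg].
have d k x : is_derive x (basis_vec k) (fun x => f x + g x)
    (partial k f x + partial k g x).
  exact: is_deriveD (Ck_is_derive k x Cf) (Ck_is_derive k x Cg).
apply: (Ck_intro _ d) => [x|k].
- by apply: cvgD; [exact: cf|exact: cg].
- by apply: IH; exact: Ck_partial.
Qed.

Lemma CkM m f g : Ck m f -> Ck m g -> Ck m (fun x => f x * g x).
Proof.
elim: m f g => [|m IH] f g Cf Cg; have cf := Ck_cont Cf; have cg := Ck_cont Cg.
  by split=> // x _; apply: cvgM; [exact: cf|exact: cg].
have d k x : is_derive x (basis_vec k) (fun x => f x * g x)
    (f x * partial k g x + g x * partial k f x).
  exact: is_deriveM (Ck_is_derive k x Cf) (Ck_is_derive k x Cg).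
apply: (Ck_intro _ d) => [x|k].
- by apply: cvgM; [exact: cf|exact: cg].
- by apply: CkD; apply: IH; by [exact: CkS|exact: Ck_partial].
Qed.

Lemma smoothD f g : smooth_on setT f -> smooth_on setT g ->
  smooth_on setT (fun x => f x + g x).
Proof. by move=> sf sg m; exact: CkD. Qed.

Lemma smoothM f g : smooth_on setT f -> smooth_on setT g ->
  smooth_on setT (fun x => f x * g x).
Proof. by move=> sf sg m; exact: CkM. Qed.

Lemma smooth_is_C1 f : smooth_on setT f -> is_C1 setT f (fun k => partial k f).
Proof. by move=> /(_ 1%N)/Ck_is_C1. Qed.

(** Induction on the order of differentiability, for all members of a family that
    is closed under differentiation at the same time. *)
Lemma smooth_chain (P : Type) (a : P -> R -> R) (D : P -> P) f :
  (forall p, continuous (a p)) ->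
  (forall p (t : R), is_derive t (1 : R) (a p) (a (D p) t)) ->
  smooth_on setT f -> forall p, smooth_on setT (fun x => a p (f x)).
Proof.
move=> ca da sf p m; elim: m p => [|m IH] p.
  split=> // x _.
  apply: (@continuous_comp _ _ _ f (a p)); last exact: ca.
  exact: Ck_cont (sf 0%N) x.
have [c _ d] := is_C1T (is_C1_comp (smooth_is_C1 sf) (ca (D p)) (da p)).
apply: (Ck_intro c d) => k; apply: CkM; first exact: IH.
exact: Ck_partial (sf m.+1).
Qed.

Lemma smooth_flat f p : smooth_on setT f -> smooth_on setT (fun x => flat p (f x)).
Proof.
by move=> sf; apply: smooth_chain sf p; [exact: flat_cont|exact: flat_derive].
Qed.

Lemma smooth_expR f : smooth_on setT f -> smooth_on setT (fun x => expR (f x)).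
Proof.
move=> sf; apply: (@smooth_chain unit (fun _ => @expR R) id f _ _ sf tt).
  by move=> _; exact: continuous_expR.
Qed.

End Smooth.

(** * The fundamental lemma of the calculus of variations *)

Section WeakDerivative.
Implicit Types (f g h : plane -> R) (r : R).

Lemma ddisk_measurable r : measurable (ddisk r : set mplane).
Proof.
rewrite -(setCK (ddisk r)); apply: measurableC; apply: open_measurable_plane.
exact/closed_openC/ddisk_closed.
Qed.

Lemma odisk_measurable r : measurable (odisk r : set mplane).
Proof. by apply: open_measurable_plane; exact: odisk_open. Qed.

Lemma integral_support (A B : set plane) (F : plane -> \bar R) : A `<=` B ->
  (forall x, ~ A x -> F x = 0%E) ->
  (\int[mu2]_(x in B) F x = \int[mu2]_(x in A) F x)%E.
Proof.
move=> AB F0; rewrite [LHS]integral_mkcond [RHS]integral_mkcond.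
apply: eq_integral => x _; rewrite !patchE.
have [xA|xA] := boolP (x \in A).
  by rewrite ifT// inE; apply: AB; exact: set_mem.
by rewrite F0 ?if_same// => /mem_set; rewrite (negbTE xA).
Qed.

(** A product of flat functions, positive exactly where its five arguments are:
    on a rectangle intersected with a disk. *)
Definition bump (a b c d r : R) (x : plane) : R :=
  flat 1 (x.1 - a) * flat 1 (b - x.1) * flat 1 (x.2 - c) * flat 1 (d - x.2) *
  flat 1 (r - rad2 x).

Definition window (a b c d r : R) : set plane :=
  (`]a, b[ `*` `]c, d[) `&` odisk r.

Lemma bump_ge0 a b c d r x : 0 <= bump a b c d r x.
Proof. by rewrite !mulr_ge0 ?flat1_ge0. Qed.

Lemma bump_gt0 a b c d r x : window a b c d r x -> 0 < bump a b c d r x.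
Proof.
move=> [[]]; rewrite /= !in_itv /= => /andP[h1 h2] /andP[h3 h4] h5.
by rewrite /bump !mulr_gt0 ?flat1_gt0 ?subr_gt0.
Qed.

Lemma bump_eq0 a b c d r x : ~ window a b c d r x -> bump a b c d r x = 0.
Proof.
move=> nw; rewrite /bump.
have [h1|h1] := ltP 0 (x.1 - a); last by rewrite (flat_le0 _ h1) !mul0r.
have [h2|h2] := ltP 0 (b - x.1); last by rewrite (flat_le0 _ h2) mulr0 !mul0r.
have [h3|h3] := ltP 0 (x.2 - c); last by rewrite (flat_le0 _ h3) mulr0 !mul0r.
have [h4|h4] := ltP 0 (d - x.2); last by rewrite (flat_le0 _ h4) mulr0 !mul0r.
have [h5|h5] := ltP 0 (r - rad2 x); last by rewrite (flat_le0 _ h5) mulr0.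
exfalso; apply: nw; rewrite !subr_gt0 in h1 h2 h3 h4 h5; split => //.
by split; rewrite /= in_itv /= ?h1 ?h3.
Qed.

Lemma smooth_sub (f g : plane -> R) : smooth_on setT f -> smooth_on setT g ->
  smooth_on setT (fun x => f x - g x).
Proof.
move=> sf sg; have -> : (fun x => f x - g x) = (fun x => f x + (-1) * g x).
  by apply/funext => x; rewrite mulN1r.
by apply: smoothD => //; apply: smoothM => //; exact: smooth_cst.
Qed.

Lemma smooth_rad2 : smooth_on setT rad2.
Proof.
have -> : rad2 = (fun x => x.1 * x.1 + x.2 * x.2).
  by apply/funext => x; rewrite /rad2 !expr2.
apply: smoothD; apply: smoothM.
- exact: smooth_fst.
- exact: smooth_fst.
- exact: smooth_snd.
- exact: smooth_snd.
Qed.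

Lemma smooth_bump a b c d r : smooth_on setT (bump a b c d r).
Proof.
have c1 (s : R) : smooth_on setT (fun _ : plane => s) by exact: smooth_cst.
have s1 := smooth_fst; have s2 := smooth_snd.
have s3 := smooth_rad2.
have e (f g : plane -> R) : smooth_on setT f -> smooth_on setT g ->
    smooth_on setT (fun x => flat 1 (f x - g x)).
  by move=> sf sg; apply: smooth_flat; exact: smooth_sub.
exact: (smoothM (smoothM (smoothM (smoothM (e _ _ s1 (c1 a)) (e _ _ (c1 b) s1))
  (e _ _ s2 (c1 c))) (e _ _ (c1 d) s2)) (e _ _ (c1 r) s3)).
Qed.

(** For r < 1, test functions that increase with n to the indicator of a window. *)
Definition plateau a b c d r (n : nat) (x : plane) : R :=
  1 - expR (- (n%:R * bump a b c d r x)).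

Lemma plateau_test a b c d r n : r < 1 -> test_function (plateau a b c d r n).
Proof.
move=> r1; split.
  apply: smooth_sub; first exact: smooth_cst.
  apply: smooth_expR.
  have -> : (fun x => - (n%:R * bump a b c d r x)) =
            (fun x => - n%:R * bump a b c d r x).
    by apply/funext => x; rewrite mulNr.
  by apply: smoothM; [exact: smooth_cst|exact: smooth_bump].
exists (ddisk r); split.
- by apply: ddisk_compact; exact: ltW.
- exact: ddisk_disk.
- move=> x nx; rewrite /plateau bump_eq0 ?mulr0 ?oppr0 ?expR0 ?subrr//.
  by move=> [_ /odisk_ddisk].
Qed.

Lemma plateau_ge0_le1 a b c d r n x : 0 <= plateau a b c d r n x <= 1.
Proof.
rewrite /plateau; have := expR_ge0 (- (n%:R * bump a b c d r x)).
have : expR (- (n%:R * bump a b c d r x)) <= 1.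
  by rewrite expR_le1 oppr_le0 mulr_ge0// bump_ge0.
by move=> h1 h2; apply/andP; split; lra.
Qed.

Lemma plateau_cvg a b c d r x :
  plateau a b c d r n x @[n --> \oo] --> (\1_(window a b c d r) x : R).
Proof.
have [w|w] := pselect (window a b c d r x); rewrite indicE.
  rewrite mem_set//= -[X in _ --> X]subr0.
  apply: cvgB; first exact: cvg_cst.
  have T0 := bump_gt0 w.
  have E : (fun n : nat => expR (- (n%:R * bump a b c d r x))) =
      (fun n => (expR (- bump a b c d r x)) ^+ n).
    apply/funext => n; rewrite -expRM_natl; congr expR; ring.
  rewrite E; apply: cvg_expr.
  by rewrite ger0_norm ?expR_ge0// expR_lt1 oppr_lt0.
rewrite memNset//=; apply: cvg_near_cst; near=> n.
by rewrite /plateau bump_eq0// mulr0 oppr0 expR0 subrr.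
Unshelve. all: by end_near. Qed.

Lemma window_measurable a b c d r : measurable (window a b c d r : set mplane).
Proof.
apply: measurableI; last exact: odisk_measurable.
by apply: measurableX; exact: measurable_itv.
Qed.

Lemma window_odisk a b c d r : window a b c d r `<=` odisk r.
Proof. by move=> x []. Qed.

Section Vanishing.
Variable h : plane -> R.
Hypothesis Lh : loc_integrable h.
Hypothesis h0 : forall f, test_function f -> \int[mu2]_(x in disk) (h x * f x) = 0.
Variable r : R.
Hypothesis r1 : r < 1.

Let Ih : mu2.-integrable (ddisk r) (EFin \o h).
Proof.
by apply: Lh.2; [apply: ddisk_compact; exact: ltW|exact: ddisk_disk].
Qed.

Let mh : measurable_fun (ddisk r : set mplane) h.
Proof. exact: intg_measurable Ih. Qed.

(** Dominated convergence along the plateaus of the window. *)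
Lemma vanish_window a b c d :
  (\int[mu2]_(x in window a b c d r) (h x)%:E = 0)%E.
Proof.
have mK := ddisk_measurable r.
pose fn n (x : plane) := (h x * plateau a b c d r n x)%:E.
have mp n : measurable_fun (ddisk r : set mplane) (plateau a b c d r n).
  have [s _] := plateau_test a b c d n r1.
  apply: (@measurable_funS _ _ _ _ setT) => //.
  apply: cont_measurable; first exact: openT.
  by move=> x _; exact: Ck_cont (s 0%N) x.
have mfn n : measurable_fun (ddisk r : set mplane) (fn n).
  by apply/measurable_EFinP; exact: measurable_funM.
have Z n : (\int[mu2]_(x in ddisk r) fn n x = 0)%E.
  have T := plateau_test a b c d n r1.
  have I1 : mu2.-integrable (ddisk r) (fn n).
    apply: (@intg_le _ _ _ mu2 _ mK _ (fun x => `|h x|)).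
    - exact: measurable_funM.
    - move=> x _; have /andP[p0 p1] := plateau_ge0_le1 a b c d r n x.
      by rewrite normrM ler_piMr// ger0_norm.
    - exact: integrable_norm.
  have := h0 T; rewrite /Rintegral.
  rewrite (@integral_support (ddisk r) disk (fn n)).
  - move=> Z; rewrite -[LHS]fineK ?Z//.
    exact: integrable_fin_num.
  - exact: ddisk_disk.
  - move=> x nx; rewrite /fn /plateau bump_eq0; last by move=> [_ /odisk_ddisk].
    by rewrite mulr0 oppr0 expR0 subrr mulr0.
have mW : measurable_fun (ddisk r : set mplane) (\1_(window a b c d r) : plane -> R).
  by apply: (@measurable_funS _ _ _ _ setT) => //; apply: measurable_indic; exact: window_measurable.
have mf : measurable_fun (ddisk r : set mplane)
    (fun x => (h x * \1_(window a b c d r) x)%:E).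
  by apply/measurable_EFinP; exact: measurable_funM.
have cv : {ae mu2, forall x, ddisk r x ->
    fn n x @[n --> \oo] --> (h x * \1_(window a b c d r) x)%:E}.
  apply: aeW => x _; apply/fine_cvgP; split; first exact: nearW.
  by rewrite /comp /=; apply: cvgM; [exact: cvg_cst|exact: plateau_cvg].
have ig : mu2.-integrable (ddisk r) (EFin \o (fun x => `|h x|)).
  exact: integrable_norm.
have bd : {ae mu2, forall x, forall n, ddisk r x -> (`|fn n x| <= `|h x|%:E)%E}.
  apply: aeW => x n _; rewrite /fn /= lee_fin.
  have /andP[p0 p1] := plateau_ge0_le1 a b c d r n x.
  by rewrite normrM ler_piMr// ger0_norm.
have [_ _] := dominated_convergence mK mfn mf cv ig bd.
have -> : (fun n => \int[mu2]_(x in ddisk r) fn n x)%E = cst 0%E.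
  by apply/funext => n; exact: Z.
move=> /cvg_lim; rewrite lim_cst// => /(_ (@ereal_hausdorff R)) E.
rewrite [RHS]E (@integral_support (window a b c d r) (ddisk r)).
- apply: eq_integral => x xW; rewrite indicE xW mulr1//.
- by move=> x /window_odisk/odisk_ddisk.
- by move=> x nW; rewrite indicE memNset// mulr0.
Qed.

(** Windows generate the sigma-algebra of the plane one coordinate at a time.
    Each of these steps is an instance of this Dynkin argument, as is the passage
    from measurable rectangles to measurable sets. *)
Lemma vanish_dynkin d (X : measurableType d) (pi_ : mplane -> X)
    (B : set mplane) (G : set (set X)) :
  measurable_fun setT pi_ -> measurable B -> B `<=` ddisk r ->
  @measurable _ X = <<s G >> -> setI_closed G ->
  (\int[mu2]_(x in B) (h x)%:E = 0)%E ->
  (forall A, G A -> (\int[mu2]_(x in B `&` pi_ @^-1` A) (h x)%:E = 0)%E) ->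
  forall A, measurable A -> (\int[mu2]_(x in B `&` pi_ @^-1` A) (h x)%:E = 0)%E.
Proof.
move=> mpi mB BK GE GI B0 GA A; rewrite GE => mA.
have mp (S : set X) : measurable S -> measurable (B `&` pi_ @^-1` S).
  by move=> mS; apply: measurableI => //; rewrite -[X in measurable X]setTI; exact: mpi.
have IB S : measurable S -> S `<=` B -> mu2.-integrable S (EFin \o h).
  by move=> mS SB; apply: integrableS Ih => //; [exact: ddisk_measurable|exact: subset_trans BK].
apply: (@dynkin_induction _ X G (fun A => (\int[mu2]_(x in B `&` pi_ @^-1` A) (h x)%:E = 0)%E)) => //.
- by rewrite preimage_setT setIT.
- move=> S mS ZS.
  have E : B = (B `&` pi_ @^-1` S) `|` (B `&` pi_ @^-1` (~` S)).
    by rewrite -setIUr -preimage_setU setUv preimage_setT setIT.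
  have := B0; rewrite {1}E integral_setU.
  + by rewrite ZS add0e.
  + exact: mp.
  + by apply: mp; exact: measurableC.
  + rewrite -E; exact: (measurable_int _ (IB _ mB (@subset_refl _ _))).
  + apply/disj_setPS => x [[_ h1] [_ h2]]; exact: h2.
- move=> F mF tF ZF.
  rewrite preimage_bigcup setI_bigcupr integral_bigcup.
  + by rewrite eseries0// => i _ _; exact: ZF.
  + move=> i j _ _ [x [[_ xi] [_ xj]]]; apply: tF => //; by exists (pi_ x).
  + by move=> k; exact: mp.
  + apply: IB; first by apply: bigcupT_measurable => k; exact: mp.
    by move=> x [k _ []].
Qed.

Lemma vanish_ae : ae_eq mu2 (odisk r) h (cst 0).
Proof.
have mO := odisk_measurable r.
have OK := @odisk_ddisk r.
have GIR : setI_closed (@RGenOpens.G R).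
  move=> _ _ [a [b ->]] [c [d ->]]; exists (Num.max a c), (Num.min b d).
  apply/seteqP; split=> x /=; rewrite !in_itv /= gt_max lt_min.
    by move=> [/andP[-> ->] /andP[-> ->]].
  by move=> /andP[/andP[-> ->] /andP[-> ->]].
have GER := RGenOpens.measurableE R.
have pt x : odisk r x -> (x.1 \in `]-2, 2[) /\ (x.2 \in `]-2, 2[).
  move=> /OK/(ddisk_disk r1)/disk_bound[]; rewrite !in_itv /= !ler_norml.
  by move=> /andP[? ?] /andP[? ?]; split; apply/andP; split; lra.
have WE a b c d : window a b c d r = odisk r `&` (snd @^-1` `]c, d[) `&` (fst @^-1` `]a, b[).
  apply/seteqP; split=> x.
    by move=> [[]].
  by move=> [[]].
have E1 c d A : measurable A ->
    (\int[mu2]_(x in odisk r `&` (snd @^-1` `]c, d[%classic) `&` (fst @^-1` A)) (h x)%:E = 0)%E.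
  apply: (vanish_dynkin _ _ _ GER GIR).
  - exact: measurable_fst.
  - apply: measurableI => //; rewrite -[X in measurable X]setTI.
    by apply: measurable_snd => //; exact: measurable_itv.
  - by move=> x [/OK].
  - rewrite -(vanish_window (-2) 2 c d); congr (integral _ _ _).
    rewrite WE; apply/seteqP; split=> x; last by move=> [].
    by move=> [Ox xc]; split => //; have [] := pt _ Ox.
  - by move=> _ [a [b ->]]; rewrite -WE; exact: vanish_window.
have E2 A B : measurable A -> measurable B ->
    (\int[mu2]_(x in odisk r `&` (fst @^-1` A) `&` (snd @^-1` B)) (h x)%:E = 0)%E.
  move=> mA; apply: (vanish_dynkin _ _ _ GER GIR).
  - exact: measurable_snd.
  - apply: measurableI => //; rewrite -[X in measurable X]setTI.
    by apply: measurable_fst.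
  - by move=> x [/OK].
  - rewrite -(E1 (-2) 2 A mA); congr (integral _ _ _).
    apply/seteqP; split=> x; last by move=> [[]].
    by move=> [Ox xc]; split => //; split => //; have [] := pt _ Ox.
  - by move=> _ [a [b ->]]; rewrite setIAC; exact: E1.
have IO : mu2.-integrable (odisk r) (EFin \o h).
  by apply: integrableS Ih => //; exact: ddisk_measurable.
suff : ae_eq mu2 (odisk r) (EFin \o h) (EFin \o cst 0).
  by apply: filterS => x hx Ox; have [] := hx Ox.
apply: (@integral_ae_eq _ _ _ mu2 _ mO) => //.
  by apply/measurable_EFinP; exact: measurable_cst.
move=> E EO mE.
rewrite [RHS]integral0_eq//.
have -> : E = odisk r `&` id @^-1` E.
  by apply/seteqP; split=> x; [move=> Ex; split => //; exact: EO|move=> []].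
apply: (vanish_dynkin _ _ _ (measurable_prod_measurableType _ _)) => //.
- by move=> _ _ [A mA [B mB <-]] [A' mA' [B' mB' <-]]; exists (A `&` A');
    [exact: measurableI|exists (B `&` B'); [exact: measurableI|rewrite setXI]].
- have := E2 setT setT measurableT measurableT.
  by rewrite !preimage_setT !setIT.
- move=> _ [A mA [B mB <-]]; rewrite -(E2 A B mA mB); congr (integral _ _ _).
  by apply/seteqP; split=> x; [move=> [Ox []]|move=> [[Ox ?] ?]].
Qed.

End Vanishing.

(** The integral of h vanishes on every window, hence on every measurable subset
    of a smaller disk, and countably many smaller disks exhaust the disk. *)
Lemma vanish_disk h : loc_integrable h ->
  (forall f, test_function f -> \int[mu2]_(x in disk) (h x * f x) = 0) ->
  ae_eq mu2 disk h (cst 0).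
Proof.
move=> Lh h0.
pose rn (n : nat) : R := 1 - n.+1%:R^-1.
have rn1 n : rn n < 1 by rewrite ltrBlDr ltrDl invr_gt0.
have := ae_foralln (fun n => vanish_ae Lh h0 (rn1 n)).
apply: filterS => x hx Dx.
have e0 : 0 < 1 - rad2 x by rewrite subr_gt0.
have [n _ /(_ n (leqnn n)) /= hn] := near_infty_natSinv_lt (PosNum e0).
by apply: (hx n); rewrite /odisk /rn /= ltrBrDr -ltrBrDl; exact: hn.
Qed.

End WeakDerivative.

(** * Weak gradients *)

Section WeakGradient.
Implicit Types (f g : plane -> R).

Definition weak_d (k : 'I_2) f g : Prop :=
  [/\ loc_integrable f, loc_integrable g & forall phi, test_function phi ->
    I (fun x => f x * partial k phi x) = - I (fun x => g x * phi x)].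

Lemma compact_measurable_plane (K : set plane) : compact K ->
  measurable (K : set mplane).
Proof.
move=> /compact_closed => /(_ (@norm_hausdorff _ _)) cK.
rewrite -(setCK K); apply: measurableC; apply: open_measurable_plane.
exact: closed_openC.
Qed.

Lemma loc_integrableD f g : loc_integrable f -> loc_integrable g ->
  loc_integrable (fun x => f x + g x).
Proof.
move=> [mf If] [mg Ig]; split; first exact: measurable_funD.
move=> K cK KD; apply: intgD; [exact: compact_measurable_plane|exact: If|exact: Ig].
Qed.

Lemma loc_integrableZ c f : loc_integrable f -> loc_integrable (fun x => c * f x).
Proof.
move=> [mf If]; split; first exact: measurable_funM.
move=> K cK KD; apply: intgZ; [exact: compact_measurable_plane|exact: If].
Qed.

Lemma sqint_loc f : sqintD2 f -> loc_integrable f.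
Proof.
move=> Sf; have [mf _] := Sf; split=> // K cK KD.
apply: integrableS (sqint_intg mD fD Sf) => //.
exact: compact_measurable_plane.
Qed.

Lemma cont_loc_integrable f : {in disk, continuous f} -> loc_integrable f.
Proof.
move=> cf; have mf := cont_measurable disk_open cf.
split=> // K cK KD.
have mK := compact_measurable_plane cK.
have [M HM] : exists M, forall x, K x -> `|f x| <= M.
  by apply: cont_bounded_compact => // x /set_mem Kx; apply: cf; rewrite inE; exact: KD.
apply: (@intg_bounded _ _ _ _ _ _ _ M) => //.
- by apply: le_lt_trans fD; apply: le_measure; rewrite ?inE.
- exact: measurable_funS mf.
Qed.

Lemma loc_integrable_test f phi : loc_integrable f -> continuous phi ->
  (exists K : set plane, [/\ compact K, K `<=` disk & forall x, ~ K x -> phi x = 0]) ->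
  mu2.-integrable disk (EFin \o (fun x => f x * phi x)).
Proof.
move=> [mf If] cphi [K [cK KD K0]].
have mK := compact_measurable_plane cK.
have [M HM] := cont_bounded_cdisk cphi.
have mp : measurable_fun disk phi by exact: cont_measurable_disk.
have h : mu2.-integrable K (EFin \o (fun x => phi x * f x)).
  apply: (@intgM_bounded _ _ _ mu2 _ mK _ _ M).
  - exact: measurable_funS mp.
  - by move=> x /KD/disk_cdisk; exact: HM.
  - exact: If.
apply/integrableP; split; first by apply/measurable_EFinP; exact: measurable_funM.
rewrite (@integral_support K) => //.
  have /integrableP[_] := h; congr (_ < _)%E; apply: eq_integral => x _ /=.
  by rewrite mulrC.
by move=> x /K0 /= ->; rewrite mulr0 normr0.
Qed.

Lemma test_partial k phi : test_function phi ->
  continuous (partial k phi) /\ exists K : set plane,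
   [/\ compact K, K `<=` disk & forall x, ~ K x -> partial k phi x = 0].
Proof.
move=> [sphi [K [cK KD K0]]]; split; first exact: Ck_cont (Ck_partial k (sphi 1%N)).
exists K; split=> // x nK.
have oK : open (~` K).
  by apply: closed_openC; exact: (compact_closed (@norm_hausdorff _ _)).
have C : is_C1 (~` K) phi (fun k => partial k phi).
  by apply: is_C1_sub (smooth_is_C1 sphi).
exact: (is_C1_grad0 oK C).
Qed.

Lemma weak_d_lin k c f g f' g' : weak_d k f g -> weak_d k f' g' ->
  weak_d k (fun x => c * f x + f' x) (fun x => c * g x + g' x).
Proof.
move=> [lf lg h] [lf' lg' h']; split.
- by apply: loc_integrableD => //; exact: loc_integrableZ.
- by apply: loc_integrableD => //; exact: loc_integrableZ.
move=> phi T; have [cp Kp] := test_partial k T.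
have [sphi KT] := T; have cphi := Ck_cont (sphi 0%N).
have I1 := loc_integrable_test lf cp Kp.
have I2 := loc_integrable_test lf' cp Kp.
have I3 := loc_integrable_test lg cphi KT.
have I4 := loc_integrable_test lg' cphi KT.
rewrite (@eq_I _ _ _ mu2 disk (fun x => (c * f x + f' x) * partial k phi x)
  (fun x => c * (f x * partial k phi x) + f' x * partial k phi x)); last first.
  by move=> x _; ring.
rewrite (@eq_I _ _ _ mu2 disk (fun x => (c * g x + g' x) * phi x)
  (fun x => c * (g x * phi x) + g' x * phi x)); last first.
  by move=> x _; ring.
rewrite (ID mD (intgZ mD c I1) I2) (ID mD (intgZ mD c I3) I4).
by rewrite (IZ mD _ I1) (IZ mD _ I3) h// h'// opprD mulrN.
Qed.

Lemma weak_d_unique k f g g' : weak_d k f g -> weak_d k f g' ->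
  ae_eq mu2 disk g g'.
Proof.
move=> [lf lg h] [_ lg' h'].
have : ae_eq mu2 disk (fun x => g x + -1 * g' x) (cst 0).
  apply: vanish_disk.
    by apply: loc_integrableD => //; exact: loc_integrableZ.
  move=> phi T; have [sphi KT] := T; have cphi := Ck_cont (sphi 0%N).
  have I3 := loc_integrable_test lg cphi KT.
  have I4 := loc_integrable_test lg' cphi KT.
  rewrite (@eq_I _ _ _ mu2 disk (fun x => (g x + -1 * g' x) * phi x)
    (fun x => g x * phi x - g' x * phi x)); last by move=> x _; ring.
  rewrite (IB mD I3 I4); apply/eqP; rewrite subr_eq0 -eqr_opp.
  by rewrite -h// -h'.
by apply: filterS => x /[apply] /= hx; lra.
Qed.

Lemma weak_d_C1 k f (g : 'I_2 -> plane -> R) : is_C1 disk f g -> weak_d k f (g k).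
Proof.
move=> C; have [cf cg _] := C; split; [exact: cont_loc_integrable..|].
move=> phi [sphi [K [cK KD K0]]].
have clK : closed K by exact: (compact_closed (@norm_hausdorff _ _)).
exact: (integration_by_parts_disk k clK KD C (smooth_is_C1 sphi) K0).
Qed.

Section Vector.
Context {n : nat}.
Implicit Types (u v : plane -> 'rV[R]_n) (G H : plane -> 'M[R]_(n, 2)).

Lemma is_wgradP u G : is_wgrad u G <->
  forall i k, weak_d k (fun x => u x 0 i) (fun x => G x i k).
Proof. by []. Qed.

Lemma wgrad_is u G : is_wgrad u G -> is_wgrad u (wgrad u).
Proof. by move=> h; apply: xgetPex; exists G. Qed.

Lemma wgrad_ae u G i k : is_wgrad u G ->
  ae_eq mu2 disk (fun x => wgrad u x i k) (fun x => G x i k).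
Proof.
by move=> h; apply: weak_d_unique; [exact: (wgrad_is h i k)|exact: h].
Qed.

Lemma W12_wgrad u : W12 u -> is_wgrad u (wgrad u).
Proof. by move=> [_ [G [h _]]]; exact: wgrad_is h. Qed.

Lemma W12_sqint u i k : W12 u -> sqintD2 (fun x => wgrad u x i k).
Proof.
move=> [_ [G [h s]]].
apply: (ae_sqint mD); last exact: (s i k).
  by have [_ [m _] _] := wgrad_is h i k.
by apply: ae_eq_sym; exact: wgrad_ae.
Qed.

Lemma W12_sqint0 u i : W12 u -> sqintD2 (fun x => u x 0 i).
Proof. by move=> [s _]; exact: s. Qed.

Lemma is_wgrad_lin c u v G H : is_wgrad u G -> is_wgrad v H ->
  is_wgrad (fun x => c *: u x + v x) (fun x => c *: G x + H x).
Proof.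
move=> hu hv; apply/is_wgradP => i k.
have := weak_d_lin c (hu i k) (hv i k).
by congr weak_d; apply/funext => x; rewrite !mxE.
Qed.

Lemma W12_lin c u v : W12 u -> W12 v -> W12 (fun x => c *: u x + v x).
Proof.
move=> Wu Wv; split.
  move=> i j; change (sqintD2 (fun x => (c *: u x + v x) i j)).
  have -> : (fun x => (c *: u x + v x) i j) =
      (fun x => c * u x 0 j + v x 0 j).
    by apply/funext => x; rewrite !mxE (ord1 i).
  exact: (sqintD mD (sqintZ mD c (W12_sqint0 j Wu)) (W12_sqint0 j Wv)).
exists (fun x => c *: wgrad u x + wgrad v x); split.
  by apply: is_wgrad_lin; exact: W12_wgrad.
move=> i j; change (sqintD2 (fun x => (c *: wgrad u x + wgrad v x) i j)).
have -> : (fun x => (c *: wgrad u x + wgrad v x) i j) =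
    (fun x => c * wgrad u x i j + wgrad v x i j).
  by apply/funext => x; rewrite !mxE.
exact: (sqintD mD (sqintZ mD c (W12_sqint i j Wu)) (W12_sqint i j Wv)).
Qed.

Lemma intg_sqnorm m p (F : plane -> 'M[R]_(m, p)) :
  (forall i j, sqintD2 (fun x => F x i j)) ->
  mu2.-integrable disk (EFin \o (fun x => sqnorm (F x))).
Proof.
move=> SF; rewrite /sqnorm.
have -> : EFin \o (fun x => \sum_(i < m) \sum_(j < p) F x i j ^+ 2) =
    (fun x => \sum_(i < m) \sum_(j < p) (F x i j ^+ 2)%:E)%E.
  by apply/funext => x; rewrite /= -sumEFin; apply: eq_bigr => i _; rewrite -sumEFin.
apply: integrable_sum => //= i _; apply: integrable_sum => //= j _.
exact: (SF i j).2.
Qed.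

Lemma entry_le_sqnorm m p (A : 'M[R]_(m, p)) i j : A i j ^+ 2 <= sqnorm A.
Proof.
rewrite /sqnorm (bigD1 i)//= (bigD1 j)//= -addrA lerDl addr_ge0//.
  by apply: sumr_ge0 => k _; exact: sqr_ge0.
by apply: sumr_ge0 => k _; apply: sumr_ge0 => l _; exact: sqr_ge0.
Qed.

Lemma sqnorm_ge0 m p (A : 'M[R]_(m, p)) : 0 <= sqnorm A.
Proof. by apply: sumr_ge0 => k _; apply: sumr_ge0 => l _; exact: sqr_ge0. Qed.

Lemma W12norm_ge u i k : W12 u ->
  I (fun x => wgrad u x i k ^+ 2) <= W12norm u ^+ 2.
Proof.
move=> Wu.
have I1 := intg_sqnorm (fun i j => W12_sqint i j Wu).
have I0 : mu2.-integrable disk (EFin \o (fun x => sqnorm (u x))).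
  by apply: intg_sqnorm => a j; rewrite (ord1 a); exact: W12_sqint0.
rewrite /W12norm sqr_sqrtr; last first.
  by apply: I_ge0 => x _; rewrite addr_ge0 ?sqnorm_ge0.
apply: (le_I mD); [exact: (W12_sqint i k Wu).2|exact: (intgD mD I0 I1)|].
move=> x _; rewrite (le_trans (entry_le_sqnorm (wgrad u x) i k))//.
by rewrite lerDr sqnorm_ge0.
Qed.

(** By the Cauchy-Schwarz inequality the integral of an entry of the weak gradient
    against a bounded weight is a bounded linear functional. *)
Lemma weak_cvg_wgrad (u_ : nat -> plane -> 'rV[R]_n) u (phi : plane -> R) (M : R) i k :
  weak_cvg_W12 u_ u -> measurable_fun disk phi ->
  (forall x, disk x -> `|phi x| <= M) ->
  (fun j => I (fun x => phi x * wgrad (u_ j) x i k)) @ \oo -->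
  I (fun x => phi x * wgrad u x i k).
Proof.
move=> [_ _ cv] mphi bphi.
have Sphi : sqintD2 phi by exact: (sqint_bounded mD fD mphi bphi).
apply: (cv (fun w => I (fun x => phi x * wgrad w x i k))); split.
  move=> a w w' Ww Ww'.
  have S1 := W12_sqint i k Ww; have S2 := W12_sqint i k Ww'.
  have I1 := sqintM mD Sphi S1; have I2 := sqintM mD Sphi S2.
  rewrite -(IZ mD a I1) -(ID mD (intgZ mD a I1) I2).
  have Wl := W12_lin a Ww Ww'.
  apply: (ae_eq_I mD).
  - exact: (intg_measurable (sqintM mD Sphi (W12_sqint i k Wl))).
  - exact: (intg_measurable (intgD mD (intgZ mD a I1) I2)).
  - have := wgrad_ae i k (is_wgrad_lin a (W12_wgrad Ww) (W12_wgrad Ww')).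
    by apply: filterS => x /[apply] /= ->; rewrite !mxE; ring.
exists (Num.sqrt (I (fun x => phi x ^+ 2))) => w Ww.
have Sw := W12_sqint i k Ww.
rewrite -(@ler_pXn2r _ 2) ?nnegrE ?mulr_ge0 ?sqrtr_ge0//.
rewrite real_normK ?num_real// exprMn sqr_sqrtr; last first.
  by apply: I_ge0 => x _; exact: sqr_ge0.
apply: le_trans (cauchy_schwarz_I mD Sphi Sw) _.
apply: ler_wpM2l; last exact: W12norm_ge.
by apply: I_ge0 => x _; exact: sqr_ge0.
Qed.

End Vector.
End WeakGradient.

(** * Integrals over the circle *)

(** Used with phi = sin and phi = cos: over an arc the integral with respect to a
    coordinate is at most the integral with respect to the angle. *)
Lemma le_substitution_increasing (phi phi' g : R -> R) (a b : R) : a <= b ->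
  continuous phi' -> (forall t : R, is_derive t (1 : R) phi (phi' t)) ->
  (forall t, `|phi' t| <= 1) ->
  {in `[a, b] &, {homo phi : x y / x < y}} ->
  continuous g -> (forall y, 0 <= g y) ->
  (\int[leb]_(y in [set` `[phi a, phi b]%R]) (g y)%:E <=
   \int[leb]_(t in [set` `[a, b]%R]) (g (phi t))%:E)%E.
Proof.
move=> ab cp dp p1 mp cg g0; have cphi := derive_cont dp.
have E : phi^`()%classic = phi'.
  by apply/funext => t; rewrite derive1E; have [] := dp t.
have cl x : cvg (phi' t @[t --> x^'+]).
  by apply/cvg_ex; exists (phi' x); apply: cvg_at_right_filter; exact: cp.
have cr x : cvg (phi' t @[t --> x^'-]).
  by apply/cvg_ex; exists (phi' x); apply: cvg_at_left_filter; exact: cp.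
have LR := derive_LR a b dp.
have cgp : continuous (g \o phi).
  by move=> t; apply: (@continuous_comp _ _ _ phi g); [exact: cphi|exact: cg].
have IG : leb.-integrable `[a, b] (EFin \o (g \o phi)).
  exact: cont_itv_intg.
have I1 : leb.-integrable `[a, b] (EFin \o ((g \o phi) * phi')).
  by apply: cont_itv_intg => t; apply: cvgM; [exact: cgp|exact: cp].
rewrite (@integration_by_substitution_increasing _ phi g _ _ ab mp) ?E//.
- have mI : measurable (`[a, b]%classic : set (measurableTypeR R)) by exact: measurable_itv.
  apply: (le_integral mI I1 IG) => t _ /=; rewrite lee_fin /= ler_piMr//; first exact: g0.
  exact: le_trans (ler_norm _) (p1 t).
- exact: continuous_subspaceT.
Qed.

Lemma le_substitution_decreasing (phi phi' g : R -> R) (a b : R) : a <= b ->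
  continuous phi' -> (forall t : R, is_derive t (1 : R) phi (phi' t)) ->
  (forall t, `|phi' t| <= 1) ->
  {in `[a, b] &, {homo phi : x y /~ x < y}} ->
  continuous g -> (forall y, 0 <= g y) ->
  (\int[leb]_(y in [set` `[phi b, phi a]%R]) (g y)%:E <=
   \int[leb]_(t in [set` `[a, b]%R]) (g (phi t))%:E)%E.
Proof.
move=> ab cp dp p1 mp cg g0; have cphi := derive_cont dp.
have E : phi^`()%classic = phi'.
  by apply/funext => t; rewrite derive1E; have [] := dp t.
have cl x : cvg (phi' t @[t --> x^'+]).
  by apply/cvg_ex; exists (phi' x); apply: cvg_at_right_filter; exact: cp.
have cr x : cvg (phi' t @[t --> x^'-]).
  by apply/cvg_ex; exists (phi' x); apply: cvg_at_left_filter; exact: cp.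
have LR := derive_LR a b dp.
have cgp : continuous (g \o phi).
  by move=> t; apply: (@continuous_comp _ _ _ phi g); [exact: cphi|exact: cg].
have IG : leb.-integrable `[a, b] (EFin \o (g \o phi)).
  exact: cont_itv_intg.
have I1 : leb.-integrable `[a, b] (EFin \o ((g \o phi) * - phi')).
  by apply: cont_itv_intg => t; apply: cvgM; [exact: cgp|apply: cvgN; exact: cp].
rewrite (@integration_by_substitution_decreasing _ phi g _ _ ab mp) ?E//.
- have mI : measurable (`[a, b]%classic : set (measurableTypeR R)) by exact: measurable_itv.
  apply: (le_integral mI I1 IG) => t _ /=; rewrite lee_fin /= ler_piMr//; first exact: g0.
  by apply: le_trans (ler_norm _) _; rewrite normrN.
- exact: continuous_subspaceT.
Qed.

Lemma cos_norm1 (t : R) : `|cos t| <= 1.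
Proof. by rewrite ler_norml cos_geN1 cos_le1. Qed.

Lemma sin_norm1 (t : R) : `|sin t| <= 1.
Proof. by rewrite ler_norml sin_geN1 sin_le1. Qed.

Lemma halfwidth_cont : continuous halfwidth.
Proof.
move=> y; apply: (@continuous_comp _ _ _ (fun y : R => 1 - y ^+ 2) Num.sqrt).
  by apply: cvgB; [exact: cvg_cst|exact: exprn_continuous].
exact: sqrt_continuous.
Qed.

Lemma halfwidth_sin (t : R) : halfwidth (sin t) = `|cos t|.
Proof. by rewrite /halfwidth -cos2sin2 sqrtr_sqr. Qed.

Lemma halfwidth_cos (t : R) : halfwidth (cos t) = `|sin t|.
Proof. by rewrite /halfwidth -sin2cos2 sqrtr_sqr. Qed.

Lemma angle_cont (H : plane -> R) : continuous H -> continuous (fun t => H (angle t)).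
Proof.
move=> cH t; apply: (@continuous_comp _ _ _ (@angle R) H); last exact: cH.
by apply: (@cvg_pair _ _ _ (nbhs t) (nbhs (cos t)) (nbhs (sin t)));
  [exact: continuous_cos|exact: continuous_sin].
Qed.

Lemma cont_right (s : R) (f : plane -> R) : continuous f ->
  continuous (fun y => f (s * halfwidth y, y)).
Proof.
move=> cf y; apply: (@continuous_comp _ _ _ (fun y => (s * halfwidth y, y)) f); last exact: cf.
apply: (@cvg_pair _ _ _ (nbhs y) (nbhs (s * halfwidth y)) (nbhs y)); last exact: cvg_id.
by apply: cvgM; [exact: cvg_cst|exact: halfwidth_cont].
Qed.

Lemma cont_top (s : R) (f : plane -> R) : continuous f ->
  continuous (fun y => f (y, s * halfwidth y)).
Proof.
move=> cf y; apply: (@continuous_comp _ _ _ (fun y => (y, s * halfwidth y)) f); last exact: cf.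
apply: (@cvg_pair _ _ _ (nbhs y) (nbhs y) (nbhs (s * halfwidth y))); first exact: cvg_id.
by apply: cvgM; [exact: cvg_cst|exact: halfwidth_cont].
Qed.

Section Arcs.
Variable H : plane -> R.
Hypotheses (cH : continuous H) (H0 : forall x, 0 <= H x).

Definition circle_int := (\int[leb]_(t in [set` `[0, 2 * pi]%R]) (H (angle t))%:E)%E.

Let Lsub (a b : R) (h : R -> R) : 0 <= a -> b <= 2 * pi ->
  (forall t, t \in `[a, b] -> h t = H (angle t)) ->
  (\int[leb]_(t in [set` `[a, b]%R]) (h t)%:E <= circle_int)%E.
Proof.
move=> a0 b2 hH.
rewrite (@eq_integral _ _ _ leb _ (fun t => (H (angle t))%:E)); last first.
  by move=> t; rewrite inE /= => /hH ->.
apply: ge0_subset_integral.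
- exact: measurable_itv.
- exact: measurable_itv.
- apply/measurable_EFinP; apply: (@measurable_funS _ _ _ _ setT) => //.
  exact: continuous_measurable_fun (angle_cont cH).
- by move=> t _; rewrite lee_fin.
- move=> t; rewrite /= !in_itv /= => /andP[h1 h2].
  by rewrite (le_trans a0 h1) (le_trans h2 b2).
Qed.

Let cr (s : R) := @cont_right s H cH.
Let cs (s : R) := @cont_top s H cH.
Let pi0 : 0 < pi. Proof. exact: pi_gt0. Qed.

Lemma arc_top :
  (\int[leb]_(y in [set` `[-1, 1]%R]) (H (y, 1 * halfwidth y))%:E <= circle_int)%E.
Proof.
have h : {in `[0, pi] &, {homo @cos R : x y /~ x < y}}.
  by move=> x y hx hy; rewrite ltr_cos.
have := @le_substitution_decreasing cos (fun t => - sin t) _ 0 pi (ltW pi0) _ _ _ h (@cs 1) _.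
rewrite cos0 cospi => L; apply: le_trans (L _ _ _ _) _.
- by move=> t; apply: cvgN; exact: continuous_sin.
- by move=> t; rewrite normrN sin_norm1.
- by move=> y; exact: H0.
- apply: Lsub => //; first by rewrite ler_peMl ?ler1n ?ltW.
  move=> t; rewrite in_itv /= => ht.
  by rewrite halfwidth_cos ger0_norm ?sin_ge0_pi// mul1r.
Qed.

Lemma arc_bottom :
  (\int[leb]_(y in [set` `[-1, 1]%R]) (H (y, -1 * halfwidth y))%:E <= circle_int)%E.
Proof.
have p0 := pi_gt0 R.
have cE (t : R) : cos t = - cos (t - pi) by rewrite -cosDpi subrK.
have sE (t : R) : sin t = - sin (t - pi) by rewrite -sinDpi subrK.
have h : {in `[pi, 2 * pi] &, {homo @cos R : x y / x < y}}.
  move=> x y; rewrite !in_itv /= => /andP[h1 h2] /andP[h3 h4] xy.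
  rewrite cE [ltRHS]cE ltrN2 ltr_cos ?in_itv /= ?ltrD2r//; apply/andP; split; lra.
have p2 : pi <= 2 * pi by lra.
have := @le_substitution_increasing cos (fun t => - sin t) _ pi (2 * pi) p2 _ _ _ h (@cs (-1)) _.
rewrite cospi mulr_natl cos2pi => L; apply: le_trans (L _ _ _ _) _.
- by move=> t; apply: cvgN; exact: continuous_sin.
- by move=> t; rewrite normrN sin_norm1.
- by move=> y; exact: H0.
- apply: Lsub; [exact: ltW|by rewrite mulr_natl|].
  move=> t; rewrite in_itv /= => /andP[h1 h2].
  rewrite halfwidth_cos ler0_norm ?mulN1r ?opprK//.
  rewrite sE oppr_le0 sin_ge0_pi//; apply/andP; split; lra.
Qed.

Lemma arc_left :
  (\int[leb]_(y in [set` `[-1, 1]%R]) (H (-1 * halfwidth y, y))%:E <= circle_int)%E.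
Proof.
have p0 := pi_gt0 R.
have cE (t : R) : cos t = - cos (t - pi) by rewrite -cosDpi subrK.
have sE (t : R) : sin t = - sin (t - pi) by rewrite -sinDpi subrK.
have h : {in `[pi / 2, 3 * pi / 2] &, {homo @sin R : x y /~ x < y}}.
  move=> x y; rewrite !in_itv /= => /andP[h1 h2] /andP[h3 h4] xy.
  rewrite sE [ltRHS]sE ltrN2 ltr_sin ?in_itv /= ?ltrD2r//; apply/andP; split; lra.
have p2 : pi / 2 <= 3 * pi / 2 by lra.
have := @le_substitution_decreasing sin cos _ (pi / 2) (3 * pi / 2) p2 _ _ _ h (@cr (-1)) _.
have -> : sin (3 * pi / 2) = -1 :> R.
  by rewrite sE; have -> : 3 * pi / 2 - pi = pi / 2 by [lra|]; rewrite ?sin_pihalf//; lra.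
rewrite sin_pihalf => L; apply: le_trans (L _ _ _ _) _.
- by move=> t; exact: continuous_cos.
- by move=> t; exact: cos_norm1.
- by move=> y; exact: H0.
- apply: Lsub; [lra|lra|].
  move=> t; rewrite in_itv /= => /andP[h1 h2].
  rewrite halfwidth_sin ler0_norm ?mulN1r ?opprK//.
  rewrite cE oppr_le0 cos_ge0_pihalf//; apply/andP; split; lra.
Qed.

(** The angle jumps from 2 pi to 0 in the middle of the right half circle, which is
    why it is split into two arcs. *)
Lemma arc_right_up :
  (\int[leb]_(y in [set` `[0, 1]%R]) (H (1 * halfwidth y, y))%:E <= circle_int)%E.
Proof.
have p0 := pi_gt0 R.
have p2 : 0 <= pi / 2 by lra.
have h : {in `[0, pi / 2] &, {homo @sin R : x y / x < y}}.
  move=> x y; rewrite !in_itv /= => /andP[h1 h2] /andP[h3 h4] xy.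
  rewrite ltr_sin ?in_itv //=; apply/andP; split; lra.
have := @le_substitution_increasing sin cos _ 0 (pi / 2) p2 _ _ _ h (@cr 1) _.
rewrite sin0 sin_pihalf => L; apply: le_trans (L _ _ _ _) _.
- by move=> t; exact: continuous_cos.
- by move=> t; exact: cos_norm1.
- by move=> y; exact: H0.
- apply: Lsub; [lra|lra|].
  move=> t; rewrite in_itv /= => /andP[h1 h2].
  rewrite halfwidth_sin ger0_norm ?mul1r//.
  rewrite cos_ge0_pihalf//; apply/andP; split; lra.
Qed.

Lemma arc_right_down :
  (\int[leb]_(y in [set` `[-1, 0]%R]) (H (1 * halfwidth y, y))%:E <= circle_int)%E.
Proof.
have p0 := pi_gt0 R.
have cE (t : R) : cos t = cos (t - 2 * pi) by rewrite -[RHS]cosD2pi mulr_natl subrK.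
have sE (t : R) : sin t = sin (t - 2 * pi) by rewrite -[RHS]sinD2pi mulr_natl subrK.
have p2 : 3 * pi / 2 <= 2 * pi by lra.
have h : {in `[3 * pi / 2, 2 * pi] &, {homo @sin R : x y / x < y}}.
  move=> x y; rewrite !in_itv /= => /andP[h1 h2] /andP[h3 h4] xy.
  rewrite sE [ltRHS]sE ltr_sin ?in_itv /= ?ltrD2r//; apply/andP; split; lra.
have := @le_substitution_increasing sin cos _ (3 * pi / 2) (2 * pi) p2 _ _ _ h (@cr 1) _.
have -> : sin (3 * pi / 2) = -1 :> R.
  rewrite sE; have -> : 3 * pi / 2 - 2 * pi = - (pi / 2) by lra.
  by rewrite sinN sin_pihalf.
have -> : sin (2 * pi) = 0 :> R by rewrite mulr_natl sin2pi.
move=> L; apply: le_trans (L _ _ _ _) _.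
- by move=> t; exact: continuous_cos.
- by move=> t; exact: cos_norm1.
- by move=> y; exact: H0.
- apply: Lsub; [lra|lra|].
  move=> t; rewrite in_itv /= => /andP[h1 h2].
  rewrite halfwidth_sin ger0_norm ?mul1r//.
  rewrite cE cos_ge0_pihalf//; apply/andP; split; lra.
Qed.

End Arcs.

(** * A Hardy inequality near the circle *)

Section Boundary.
Variable H : plane -> R.
Hypotheses (cH : continuous H) (H0 : forall x, 0 <= H x).
Local Notation L := (circle_int H).

Lemma circle_int_ge0 : (0 <= L)%E.
Proof. by apply: integral_ge0 => t _; rewrite lee_fin. Qed.

Lemma circle_int_fin : L \is a fin_num.
Proof.
have mI : measurable (`[0, 2 * pi]%classic : set (measurableTypeR R)).
  exact: measurable_itv.
apply: (integrable_fin_num mI).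
exact: (cont_itv_intg _ _ (angle_cont cH)).
Qed.

Let cr (s : R) := @cont_right s H cH.
Let cs (s : R) := @cont_top s H cH.

Lemma arc_right :
  (\int[leb]_(y in [set` `[-1, 1]%R]) (H (1 * halfwidth y, y))%:E <= L + L)%E.
Proof.
have mf A : measurable_fun (A : set (measurableTypeR R))
    (fun y : measurableTypeR R => (H (1 * halfwidth y, y))%:E).
  apply/measurable_EFinP; apply: (@measurable_funS _ _ _ _ setT) => //.
  by apply: continuous_measurable_fun; exact: cr.
have E : `[(-1 : R), 1]%classic = `[-1, 0]%classic `|` `]0, 1]%classic.
  by rewrite -itv_bndbnd_setU// bnd_simp.
rewrite E ge0_integral_setU//.
- apply: leeD; first exact: arc_right_down.
  apply: le_trans (arc_right_up cH H0).
  apply: ge0_subset_integral => //; first by move=> t _; rewrite lee_fin.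
  by move=> t /=; rewrite !in_itv /= => /andP[h1 h2]; rewrite (ltW h1) h2.
- by move=> t _; rewrite lee_fin.
- by apply/disj_setPS => t [] /=; rewrite !in_itv /= => /andP[_ h1] /andP[h2 _]; move: h1; rewrite leNgt h2.
Qed.

(** Applied to the restrictions h1 and h2 of a function to opposite half circles,
    as functions of the coordinate that the two end points of a chord share. *)
Lemma two_arcs (c : R) (h1 h2 p : R -> R) (M : \bar R) : 0 <= c ->
  continuous h1 -> continuous h2 ->
  (forall y, 0 <= h1 y) -> (forall y, 0 <= h2 y) ->
  (forall y, y \notin `[-1, 1] -> p y = 0) ->
  continuous p ->
  (forall y, y \in `[-1, 1] -> 0 <= p y <= c * (h1 y + h2 y)) ->
  (\int[leb]_(y in [set` `[-1, 1]%R]) (h1 y)%:E +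
   \int[leb]_(y in [set` `[-1, 1]%R]) (h2 y)%:E <= M)%E ->
  (\int[leb]_y (p y)%:E <= c%:E * M)%E.
Proof.
move=> c0 ch1 ch2 h10 h20 p0 cp ple hM.
have mI : measurable (`[-1, 1]%classic : set (measurableTypeR R)).
  exact: measurable_itv.
have mc A (g : R -> R) : continuous g -> measurable_fun (A : set (measurableTypeR R)) (EFin \o g).
  move=> cg; apply/measurable_EFinP; apply: (@measurable_funS _ _ _ _ setT) => //.
  exact: continuous_measurable_fun.
have -> : (\int[leb]_y (p y)%:E = \int[leb]_(y in [set` `[-1, 1]%R]) (p y)%:E)%E.
  rewrite [RHS]integral_mkcond; apply: eq_integral => y _; rewrite patchE.
  by rewrite mem_setE; case: ifPn => // /p0 ->.
apply: (@le_trans _ _ (\int[leb]_(y in [set` `[-1, 1]%R]) (c%:E * ((h1 y)%:E + (h2 y)%:E)))%E).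
  apply: ge0_le_integral => //=.
  - by move=> y hy; rewrite lee_fin; have /andP[] := ple y hy.
  - exact: mc.
  - have := @mc `[-1, 1]%classic (fun y => c * (h1 y + h2 y)).
    apply => y; apply: cvgM; first exact: cvg_cst.
    by apply: cvgD; [exact: ch1|exact: ch2].
  - by move=> y hy; rewrite -EFinD -EFinM lee_fin; have /andP[] := ple y hy.
rewrite ge0_integralZl//=; last 2 first.
- have := @mc `[-1, 1]%classic (fun y => h1 y + h2 y).
  by apply => y; apply: cvgD; [exact: ch1|exact: ch2].
- by move=> y _; rewrite adde_ge0// lee_fin.
rewrite lee_wpmul2l//; apply: le_trans hM.
rewrite ge0_integralD//=.
- by move=> y _; rewrite lee_fin.
- exact: mc.
- by move=> y _; rewrite lee_fin.
- exact: mc.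
Qed.

Lemma halfwidth_le1 (y : R) : halfwidth y <= 1.
Proof.
rewrite -sqrtr1 /halfwidth ler_wsqrtr//.
by rewrite lerBlDr lerDl sqr_ge0.
Qed.

Lemma halfwidth_circle (y : R) : y \in `[-1, 1] -> halfwidth y ^+ 2 + y ^+ 2 = 1.
Proof.
rewrite in_itv /= => /andP[h1 h2]; rewrite /halfwidth sqr_sqrtr ?subrK//.
nra.
Qed.

Lemma halfwidth_out (y : R) : y \notin `[-1, 1] -> halfwidth y = 0.
Proof.
rewrite in_itv /= negb_and -!ltNge => h; rewrite /halfwidth ler0_sqrtr//.
by case/orP: h => h; nra.
Qed.

(** The flux through the circle of the field (x.1 chi H, 0), by slices.  The right
    half circle counts twice in the constant, by [arc_right]. *)
Lemma flux_fst (chi : plane -> R) (c : R) G : 0 <= c ->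
  is_C1 setT (fun x => x.1 * (chi x * H x)) G ->
  (forall x, circle x -> chi x = c) ->
  I (G ord0) <= c * (3 * fine L).
Proof.
move=> c0 C hc; have [cF cG _] := is_C1T C.
rewrite -lee_fin (EFin_I mD (cont_intg (cG ord0))) (green_fst C).
have -> : (c * (3 * fine L))%:E = (c%:E * (L + L + L))%E.
  by rewrite -(fineK circle_int_fin) -!EFinD -EFinM; congr EFin => /=; ring.
pose F := fun x : plane => x.1 * (chi x * H x).
rewrite (@eq_integral _ _ _ leb setT (fun y => (F (1 * halfwidth y, y) - F (-1 * halfwidth y, y))%:E));
  last by move=> y _; rewrite mul1r mulN1r.
apply: (@two_arcs c (fun y => H (1 * halfwidth y, y)) (fun y => H (-1 * halfwidth y, y))) => //.
- by move=> y /halfwidth_out ->; rewrite /F /= !mulr0 !mul0r subrr.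
- by move=> y; apply: cvgB; [exact: (@cont_right 1 F cF y)|exact: (@cont_right (-1) F cF y)].
- move=> y hy; have hw := halfwidth_circle hy.
  rewrite /F /= !hc /circle /= ?mulN1r ?sqrrN ?mul1r//.
  have := halfwidth_le1 y; have := sqrtr_ge0 (1 - y ^+ 2); rewrite -/(halfwidth y).
  have := H0 (halfwidth y, y); have := H0 (- halfwidth y, y).
  move: (halfwidth y) (H (- halfwidth y, y)) (H (halfwidth y, y)) => w a b a0 b0 w0 w1.
  rewrite mulNr opprK -!mulrDr.
  have ab0 : 0 <= b + a by exact: addr_ge0.
  by rewrite !mulr_ge0//= ler_piMl// mulr_ge0.
- by apply: leeD; [exact: arc_right|exact: arc_left].
Qed.

Lemma flux_snd (chi : plane -> R) (c : R) G : 0 <= c ->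
  is_C1 setT (fun x => x.2 * (chi x * H x)) G ->
  (forall x, circle x -> chi x = c) ->
  I (G 1) <= c * (2 * fine L).
Proof.
move=> c0 C hc; have [cF cG _] := is_C1T C.
rewrite -lee_fin (EFin_I mD (cont_intg (cG 1))) (green_snd C).
have -> : (c * (2 * fine L))%:E = (c%:E * (L + L))%E.
  by rewrite -(fineK circle_int_fin) -!EFinD -EFinM; congr EFin => /=; ring.
pose F := fun x : plane => x.2 * (chi x * H x).
rewrite (@eq_integral _ _ _ leb setT (fun y => (F (y, 1 * halfwidth y) - F (y, -1 * halfwidth y))%:E));
  last by move=> y _; rewrite mul1r mulN1r.
apply: (@two_arcs c (fun y => H (y, 1 * halfwidth y)) (fun y => H (y, -1 * halfwidth y))) => //.
- by move=> y /halfwidth_out ->; rewrite /F /= !mulr0 !mul0r subrr.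
- by move=> y; apply: cvgB; [exact: (@cont_top 1 F cF y)|exact: (@cont_top (-1) F cF y)].
- move=> y hy; have hw := halfwidth_circle hy.
  rewrite /F /= !hc /circle /= ?mulN1r ?sqrrN ?mul1r// 1?addrC//.
  have := halfwidth_le1 y; have := sqrtr_ge0 (1 - y ^+ 2); rewrite -/(halfwidth y).
  have := H0 (y, halfwidth y); have := H0 (y, - halfwidth y).
  move: (halfwidth y) (H (y, - halfwidth y)) (H (y, halfwidth y)) => w a b a0 b0 w0 w1.
  rewrite mulNr opprK addrC -!mulrDr.
  have ab0 : 0 <= b + a by exact: addr_ge0.
  by rewrite !mulr_ge0//= ler_piMl// mulr_ge0.
- by apply: leeD; [exact: arc_top|exact: arc_bottom].
Qed.
End Boundary.

Section ZeroTrace.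
Implicit Types (f h : plane -> R) (d : R).

Definition coord (k : 'I_2) (x : plane) : R := if k == ord0 then x.1 else x.2.

Lemma is_C1_rad2 (A : set plane) : is_C1 A rad2 (fun k x => 2 * coord k x).
Proof.
have := is_C1D (is_C1M (is_C1_fst A) (is_C1_fst A)) (is_C1M (is_C1_snd A) (is_C1_snd A)).
apply: is_C1_eq => k x; rewrite /coord /basis_vec.
by case: ifP => _ /=; ring.
Qed.

(** A weight that decreases linearly in 1 - |x|^2, from 1 on the circle to 0 where
    1 - |x|^2 = 2 d; hence the gradient of its square is explicit. *)
Definition collar d (x : plane) : R := ppow 1 (1 - (1 - rad2 x) / (2 * d)).

Lemma collar_ge0 d x : 0 <= collar d x.
Proof. exact: ppow_ge0. Qed.

Lemma collar_le1 d x : 0 < d -> disk x -> collar d x <= 1.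
Proof.
move=> d0 Dx; rewrite /collar /ppow expr1 ge_max ler01 andbT.
rewrite gerBl divr_ge0 ?mulr_ge0 ?ltW//.
by rewrite subr_gt0.
Qed.

Lemma collar_gt0 d x : 0 < d -> 0 < collar d x -> 1 - rad2 x < 2 * d.
Proof.
move=> d0; rewrite /collar /ppow expr1 lt_max ltxx orbF subr_gt0.
by rewrite ltr_pdivrMr ?mulr_gt0// mul1r.
Qed.

Lemma is_C1_collar2 d : d != 0 ->
  is_C1 setT (fun x => d * collar d x ^+ 2)
    (fun k x => 2 * collar d x * coord k x).
Proof.
move=> d0.
have C1 := is_C1B (is_C1_cst setT 1) (is_C1Z (2 * d)^-1
  (is_C1B (is_C1_cst setT 1) (is_C1_rad2 setT))).
have c2 : continuous (fun t : R => 2 * ppow 1 t).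
  by move=> t; apply: cvgM; [exact: cvg_cst|exact: ppow_cont].
have := is_C1Z d (is_C1_comp C1 c2 (ppow_derive 0)).
have -> : (fun x : plane => d * ppow 2 (1 - (2 * d)^-1 * (1 - rad2 x))) =
   (fun x => d * collar d x ^+ 2).
  by apply/funext => x; rewrite /collar /ppow expr1 [_ / _]mulrC.
apply: is_C1_eq => k x; rewrite /collar [_ / _]mulrC.
by field.
Qed.

Lemma cont_collar d : continuous (collar d).
Proof.
move=> x; apply: (@continuous_comp _ _ _ (fun x : plane => 1 - (1 - rad2 x) / (2 * d)) (ppow 1)).
  apply: cvgB; first exact: cvg_cst.
  apply: cvgM; last exact: cvg_cst.
  by apply: cvgB; [exact: cvg_cst|exact: cont_rad].
exact: ppow_cont.
Qed.

(** The integrand of [hardy] at the point (x1, x2), where s, a and (g1, g2) are the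
    weight, the function and its gradient.  As d <= 1/4, the weight is positive
    only where x1^2 + x2^2 >= 1/2, and there the second term on the right is at
    least 2 s a^2; Young's inequality absorbs the mixed term. *)
Lemma hardy_pointwise (a s d x1 x2 g1 g2 : R) : 0 < d -> d <= 1 / 4 ->
  0 <= s -> s <= 1 -> x1 ^+ 2 + x2 ^+ 2 <= 1 ->
  (0 < s -> 1 - (x1 ^+ 2 + x2 ^+ 2) < 2 * d) ->
  s * a ^+ 2 <= 2 * (2 * (d * s ^+ 2) * a ^+ 2 +
      2 * s * (x1 ^+ 2 + x2 ^+ 2) * a ^+ 2 +
      2 * (d * s ^+ 2) * a * (x1 * g1 + x2 * g2)) +
    4 * d ^+ 2 * (s * (g1 ^+ 2 + g2 ^+ 2)).
Proof.
move=> d0 d4 s0 s1 r1; rewrite le_eqVlt in s0.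
case/predU1P: s0 => [<- _|sp /(_ sp) hr].
  by rewrite !(mul0r, mulr0, expr0n, addr0)/=.
set r := x1 ^+ 2 + x2 ^+ 2 in r1 hr *; set w := x1 * g1 + x2 * g2.
have hw : w ^+ 2 <= g1 ^+ 2 + g2 ^+ 2.
  have E : w ^+ 2 = r * (g1 ^+ 2 + g2 ^+ 2) - (x1 * g2 - x2 * g1) ^+ 2.
    by rewrite /w /r; ring.
  have := sqr_ge0 (x1 * g2 - x2 * g1).
  have : 0 <= (1 - r) * (g1 ^+ 2 + g2 ^+ 2).
    by rewrite mulr_ge0 ?subr_ge0// addr_ge0 ?sqr_ge0.
  by rewrite E; lra.
set G := g1 ^+ 2 + g2 ^+ 2 in hw *.
have d2 : 0 <= 4 * d ^+ 2 by rewrite mulr_ge0 ?sqr_ge0.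
have s0 := ltW sp.
have h1 : 0 <= s * (a + 2 * d * s * w) ^+ 2 by exact: mulr_ge0 s0 (sqr_ge0 _).
have h2 : 0 <= 4 * d ^+ 2 * s * (G - w ^+ 2).
  by apply: mulr_ge0; [exact: mulr_ge0|rewrite subr_ge0].
have h3 : 0 <= 4 * d ^+ 2 * s * (1 - s ^+ 2) * w ^+ 2.
  have s2 : 0 <= 1 - s ^+ 2 by nra.
  exact: mulr_ge0 (mulr_ge0 (mulr_ge0 d2 s0) s2) (sqr_ge0 _).
have h4 : 0 <= s * (4 * r - 2) * a ^+ 2.
  by apply: mulr_ge0 (sqr_ge0 _); apply: mulr_ge0 => //; lra.
have h5 : 0 <= 4 * (d * s ^+ 2) * a ^+ 2.
  by apply: mulr_ge0 (sqr_ge0 _); apply: mulr_ge0 => //; exact: mulr_ge0 (ltW d0) (sqr_ge0 _).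
by lra.
Qed.

(** The divergence theorem for the field d collar^2 f^2 x.  The part of the
    divergence in which the weight is differentiated controls collar f^2. *)
Lemma hardy f (g : 'I_2 -> plane -> R) d : 0 < d -> d <= 1 / 4 -> is_C1 setT f g ->
  I (fun x => collar d x * f x ^+ 2) <=
  10 * d * fine (circle_int (fun x => f x ^+ 2)) +
  4 * d ^+ 2 * I (fun x => collar d x * (g ord0 x ^+ 2 + g 1 x ^+ 2)).
Proof.
move=> d0 d4 C; have [cf cg _] := is_C1T C.
pose chi x := d * collar d x ^+ 2; pose H x := f x ^+ 2.
have cH : continuous H by exact: cont_sqr.
have H0 x : 0 <= H x by exact: sqr_ge0.
have Cchi : is_C1 setT chi (fun k x => 2 * collar d x * coord k x).
  by apply: is_C1_collar2; rewrite gt_eqF.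
have CH : is_C1 setT H (fun k x => 2 * f x * g k x).
  by apply: is_C1_eq (is_C1M C C) => k x; ring.
have Cp := is_C1M Cchi CH.
have hchi x : circle x -> chi x = d.
  rewrite /circle /chi /collar /rad2 /= => ->.
  by rewrite subrr mul0r subr0 ppowE// !expr1n mulr1.
have F1 := flux_fst cH H0 (ltW d0) (is_C1M (is_C1_fst setT) Cp) hchi.
have F2 := flux_snd cH H0 (ltW d0) (is_C1M (is_C1_snd setT) Cp) hchi.
have [_ cG1 _] := is_C1T (is_C1M (is_C1_fst setT) Cp).
have [_ cG2 _] := is_C1T (is_C1M (is_C1_snd setT) Cp).
have I1 := cont_intg (cG1 ord0); have I2 := cont_intg (cG2 1).
set G1 := (X in I X <= _) in F1; set G2 := (X in I X <= _) in F2.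
set L := fine _ in F1 F2 *.
have I3 : mu2.-integrable disk (EFin \o (fun x => collar d x * (g ord0 x ^+ 2 + g 1 x ^+ 2))).
  apply: cont_intg => x; apply: cvgM; first exact: cont_collar.
  by apply: cvgD; apply: cont_sqr; exact: cg.
have I4 : mu2.-integrable disk (EFin \o (fun x => collar d x * f x ^+ 2)).
  by apply: cont_intg => x; apply: cvgM; [exact: cont_collar|exact: cH].
apply: (@le_trans _ _ (I (fun x => 2 * (G1 x + G2 x) +
    4 * d ^+ 2 * (collar d x * (g ord0 x ^+ 2 + g 1 x ^+ 2))))).
  apply: (le_I mD) => //.
    apply: (intgD mD); last exact: (intgZ mD).
    by apply: (intgZ mD); exact: (intgD mD).
  move=> x Dx.
  have := @hardy_pointwise (f x) (collar d x) d x.1 x.2 (g ord0 x) (g 1 x) d0 d4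
    (collar_ge0 _ _) (collar_le1 d0 Dx) (ltW Dx) (collar_gt0 d0).
  congr (_ <= _ * _ + _); rewrite /G1 /G2 /chi /H /coord /basis_vec /=; ring.
have I12 := intgD mD I1 I2.
rewrite (ID mD (intgZ mD 2 I12) (intgZ mD (4 * d ^+ 2) I3)).
rewrite (IZ mD 2 I12) (IZ mD _ I3) (ID mD I1 I2) lerD2r.
rewrite -/G1 -/G2; lra.
Qed.

(** Equal to 0 if 1 - |x|^2 <= d / 2 and to 1 if 1 - |x|^2 >= d.  Two nested
    truncated squares join these values with a continuous gradient. *)
Definition cutoff d (x : plane) : R :=
  1 - ppow 2 (1 - ppow 2 (2 / d * (1 - rad2 x) - 1)).

Definition cutoff_grad d (k : 'I_2) (x : plane) : R :=
  - (2 * ppow 1 (1 - ppow 2 (2 / d * (1 - rad2 x) - 1)) *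
    (2 * ppow 1 (2 / d * (1 - rad2 x) - 1) * (2 / d * (2 * coord k x)))).

Lemma is_C1_cutoff_fun d : is_C1 setT (cutoff d) (cutoff_grad d).
Proof.
have c2 : continuous (fun t : R => 2 * ppow 1 t).
  by move=> t; apply: cvgM; [exact: cvg_cst|exact: ppow_cont].
have C1 := is_C1B (is_C1Z (2 / d) (is_C1B (is_C1_cst setT 1) (is_C1_rad2 setT)))
  (is_C1_cst setT 1).
have C2 := is_C1B (is_C1_cst setT 1) (is_C1_comp C1 c2 (ppow_derive 0)).
have C3 := is_C1B (is_C1_cst setT 1) (is_C1_comp C2 c2 (ppow_derive 0)).
by apply: is_C1_eq C3 => k x; rewrite /cutoff_grad; ring.
Qed.

Lemma cutoff_eq0 d x : 0 < d -> ~ ddisk (1 - d / 2) x -> cutoff d x = 0.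
Proof.
move=> d0; rewrite /ddisk /= => /negP; rewrite -ltNge => h.
rewrite /cutoff (@ppow_eq0 1 (_ - 1)) ?subr0 ?ppowE ?expr1n ?subrr//.
have : 2 / d * (1 - rad2 x) <= 2 / d * (d / 2).
  by rewrite ler_pM2l ?divr_gt0//; lra.
have -> : 2 / d * (d / 2) = 1 by field; rewrite gt_eqF.
lra.
Qed.

(** Where the cutoff differs from 1 or is not locally constant, 1 - |x|^2 < d, so
    that the weight of the collar is at least 1/2. *)
Lemma cutoff_collar d x k : 0 < d -> disk x ->
  (1 - cutoff d x) ^+ 2 <= 2 * collar d x /\
  cutoff_grad d k x ^+ 2 <= 512 / d ^+ 2 * collar d x.
Proof.
move=> d0 Dx; rewrite /cutoff opprB addrCA subrr addr0 /cutoff_grad.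
set u := 2 / d * (1 - rad2 x) - 1.
have [hd|hd] := leP d (1 - rad2 x).
  have u1 : 1 <= u.
    rewrite /u lerBrDr -[1 + 1]/(2 : R).
    have : 2 / d * d <= 2 / d * (1 - rad2 x) by rewrite ler_pM2l ?divr_gt0.
    by rewrite -mulrA mulVf ?gt_eqF// mulr1.
  have Z : 1 - ppow 2 u <= 0.
    rewrite ppowE; last by apply: le_trans u1.
    by rewrite subr_le0; nra.
  rewrite (ppow_eq0 1 Z) (ppow_eq0 0 Z) mulr0 mul0r oppr0 expr0n /=.
  split; first by rewrite mulr_ge0// collar_ge0.
  exact: mulr_ge0 (divr_ge0 (ler0n _ _) (sqr_ge0 _)) (collar_ge0 _ _).
have sc : 1 / 2 <= collar d x.
  rewrite /collar /ppow expr1 le_max; apply/orP; left.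
  have : (1 - rad2 x) / (2 * d) <= 1 / 2.
    rewrite ler_pdivrMr ?mulr_gt0//; lra.
  lra.
have p0 := ppow_ge0 2 u.
have w0 := ppow_ge0 1 (1 - ppow 2 u).
have w1 : ppow 1 (1 - ppow 2 u) <= 1.
  by rewrite /ppow expr1 ge_max ler01 andbT gerBl.
have P2 (t : R) : ppow 2 t = ppow 1 t ^+ 2 by rewrite /ppow expr1.
split.
  rewrite P2; set w := ppow 1 _ in w0 w1 *.
  have : w ^+ 2 <= 1 by nra.
  have : 0 <= w ^+ 2 by exact: sqr_ge0.
  by nra.
have cx : coord k x ^+ 2 <= 1.
  rewrite /coord; have : rad2 x < 1 by exact: Dx.
  by rewrite /rad2; have := sqr_ge0 x.1; have := sqr_ge0 x.2; case: ifP => _; lra.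
have wu : (ppow 1 (1 - ppow 2 u) * ppow 1 u) ^+ 2 <= 1.
  rewrite exprMn; have [h|h] := leP (1 - ppow 2 u) 0.
    by rewrite ppow_eq0// expr0n mul0r ler01.
  rewrite -(P2 u); set w := ppow 1 _ in w0 w1 *.
  have : w ^+ 2 <= 1 by nra.
  have : 0 <= w ^+ 2 by exact: sqr_ge0.
  by nra.
have -> : (- (2 * ppow 1 (1 - ppow 2 u) * (2 * ppow 1 u * (2 / d * (2 * coord k x))))) ^+ 2 =
   256 / d ^+ 2 * ((ppow 1 (1 - ppow 2 u) * ppow 1 u) ^+ 2 * coord k x ^+ 2).
  by field; rewrite gt_eqF.
have -> : 512 / d ^+ 2 * collar d x = 256 / d ^+ 2 * (2 * collar d x).
  by field; rewrite gt_eqF.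
apply: ler_wpM2l; first exact: divr_ge0 (ler0n _ _) (sqr_ge0 _).
apply: (@le_trans _ _ 1); last by lra.
by rewrite mulr_ile1 ?sqr_ge0.
Qed.

End ZeroTrace.

(** * Functions with vanishing trace *)

Lemma collar_measurable (e : R) : measurable_fun disk (collar e).
Proof. by apply: cont_measurable_disk; exact: cont_collar. Qed.

Lemma collar_cvg0 (h : plane -> R) : sqintD2 h ->
  (fun m : nat => I (fun x => collar m.+4%:R^-1 x * h x ^+ 2)) @ \oo --> (0 : R).
Proof.
move=> [mh Ih].
have E0 : I (fun=> 0 : R) = 0 by rewrite /Rintegral integral0.
rewrite -[X in _ --> X]E0.
have e0 (m : nat) : 0 < m.+4%:R^-1 :> R by rewrite invr_gt0.
apply: (@I_dominated _ _ _ mu2 _ mD _ _ (fun x => h x ^+ 2) _ _ _ _ _).2 => //.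
- move=> m; apply: measurable_funM; first exact: collar_measurable.
  exact: measurable_funX.
- apply: aeW => x Dx; apply: cvg_near_cst.
  have q0 : 0 < (1 - rad2 x) / 2 by rewrite divr_gt0// subr_gt0.
  near=> m.
  rewrite /collar ppow_eq0 ?mul0r// subr_le0.
  rewrite ler_pdivlMr ?mulr_gt0// mul1r.
  rewrite mulrC -ler_pdivlMr//; apply: ltW.
  apply: (@le_lt_trans _ _ m.+1%:R^-1).
    by rewrite lef_pV2 ?posrE// ler_nat -(addn3 m.+1) leq_addr.
  by near: m; exact: (near_infty_natSinv_lt (PosNum q0)).
- move=> m x Dx; rewrite normrM [`|collar _ _|]ger0_norm ?collar_ge0//.
  rewrite ger0_norm ?sqr_ge0// ler_piMl ?sqr_ge0//.
  exact: collar_le1.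
Unshelve. all: by end_near. Qed.

(** The approximation is f n multiplied by a cutoff.  The derivative of the cutoff
    is of size 1/d on the collar, and [hardy] bounds the resulting integral of
    f n ^2 / d^2 there by the mean square of f n on the circle, divided by d, and
    by the energy of f n in the collar.  The width d is chosen first, so that h has
    little energy in the collar, and n afterwards, depending on d. *)
Lemma zero_trace_approx (f : nat -> plane -> R)
    (g : nat -> 'I_2 -> plane -> R) (h : 'I_2 -> plane -> R) (eps : R) :
  0 < eps -> (forall n, is_C1 setT (f n) (g n)) ->
  (forall k, sqintD2 (h k)) ->
  (forall k, (fun n => I (fun x => (g n k x - h k x) ^+ 2)) @ \oo --> (0 : R)) ->
  (fun n => fine (circle_int (fun x => f n x ^+ 2))) @ \oo --> (0 : R) ->
  exists z w (r : R), [/\ is_C1 setT z w, r < 1, forall x, ~ ddisk r x -> z x = 0 &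
    forall k, I (fun x => (h k x - w k x) ^+ 2) < eps].
Proof.
move=> eps0 C Sh cvg_g cvg_L.
pose S m := I (fun x => collar m.+4%:R^-1 x * h ord0 x ^+ 2) +
  I (fun x => collar m.+4%:R^-1 x * h 1 x ^+ 2).
have cS : S @ \oo --> (0 : R).
  by rewrite -[X in _ --> X](addr0 0); apply: cvgD; exact: collar_cvg0.
pose e k n := I (fun x => (g n k x - h k x) ^+ 2).
(* The constants of the three error terms add up to less than 10^5. *)
pose c : R := eps / 10 ^+ 5.
have c0 : 0 < c by rewrite divr_gt0.
have [m Sm] : exists m, S m < c.
  have : \forall m \near \oo, S m < c by apply: (cvgr_lt _ cS).
  by move=> [N _ /(_ N (leqnn N))]; exists N.
pose d : R := m.+4%:R^-1.
have d0 : 0 < d by rewrite invr_gt0.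
have d4 : d <= 1 / 4 by rewrite div1r lef_pV2 ?posrE// (ler_nat _ 4).
have [n [en0 en1 Ln]] : exists n, [/\ e ord0 n < c, e 1 n < c &
    fine (circle_int (fun x => f n x ^+ 2)) < c * d].
  have h1 : \forall n \near \oo, e ord0 n < c by apply: (cvgr_lt _ (cvg_g _)).
  have h2 : \forall n \near \oo, e 1 n < c by apply: (cvgr_lt _ (cvg_g _)).
  have h3 : \forall n \near \oo, fine (circle_int (fun x => f n x ^+ 2)) < c * d.
    by apply: (cvgr_lt _ cvg_L); exact: mulr_gt0.
  have [N _ /(_ N (leqnn N)) [? [? ?]]] := filterI h1 (filterI h2 h3).
  by exists N.
have Cz := is_C1M (is_C1_cutoff_fun d) (C n).
exists (fun x => cutoff d x * f n x),
  (fun k x => cutoff d x * g n k x + f n x * cutoff_grad d k x), (1 - d / 2).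
split=> //; first by rewrite ltrBlDr ltrDl divr_gt0.
  by move=> x nx; rewrite cutoff_eq0// mul0r.
have [cf cg _] := is_C1T (C n).
have cc := @cont_collar d.
have Sg k : sqintD2 (g n k).
  have [M HM] := cont_bounded_cdisk (cg k).
  apply: (sqint_bounded mD fD (M := M)); first exact: cont_measurable_disk.
  by move=> x /disk_cdisk; exact: HM.
have bcol x : disk x -> `|collar d x| <= 1.
  by move=> Dx; rewrite ger0_norm ?collar_ge0 ?collar_le1.
have mcol := collar_measurable d.
have Se k : sqintD2 (fun x => g n k x - h k x) by exact: sqintB.
have Ie k := (Se k).2.
have Isg k : mu2.-integrable disk (EFin \o (fun x => collar d x * g n k x ^+ 2)).
  by apply: (intgM_bounded mD mcol bcol); exact: (Sg k).2.
have Ish k : mu2.-integrable disk (EFin \o (fun x => collar d x * h k x ^+ 2)).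
  by apply: (intgM_bounded mD mcol bcol); exact: (Sh k).2.
have Isf : mu2.-integrable disk (EFin \o (fun x => collar d x * f n x ^+ 2)).
  by apply: cont_intg => x; apply: cvgM; [exact: cc|exact: cont_sqr].
have sg_le k : I (fun x => collar d x * g n k x ^+ 2) <=
    2 * e k n + 2 * I (fun x => collar d x * h k x ^+ 2).
  rewrite -(IZ mD 2 (Ie k)) -(IZ mD 2 (Ish k)) -(ID mD (intgZ mD 2 (Ie k)) (intgZ mD 2 (Ish k))).
  apply: (le_I mD) => //; first exact: (intgD mD (intgZ mD 2 (Ie k)) (intgZ mD 2 (Ish k))).
  by move=> x Dx; apply: collar_pointwise; [exact: collar_ge0|exact: collar_le1].
have Hd := hardy d0 d4 (C n).
have sumE : I (fun x => collar d x * (g n ord0 x ^+ 2 + g n 1 x ^+ 2)) =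
    I (fun x => collar d x * g n ord0 x ^+ 2) + I (fun x => collar d x * g n 1 x ^+ 2).
  by rewrite -(ID mD (Isg ord0) (Isg 1)); apply: eq_I => // x _; rewrite mulrDr.
move=> k.
have Swk : sqintD2 (fun x => h k x - (cutoff d x * g n k x + f n x * cutoff_grad d k x)).
  apply: (sqintB mD) => //.
  have [_ cw _] := is_C1T Cz.
  have [M HM] := cont_bounded_cdisk (cw k).
  apply: (sqint_bounded mD fD (M := M)); first exact: cont_measurable_disk.
  by move=> x /disk_cdisk; exact: HM.
pose q : R := 512 / d ^+ 2.
apply: (@le_lt_trans _ _ (I (fun x => 3 * ((g n k x - h k x) ^+ 2) +
   (6 * (collar d x * g n k x ^+ 2) + 3 * q * (collar d x * f n x ^+ 2))))).
  apply: (le_I mD); first exact: Swk.2.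
    exact: (intgD mD (intgZ mD _ (Ie k)) (intgD mD (intgZ mD _ (Isg k)) (intgZ mD _ Isf))).
  move=> x Dx.
  have [h1 h2] := cutoff_collar k d0 Dx.
  exact: cutoff_pointwise.
rewrite (ID mD (intgZ mD _ (Ie k)) (intgD mD (intgZ mD _ (Isg k)) (intgZ mD _ Isf))).
rewrite (ID mD (intgZ mD _ (Isg k)) (intgZ mD _ Isf)).
rewrite (IZ mD _ (Ie k)) (IZ mD _ (Isg k)) (IZ mD _ Isf).
have S0 l : 0 <= I (fun x => collar d x * h l x ^+ 2).
  by apply: I_ge0 => x _; rewrite mulr_ge0 ?collar_ge0 ?sqr_ge0.
have ek l : e l n < c.
  by have [->|->] := ord2P l.
have Sk l : I (fun x => collar d x * h l x ^+ 2) < c.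
  by apply: le_lt_trans Sm; have [->|->] := ord2P l; rewrite ?lerDl ?lerDr S0.
have gk l : I (fun x => collar d x * g n l x ^+ 2) <= 4 * c.
  apply: le_trans (sg_le l) _; have -> : 4 * c = 2 * c + 2 * c by clear; ring.
  by apply: lerD; rewrite ler_pM2l// ltW.
rewrite sumE in Hd.
have hG : I (fun x => collar d x * g n ord0 x ^+ 2) +
    I (fun x => collar d x * g n 1 x ^+ 2) <= 8 * c.
  have -> : 8 * c = 4 * c + 4 * c by clear; ring.
  by apply: lerD; exact: gk.
have hA := hardy_arith d0 c0 Ln hG Hd.
have -> : eps = 10 ^+ 5 * c by rewrite /c; field.
rewrite -[3 * q * _]mulrA.
apply: sum_arith => //; first exact: ek.
have -> : 512 * (42 * c) = q * (d ^+ 2 * (42 * c)).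
  by rewrite /q; field; rewrite gt_eqF.
by apply: ler_wpM2l hA; exact: divr_ge0 (ler0n _ _) (sqr_ge0 _).
Qed.

(** * Lipschitz functions: extension and smoothing *)

Section Lipschitz.
Implicit Types (f v : plane -> R) (L h : R).

(** The l^1 distance: Lipschitz constants with respect to it bound the partial
    derivatives, and the averages below act on one coordinate at a time. *)
Definition dist1 (x y : plane) : R := `|x.1 - y.1| + `|x.2 - y.2|.

Lemma dist1_triangle y x z : dist1 x z <= dist1 x y + dist1 y z.
Proof.
rewrite /dist1; have := ler_distD y.1 x.1 z.1; have := ler_distD y.2 x.2 z.2; lra.
Qed.

Lemma dist1C x y : dist1 x y = dist1 y x.
Proof. by rewrite /dist1 distrC [`|x.2 - _|]distrC. Qed.

Lemma dist1xx x : dist1 x x = 0.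
Proof. by rewrite /dist1 !subrr normr0 addr0. Qed.

Definition lip1 L f := forall x y, `|f x - f y| <= L * dist1 x y.

(** The McShane extension: the infimum of the cones above the graph. *)
Lemma mcshane (A : set plane) f L : A !=set0 -> 0 <= L ->
  (forall x y, A x -> A y -> `|f x - f y| <= L * dist1 x y) ->
  exists F, lip1 L F /\ forall x, A x -> F x = f x.
Proof.
move=> [a Aa] L0 fL.
pose E x := [set f y + L * dist1 x y | y in A].
have lbE x : lbound (E x) (f a - L * dist1 x a).
  move=> _ [y Ay <-]; have := fL a y Aa Ay; rewrite ler_norml => /andP[_ h].
  have : L * dist1 a y <= L * (dist1 a x + dist1 x y).
    by rewrite ler_wpM2l// dist1_triangle.
  by rewrite (dist1C a x); lra.
have iE x : has_inf (E x).
  by split; [exists (f a + L * dist1 x a); exists a|exists (f a - L * dist1 x a)].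
have infE x y : A y -> inf (E x) <= f y + L * dist1 x y.
  by move=> Ay; apply: ge_inf; [exact: (iE x).2|exists y].
have H x y : inf (E x) <= inf (E y) + L * dist1 x y.
  rewrite -lerBlDr; apply: lb_le_inf; first exact: (iE y).1.
  move=> _ [z Az <-]; rewrite lerBlDr; apply: le_trans (infE x z Az) _.
  have : L * dist1 x z <= L * (dist1 x y + dist1 y z).
    by rewrite ler_wpM2l// dist1_triangle.
  by lra.
exists (fun x => inf (E x)); split=> [x y|x Ax].
  rewrite ler_distl; apply/andP; split; last by have := H x y; lra.
  by have := H y x; rewrite dist1C; lra.
apply/le_anti/andP; split; first by have := infE x x Ax; rewrite dist1xx mulr0 addr0.
apply: lb_le_inf; first exact: (iE x).1.
move=> _ [y Ay <-]; have := fL x y Ax Ay; rewrite ler_norml => /andP[_]; lra.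
Qed.

Lemma norm_dist1 (x y : plane) : `|x - y| <= dist1 x y.
Proof.
rewrite /Num.norm /= ge_max /dist1.
by rewrite lerDl lerDr !normr_ge0.
Qed.

Lemma lip1_cont L f : lip1 L f -> continuous f.
Proof.
move=> fL x; apply/cvgrPdist_lt => e e0.
have c : (fun y : plane => L * dist1 x y) @ x --> L * dist1 x x.
  have cn (a : R) (p : plane -> R) : continuous p -> continuous (fun y => `|a - p y|).
    move=> cp y; apply: (@continuous_comp _ _ _ (fun y => a - p y) (fun t : R => `|t|)).
      by apply: cvgB; [exact: cvg_cst|exact: cp].
    exact: (@norm_continuous R R^o).
  apply: cvgM; first exact: cvg_cst.
  by apply: cvgD; apply: cn; [exact: cont_fst|exact: cont_snd].
rewrite dist1xx mulr0 in c.
near=> y; apply: (le_lt_trans (fL x y)); near: y.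
exact: (cvgr_lt _ c).
Unshelve. all: by end_near. Qed.

Lemma lip1_swap L f : lip1 L f -> lip1 L (fun x => f (x.2, x.1)).
Proof.
move=> hf x y; apply: le_trans (hf _ _) _.
by rewrite /dist1 /= addrC.
Qed.

Lemma lip1_shift L f (a : R) : lip1 L f -> lip1 L (fun x => f (x.1 + a, x.2)).
Proof.
move=> hf x y; apply: le_trans (hf _ _) _; rewrite /dist1 /=.
by have -> : x.1 + a - (y.1 + a) = x.1 - y.1 by ring.
Qed.

Section Steklov.
Variables (h : R).
Hypothesis h0 : 0 < h.
Local Notation J := ([set` `[0, h]%R] : set (measurableTypeR R)).
Local Notation IJ p := (\int[leb]_(t in J) p t).

Let mJ : measurable J. Proof. exact: measurable_itv. Qed.

Let fJ : leb J = h%:E.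
Proof. by rewrite lebesgue_measure_itv /= lte_fin h0 -EFinB subr0. Qed.

Let cintJ (p : R -> R) : continuous p -> leb.-integrable J (EFin \o p).
Proof. exact: cont_itv_intg. Qed.

Let Icst (c : R) : IJ (fun=> c) = c * h.
Proof. by rewrite Rintegral_cst//; congr (c * _); exact: (f_equal fine fJ). Qed.

Definition mean1 f (x : plane) : R := h^-1 * IJ (fun t => f (x.1 + t, x.2)).

Lemma cont_line f (a b : R) : continuous f -> continuous (fun t => f (a + t, b)).
Proof.
move=> cf t; apply: (@continuous_comp _ _ _ (fun t : R => (a + t, b)) f); last exact: cf.
apply: (@cvg_pair _ _ _ (nbhs t) (nbhs (a + t)) (nbhs b)); last exact: cvg_cst.
by apply: cvgD; [exact: cvg_cst|exact: cvg_id].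
Qed.

Let le_IJ (p : R -> R) M : continuous p -> (forall t, 0 <= t <= h -> `|p t| <= M) ->
  `|IJ p| <= M * h.
Proof.
move=> cp bp; have Ip := cintJ cp.
apply: le_trans (I_norm mJ Ip) _.
rewrite -Icst; apply: (le_I mJ).
- exact: integrable_norm.
- by apply: cintJ => t; exact: cvg_cst.
- by move=> t; rewrite /= in_itv /=; exact: bp.
Qed.

Lemma mean1_bound f M : continuous f -> (forall x, `|f x| <= M) ->
  forall x, `|mean1 f x| <= M.
Proof.
move=> cf bf x; rewrite /mean1 normrM gtr0_norm ?invr_gt0//.
rewrite ler_pdivrMl// mulrC; apply: le_IJ; first exact: cont_line.
by move=> t _; exact: bf.
Qed.

Lemma mean1_lip L f : lip1 L f -> lip1 L (mean1 f).
Proof.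
move=> hf x y; have cf := lip1_cont hf.
have cx := @cont_line f x.1 x.2 cf; have cy := @cont_line f y.1 y.2 cf.
rewrite /mean1 -mulrBr normrM gtr0_norm ?invr_gt0// ler_pdivrMl// mulrC.
rewrite -(IB mJ (cintJ cx) (cintJ cy)); apply: le_IJ.
  by move=> t; apply: cvgB; [exact: cx|exact: cy].
move=> t _; apply: le_trans (hf _ _) _; rewrite /dist1 /=.
by have -> : x.1 + t - (y.1 + t) = x.1 - y.1 by ring.
Qed.

Lemma mean1_close L f x : 0 <= L -> lip1 L f -> `|mean1 f x - f x| <= L * h.
Proof.
move=> L0 hf; have cf := lip1_cont hf; have cx := @cont_line f x.1 x.2 cf.
have -> : mean1 f x - f x = h^-1 * (IJ (fun t => f (x.1 + t, x.2)) - IJ (fun=> f x)).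
  by rewrite Icst /mean1; field; rewrite gt_eqF.
rewrite normrM gtr0_norm ?invr_gt0// ler_pdivrMl// mulrC.
rewrite -(IB mJ (cintJ cx)); last by apply: cintJ => t; exact: cvg_cst.
apply: le_IJ; first by move=> t; apply: cvgB; [exact: cx|exact: cvg_cst].
move=> t /andP[t0 th]; apply: le_trans (hf _ _) _; rewrite ler_wpM2l// /dist1 /=.
by rewrite subrr normr0 addr0 (_ : x.1 + t - x.1 = t) ?ger0_norm//; ring.
Qed.

Lemma integral_shift (p : R -> R) (a : R) : continuous p ->
  IJ (fun t => p (a + t)) = \int[leb]_(t in [set` `[a, a + h]%R]) p t.
Proof.
move=> cp; rewrite /Rintegral; congr fine.
have d (t : R) : is_derive t (1 : R) (fun t : R => a + t) 1.
  have := is_deriveD (is_derive_cst a t (1 : R)) (is_derive_id t (1 : R)).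
  by rewrite add0r.
have E : (fun t : R => a + t)^`()%classic = cst 1.
  by apply/funext => t; rewrite derive1E; have [] := d t.
have := @integration_by_substitution_increasing R (fun t => a + t) p 0 h (ltW h0).
rewrite addr0 => ->.
- apply: eq_integral => t _; rewrite E /=; congr EFin.
  by rewrite [RHS]mulr1.
- by move=> x y _ _; rewrite ltrD2l.
- by rewrite E => x _; exact: cvg_cst.
- by rewrite E; apply/cvg_ex; exists 1; exact: cvg_cst.
- by rewrite E; apply/cvg_ex; exists 1; exact: cvg_cst.
- exact: derive_LR d.
- exact: continuous_subspaceT.
Qed.

Lemma mean1_derive f (x : plane) : continuous f ->
  is_derive x (basis_vec ord0) (mean1 f) (h^-1 * (f (x.1 + h, x.2) - f x)).
Proof.
case: x => x y cf /=.
suff D : is_derive x (1 : R) (fun s => mean1 f (s, y)) (h^-1 * (f (x + h, y) - f (x, y))).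
  move: D => /is_derive_line D; apply/is_derive_line.
  suff -> : (fun t : R => mean1 f (t *: basis_vec ord0 + (x, y))) =
            (fun t : R => mean1 f (t *: (1 : R) + x, y)) by [].
  apply/funext => t; congr (mean1 f _); rewrite /basis_vec /=.
  by congr (_, _); rewrite /= /GRing.scale /= mulr0 add0r.
pose p s := f (s, y); have cp : continuous p by exact: cont_pairl.
pose a := x - 1.
pose P s := \int[leb]_(t in [set` `[a, s]%R]) p t.
have ip (u : R) := cont_itv_intg a u cp.
have dP s : a < s -> is_derive s (1 : R) P (p s).
  move=> as_; have s1 : s < s + 1 by rewrite ltrDl.
  have [d1 d2] := @continuous_FTC1_closed R p a s (s + 1) s1 (ip _) as_ (cp s).
  by apply: DeriveDef; [exact: d1|rewrite -derive1E d2].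
have ax : a < x by rewrite /a; lra.
have axh : a < x + h by apply: lt_trans ax _; rewrite ltrDl.
have dsh : is_derive x (1 : R) (fun s : R => s + h) 1.
  have := is_deriveD (is_derive_id x (1 : R)) (is_derive_cst h x (1 : R)).
  by rewrite addr0.
have dPh := @is_derive1_comp R P (fun s : R => s + h) x _ _ (dP _ axh) dsh.
have dd := is_deriveZ h^-1 (is_deriveB dPh (dP _ ax)).
rewrite mulr1 in dd.
apply: near_eq_is_derive dd.
near=> s.
have as_ : a < s by near: s; exact: lt_nbhsr.
have ash : (BLeft a <= BRight s)%O by rewrite bnd_simp ltW.
have ssh : (BRight s <= BRight (s + h))%O by rewrite bnd_simp lerDl ltW.
have E1 := @Rintegral_itvB R p (BLeft a) (BRight (s + h)) s (ip (s + h)) ash ssh.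
have Is : leb.-integrable [set` Interval (BRight s) (BRight (s + h))] (EFin \o p).
  apply: integrableS (ip (s + h)); [exact: measurable_itv|exact: measurable_itv|].
  exact: subset_itvr.
transitivity (h^-1 * (P (s + h) - P s)); first by [].
rewrite [LHS](f_equal (fun c : R => h^-1 * c) E1) (Rintegral_itv_obnd_cbnd Is).
by rewrite -(@integral_shift p s cp).
Unshelve. all: by end_near. Qed.

Lemma mean1_slope L f : 0 <= L -> lip1 L f ->
  forall x, `|h^-1 * (f (x.1 + h, x.2) - f x)| <= L.
Proof.
move=> L0 hf x; rewrite normrM gtr0_norm ?invr_gt0// ler_pdivrMl// mulrC.
apply: le_trans (hf _ _) _; rewrite ler_wpM2l// /dist1 /= subrr normr0 addr0.
by rewrite (_ : x.1 + h - x.1 = h) ?gtr0_norm//; ring.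
Qed.

Lemma slope_lip L f : lip1 L f ->
  lip1 (h^-1 * (L + L)) (fun x => h^-1 * (f (x.1 + h, x.2) - f x)).
Proof.
move=> hf x y; rewrite -mulrBr normrM gtr0_norm ?invr_gt0// -mulrA.
apply: ler_wpM2l; first by rewrite invr_ge0 ltW.
rewrite mulrDl.
have := lip1_shift h hf x y; have := hf x y.
have := ler_normB (f (x.1 + h, x.2) - f (y.1 + h, y.2)) (f x - f y).
have -> : f (x.1 + h, x.2) - f (y.1 + h, y.2) - (f x - f y) =
  f (x.1 + h, x.2) - f x - (f (y.1 + h, y.2) - f y) by ring.
lra.
Qed.

Definition swap (x : plane) : plane := (x.2, x.1).

Definition mean2 f (x : plane) : R := mean1 (f \o swap) (swap x).

Lemma is_derive_swap f (x : plane) (a : R) :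
  is_derive (swap x) (basis_vec ord0) (f \o swap) a -> is_derive x (basis_vec 1) f a.
Proof.
move=> /is_derive_line D; apply/is_derive_line.
Qed.

(** Differentiation of an average in the variable that is not averaged. *)
Lemma mean2_derive0 f f' (x : plane) M :
  continuous f -> continuous f' -> (forall x, `|f' x| <= M) ->
  (forall x, is_derive x (basis_vec ord0) f (f' x)) ->
  is_derive x (basis_vec ord0) (mean2 f) (mean2 f' x).
Proof.
move=> cf cf' bf' df; case: x => x y.
have M0 : 0 <= M by exact: le_trans (bf' (x, y)).
pose F (s t : R) := f (s, y + t).
have dF s t : is_derive s (1 : R) (F ^~ t) (f' (s, y + t)).
  exact: is_derive_fst (df _).
have E s t : partial1of2 F s t = f' (s, y + t).
  by rewrite partial1of2E; have [] := dF s t.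
have cfl (p : plane -> R) (s : R) : continuous p -> continuous (fun t => p (s, y + t)).
  move=> cp t; apply: (@continuous_comp _ _ _ (fun t => y + t) (fun u => p (s, u))).
    by apply: cvgD; [exact: cvg_cst|exact: cvg_id].
  exact: (cont_pairr cp).
have Ix : `]x - 1, x + 1[%classic x by rewrite /= in_itv /=; apply/andP; split; lra.
have i1 s : `]x - 1, x + 1[%classic s -> leb.-integrable J (EFin \o F s).
  by move=> _; apply: cintJ; exact: cfl.
have i2 s t : `]x - 1, x + 1[%classic s -> J t -> derivable (F ^~ t) s 1.
  by move=> _ _; have [] := dF s t.
have i3 : leb.-integrable J (EFin \o (fun=> M)).
  by apply: cintJ => t; exact: cvg_cst.
have i4 s t : `]x - 1, x + 1[%classic s -> J t -> `|partial1of2 F s t| <= M.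
  by move=> _ _; rewrite E.
have D : is_derive x (1 : R) (fun s => IJ (F s)) (IJ (fun t => f' (x, y + t))).
  apply: DeriveDef; first exact: (@derivable_under_integral _ _ _ leb F J mJ x _ _ Ix i1 i2 (fun=> M)).
  rewrite -derive1E (@differentiation_under_integral _ _ _ leb F J mJ x _ _ Ix i1 i2 (fun=> M))//.
  by apply: eq_I => // t _; exact: E.
have D2 := is_deriveZ h^-1 D.
move: D2 => /is_derive_line D2; apply/is_derive_line.
suff -> : (fun t : R => mean2 f (t *: basis_vec ord0 + (x, y))) =
          (fun t : R => (h^-1 \*: (fun s => IJ (F s))) (t *: (1 : R) + x)) by [].
apply/funext => t; rewrite /mean2 /mean1 /swap /basis_vec /= /GRing.scale /=.
by rewrite mulr0 add0r.
Qed.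

Lemma cont_swap f : continuous f -> continuous (f \o swap).
Proof.
move=> cf x; apply: (@continuous_comp _ _ _ swap f); last exact: cf.
by apply: (@cvg_pair _ _ _ (nbhs x) (nbhs x.2) (nbhs x.1)); [exact: cont_snd|exact: cont_fst].
Qed.

(** The average of v over squares of side h.  Its partial derivatives are averages of
    difference quotients of v, hence continuous and bounded by the Lipschitz
    constant. *)
Lemma steklov L v : 0 <= L -> lip1 L v -> exists s g,
  [/\ is_C1 setT s g, forall k x, `|g k x| <= L & forall x, `|s x - v x| <= 2 * L * h].
Proof.
move=> L0 hv.
pose w := mean1 v; have hw : lip1 L w by exact: mean1_lip.
have hws : lip1 L (w \o swap) by exact: lip1_swap.
pose D := fun x => h^-1 * (v (x.1 + h, x.2) - v x).
have hD : lip1 (h^-1 * (L + L)) D by exact: slope_lip.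
have bD x : `|D x| <= L by exact: mean1_slope.
have cv := lip1_cont hv; have cw := lip1_cont hw.
have cD := lip1_cont hD; have cws := lip1_cont hws.
pose g (k : 'I_2) x := if k == ord0 then mean2 D x
  else h^-1 * (w (x.1, x.2 + h) - w x).
have g0 : g ord0 = mean2 D by apply/funext => x.
have g1 : g 1 = (fun y => h^-1 * ((w \o swap) (y.1 + h, y.2) - (w \o swap) y)) \o swap.
  by apply/funext => -[x y].
exists (mean2 w), g; split.
- split=> [x _|k x _|k x _].
  + exact: (cont_swap (lip1_cont (mean1_lip hws))).
  + have [->|->] := ord2P k; rewrite ?g0 ?g1.
      exact: (cont_swap (lip1_cont (mean1_lip (lip1_swap hD)))).
    exact: (cont_swap (lip1_cont (slope_lip hws))).
  + have [->|->] := ord2P k; rewrite ?g0 ?g1.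
      exact: (mean2_derive0 x cw cD bD (fun x => mean1_derive x cv)).
    apply: is_derive_swap.
    have -> : mean2 w \o swap = mean1 (w \o swap) by apply/funext => -[].
    exact: (mean1_derive (swap x) (lip1_cont hws)).
- move=> k x; have [->|->] := ord2P k; rewrite ?g0 ?g1.
    by apply: (mean1_bound (cont_swap cD)) => y; exact: bD.
  exact: (mean1_slope L0 hws (swap x)).
- move=> x; have h1 := @mean1_close L v x L0 hv.
  have := @mean1_close L (w \o swap) (swap x) L0 hws.
  have -> : (w \o swap) (swap x) = w x by case: x {h1}.
  rewrite -/(mean2 w x) => h2.
  have := ler_distD (w x) (mean2 w x) (v x); rewrite -/w in h1; lra.
Qed.

End Steklov.

End Lipschitz.

(** * Weak gradients of Lipschitz functions *)

Section Completeness.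

Lemma sqr_diff_le (a b L : R) : `|a| <= L -> `|b| <= L -> (a - b) ^+ 2 <= (2 * L) ^+ 2.
Proof.
rewrite !ler_norml => /andP[h1 h2] /andP[h3 h4].
have e1 : 0 <= 2 * L - (a - b) by lra.
have e2 : 0 <= 2 * L + (a - b) by lra.
have := mulr_ge0 e1 e2; lra.
Qed.

Lemma mid_le (a b c M : R) : `|a - c| <= M -> `|b - c| <= M ->
  `|2^-1 * (a + b) - c| <= M.
Proof.
rewrite !ler_norml => /andP[h1 h2] /andP[h3 h4].
by apply/andP; split; lra.
Qed.

(** The bookkeeping of the parallelogram law in [minimizing_sequence]. *)
Lemma par_arith (a0 a1 b0 b1 x0 x1 dn dm l i j : R) :
  dn <= (2^-1 * a0 + 2^-1 * b0 - 4^-1 * x0) + (2^-1 * a1 + 2^-1 * b1 - 4^-1 * x1) ->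
  a0 + a1 < dn + i -> b0 + b1 < dm + j -> dm <= l -> j <= i ->
  x0 + x1 <= 2 * (l - dn) + 4 * i.
Proof. lra. Qed.

Lemma summable_cvg (x : nat -> R) :
  (\sum_(j <oo) (`|x j.+1 - x j|)%:E < +oo)%E -> cvgn x.
Proof.
move=> S.
have t0 (n : nat) : (true -> 0 <= (`|x n.+1 - x n|)%:E)%E by rewrite lee_fin.
have tf : (\sum_(j <oo) (`|x j.+1 - x j|)%:E)%E \is a fin_num.
  by rewrite ge0_fin_numE//; apply: nneseries_ge0 => n _; exact: t0.
have c : cvgn [normed series (telescope x)].
  apply: nondecreasing_is_cvgn.
    by apply: nondecreasing_series => n _ _; exact: normr_ge0.
  exists (fine (\sum_(j <oo) (`|x j.+1 - x j|)%:E)%E) => _ [n _ <-].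
  rewrite -lee_fin fineK//.
  apply: le_trans (nneseries_lim_ge n _); last by move=> k _ _; rewrite lee_fin.
  by rewrite /series /= sumEFin.
have := normed_cvg c.
rewrite telescopeK => c2.
have -> : x = (fun n => (x n - x 0%N) + x 0%N) by apply/funext => n; rewrite subrK.
by apply: is_cvgD => //; exact: is_cvg_cst.
Qed.

(** Along a rapidly convergent subsequence the sum of the absolute values of the
    increments has a finite integral, so it is finite almost everywhere, and where
    it is the subsequence converges.  Truncation at the level L keeps the limit
    bounded at the other points. *)
Lemma L2_complete (r : nat -> plane -> R) (L : R) (eps : nat -> R) :
  0 <= L -> (forall n, measurable_fun disk (r n)) ->
  (forall n x, disk x -> `|r n x| <= L) ->
  (forall n m, (n <= m)%N -> I (fun x => (r n x - r m x) ^+ 2) <= eps n) ->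
  eps @ \oo --> (0 : R) ->
  exists G : plane -> R, [/\ measurable_fun disk G, forall x, disk x -> `|G x| <= L &
    (fun n => I (fun x => (r n x - G x) ^+ 2)) @ \oo --> (0 : R)].
Proof.
move=> L0 mr br cau ceps.
have Sr n : sqintD2 (r n) by exact: (sqint_bounded mD fD (mr n) (br n)).
pose p (j : nat) : R := (2 ^ j.+1)%:R.
have p0 j : 0 < p j by rewrite ltr0n expn_gt0.
have ex j : exists N, forall n, (N <= n)%N -> eps n <= (p j ^+ 2)^-1.
  have h : 0 < (p j ^+ 2)^-1 by rewrite invr_gt0 exprn_gt0.
  have : \forall n \near \oo, eps n < (p j ^+ 2)^-1 by apply: (cvgr_lt _ ceps).
  by move=> [N _ HN]; exists N => n nN; apply: ltW; exact: HN.
have [N HN] := choice ex.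
pose n_ (j : nat) := (\sum_(i < j.+1) (N i).+1)%N.
have nS j : (n_ j <= n_ j.+1)%N by rewrite /n_ [leqRHS]big_ord_recr leq_addr.
have nN j : (N j <= n_ j)%N.
  by rewrite /n_ big_ord_recr /= (leq_trans (leqnSn _))// leq_addl.
have nj j : (j <= n_ j)%N.
  elim: j => [//|j IH]; rewrite /n_ big_ord_recr /=.
  by rewrite (leq_trans (IH : (j.+1 <= (n_ j).+1)%N))// -addn1 leq_add.
pose u j x := `|r (n_ j.+1) x - r (n_ j) x|.
have u0 j x : 0 <= u j x by exact: normr_ge0.
have Sd n m : sqintD2 (fun x => r n x - r m x) by exact: sqintB.
have mu_ j : measurable_fun disk (u j).
  by apply: measurableT_comp => //; exact: (Sd _ _).1.
have Iu j : mu2.-integrable disk (EFin \o u j).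
  by apply: integrable_norm; exact: (sqint_intg mD fD (Sd _ _)).
pose c := I (fun=> 1 : R) + 1.
have I1 : mu2.-integrable disk (EFin \o (fun=> 1 : R)).
  by apply: cont_intg => x; exact: cvg_cst.
have c0 : 0 <= c by rewrite addr_ge0//; apply: I_ge0 => x _.
have uj j : I (u j) <= c / p j.
  have hj : I (fun x => (r (n_ j) x - r (n_ j.+1) x) ^+ 2) <= (p j ^+ 2)^-1.
    by apply: le_trans (cau _ _ (nS j)) _; exact: HN.
  have Isq := (Sd (n_ j) (n_ j.+1)).2.
  (* |a| <= 1 / p + p a^2 turns a bound in the mean square into one in the mean. *)
  apply: (@le_trans _ _ (I (fun x => (p j)^-1 * 1 + p j * (r (n_ j) x - r (n_ j.+1) x) ^+ 2))).
    apply: (le_I mD) => //; first exact: (intgD mD (intgZ mD _ I1) (intgZ mD _ Isq)).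
    move=> x _; rewrite /u distrC; set a := r _ x - r _ x.
    rewrite -(real_normK (num_real a)); set b := `|a|.
    have b0 : 0 <= b by exact: normr_ge0.
    have E : (p j)^-1 * 1 + p j * b ^+ 2 - b =
       (p j)^-1 * ((p j * b - 1 / 2) ^+ 2 + 3 / 4) by field; rewrite gt_eqF.
    have q0 : 0 <= (p j * b - 1 / 2) ^+ 2 + 3 / 4.
      by rewrite addr_ge0 ?sqr_ge0// divr_ge0.
    by rewrite -subr_ge0 E mulr_ge0// invr_ge0 ltW.
  rewrite (ID mD (intgZ mD _ I1) (intgZ mD _ Isq)) (IZ mD _ I1) (IZ mD _ Isq).
  have -> : c / p j = (p j)^-1 * I (fun=> 1 : R) + p j * (p j ^+ 2)^-1.
    by rewrite /c; field; rewrite gt_eqF.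
  by rewrite lerD2l ler_wpM2l// ltW.
pose W x : \bar R := (\sum_(j <oo) (u j x)%:E)%E.
have mW : measurable_fun disk W.
  apply: ge0_emeasurable_sum => [j x _ _|j _]; first by rewrite lee_fin u0.
  exact/measurable_EFinP.
have W0 x : (0 <= W x)%E by apply: nneseries_ge0 => j _; rewrite lee_fin.
have IW : mu2.-integrable disk W.
  apply/integrableP; split=> //.
  under eq_integral do rewrite gee0_abs//.
  have mu' j : measurable_fun disk (fun x => (u j x)%:E) by exact/measurable_EFinP.
  have u0' j x : disk x -> (0 <= (u j x)%:E)%E by rewrite lee_fin u0.
  rewrite /W (integral_nneseries _ mD mu' u0').
  apply: (@le_lt_trans _ _ c%:E); last exact: ltry.
  apply: le_trans (epsilon_trick0 xpredT c0).
  apply: lee_nneseries => [j _ _|j _].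
    by apply: integral_ge0 => x _; rewrite lee_fin u0.
  by rewrite -(EFin_I mD (Iu j)) lee_fin; exact: uj.
pose G x := Num.max (- L) (Num.min L (limn_sup (fun j => r (n_ j) x))).
have bG x : `|G x| <= L.
  rewrite ler_norml /G le_max lexx/= ge_max ge_min lexx/= andbT.
  by rewrite lerNl (le_trans _ L0)// oppr_le0.
have mG : measurable_fun disk G.
  apply: measurable_maxr; first exact: measurable_cst.
  apply: measurable_minr; first exact: measurable_cst.
  apply: measurable_fun_limn_sup => [x Dx|x Dx|j]; last exact: mr.
    by exists L => _ [j _ <-]; have := br (n_ j) x Dx; rewrite ler_norml => /andP[].
  by exists (- L) => _ [j _ <-]; have := br (n_ j) x Dx; rewrite ler_norml => /andP[].
have SG : sqintD2 G by apply: (sqint_bounded mD fD mG (M := L)) => x _.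
have cvG x : disk x -> W x \is a fin_num -> r (n_ j) x @[j --> \oo] --> G x.
  move=> Dx hx.
  have c1 : cvgn (fun j => r (n_ j) x).
    apply: summable_cvg; move: hx; rewrite fin_numE => /andP[_].
    by rewrite -ltey.
  suff -> : G x = limn (fun j => r (n_ j) x) by [].
  rewrite /G cvg_limn_supE//.
  have l1 : limn (fun j => r (n_ j) x) <= L.
    apply: limr_le => //; apply: nearW => j.
    by have := br (n_ j) x Dx; rewrite ler_norml => /andP[].
  have l2 : - L <= limn (fun j => r (n_ j) x).
    apply: limr_ge => //; apply: nearW => j.
    by have := br (n_ j) x Dx; rewrite ler_norml => /andP[].
  by rewrite min_r// max_r.
have cv2 : {ae mu2, forall x, disk x ->
    (r (n_ j) x - G x) ^+ 2 @[j --> \oo] --> (0 : R)}.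
  have := integrable_ae mD IW; apply: filterS => x hx Dx.
  have cx := cvG x Dx (hx Dx).
  have -> : (0 : R) = (G x - G x) * (G x - G x) by rewrite subrr mul0r.
  by apply: cvgM; (apply: cvgB; [exact: cx|exact: cvg_cst]).
have cvI : (fun j => I (fun x => (r (n_ j) x - G x) ^+ 2)) @ \oo --> (0 : R).
  have E0 : I (fun=> 0 : R) = 0 by rewrite /Rintegral integral0.
  rewrite -[X in _ --> X]E0.
  apply: (@I_dominated _ _ _ mu2 _ mD _ _ (fun=> (2 * L) ^+ 2) _ _ _ _ _).2 => //.
  - by move=> j; apply: measurable_funX; exact: (sqintB mD (Sr (n_ j)) SG).1.
  - by apply: cont_intg => x; exact: cvg_cst.
  - move=> j x Dx; rewrite ger0_norm ?sqr_ge0//.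
    exact: sqr_diff_le (br _ _ Dx) (bG x).
exists G; split=> [//|x _|]; first exact: bG.
have lim2 : (fun n => 2 * eps n) @ \oo --> (0 : R).
  by rewrite -[X in _ --> X](mulr0 2); apply: cvgM; [exact: cvg_cst|exact: ceps].
apply: (squeeze_cvgr _ (cvg_cst 0) lim2); apply: nearW => n.
apply/andP; split; first by apply: I_ge0 => x _; exact: sqr_ge0.
have cR : (fun j => 2 * eps n + 2 * I (fun x => (r (n_ j) x - G x) ^+ 2)) @ \oo --> (2 * eps n).
  rewrite -[X in _ --> X]addr0 -[X in _ --> _ + X](mulr0 2).
  by apply: cvgD; [exact: cvg_cst|apply: cvgM; [exact: cvg_cst|exact: cvI]].
apply: (cvgr_to_ge cR); near=> j.
have nnj : (n <= n_ j)%N by apply: leq_trans (nj j); near: j; exact: nbhs_infty_ge.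
have Ia := (Sd n (n_ j)).2; have Ib := (sqintB mD (Sr (n_ j)) SG).2.
apply: (@le_trans _ _ (I (fun x => 2 * (r n x - r (n_ j) x) ^+ 2 +
    2 * (r (n_ j) x - G x) ^+ 2))).
  apply: (le_I mD); first exact: (sqintB mD (Sr n) SG).2.
    exact: (intgD mD (intgZ mD 2 Ia) (intgZ mD 2 Ib)).
  move=> x _; have := sqr_ge0 (r n x - r (n_ j) x - (r (n_ j) x - G x)); lra.
rewrite (ID mD (intgZ mD 2 Ia) (intgZ mD 2 Ib)) (IZ mD 2 Ia) (IZ mD 2 Ib).
by rewrite lerD2r ler_wpM2l//; exact: cau.
Unshelve. all: by end_near. Qed.

Section Minimizing.
Variables (v : plane -> R) (L : R).
Hypotheses (L0 : 0 <= L) (hv : lip1 L v).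

Definition approximant (n : nat) (sg : (plane -> R) * ('I_2 -> plane -> R)) :=
  [/\ is_C1 setT sg.1 sg.2, forall k x, `|sg.2 k x| <= L &
    forall x, `|sg.1 x - v x| <= n.+1%:R^-1].

Let energy (g : 'I_2 -> plane -> R) : R :=
  I (fun x => g ord0 x ^+ 2) + I (fun x => g 1 x ^+ 2).

Lemma approximant_ex n : exists sg, approximant n sg.
Proof.
pose h : R := (n.+1%:R * (2 * L + 1))^-1.
have a0 : 0 < 2 * L + 1 by rewrite ltr_wpDl// mulr_ge0.
have h0 : 0 < h by rewrite invr_gt0 mulr_gt0.
have [s [g [C bg cl]]] := steklov h0 L0 hv.
exists (s, g); split=> //= x; apply: le_trans (cl x) _.
have -> : 2 * L * h = (2 * L / (2 * L + 1)) * n.+1%:R^-1.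
  by rewrite /h; field; rewrite !gt_eqF.
by rewrite ler_piMl ?invr_ge0// ler_pdivrMr// mul1r lerDl.
Qed.

Lemma approximant_mid n a b : approximant n a -> approximant n b ->
  approximant n (fun x => 2^-1 * (a.1 x + b.1 x), fun k x => 2^-1 * (a.2 k x + b.2 k x)).
Proof.
move=> [Ca ba cla] [Cb bb clb]; split=> /=.
- exact: is_C1Z (is_C1D Ca Cb).
- move=> k x; rewrite -[X in `|X|]subr0; apply: mid_le; by rewrite subr0.
- move=> x; exact: mid_le (cla x) (clb x).
Qed.

Lemma approximant_sqint n a k : approximant n a -> sqintD2 (a.2 k).
Proof.
move=> [Ca ba _]; have [_ cg _] := is_C1T Ca.
by apply: (sqint_bounded mD fD (M := L)) => [|x _]; [exact: cont_measurable_disk|exact: ba].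
Qed.

(** The C^1 functions that are within 1 / (n + 1) of v and have slopes at most L
    form a decreasing sequence of convex sets.  The infima of the energy on them
    converge, so by the parallelogram law the gradients of almost minimizers form
    a Cauchy sequence in the mean square. *)
Lemma minimizing_sequence : exists (sg : nat -> (plane -> R) * ('I_2 -> plane -> R)) eps,
  [/\ forall n, approximant n (sg n),
    forall k n m, (n <= m)%N -> I (fun x => ((sg n).2 k x - (sg m).2 k x) ^+ 2) <= eps n &
    eps @ \oo --> (0 : R)].
Proof.
pose E n := [set energy sg.2 | sg in approximant n].
have E0 n : E n !=set0.
  by have [sg h] := approximant_ex n; exists (energy sg.2); exists sg.
have I0 (f : plane -> R) : 0 <= I (fun x => f x ^+ 2).
  by apply: I_ge0 => x _; exact: sqr_ge0.
have lE n : lbound (E n) 0 by move=> _ [sg _ <-]; rewrite addr_ge0.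
have iE n : has_inf (E n) by split; [exact: E0|exists 0; exact: lE].
have mono n m a : (n <= m)%N -> approximant m a -> approximant n a.
  move=> nm [Ca ba cla]; split=> // x; apply: le_trans (cla x) _.
  by rewrite lef_pV2 ?posrE// ler_nat.
pose d n := inf (E n).
have d_le n sg : approximant n sg -> d n <= energy sg.2.
  by move=> h; apply: ge_inf; [exists 0; exact: lE|exists sg].
have dmono : {homo d : n m / (n <= m)%N >-> n <= m}.
  move=> n m nm; apply: lb_le_inf; first exact: E0.
  by move=> _ [sg h <-]; apply: d_le; exact: mono h.
have dbd : has_ubound (range d).
  exists (2 * I (fun=> L ^+ 2)) => _ [n _ <-].
  have [sg h] := approximant_ex n; apply: le_trans (d_le _ _ h) _.
  have IL : mu2.-integrable disk (EFin \o (fun=> L ^+ 2)).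
    by apply: cont_intg => x; exact: cvg_cst.
  have b k : I (fun x => sg.2 k x ^+ 2) <= I (fun=> L ^+ 2).
    apply: (le_I mD) => //; first exact: (approximant_sqint k h).2.
    move=> x _; have [_ bg _] := h; have := bg k x; rewrite ler_norml => /andP[? ?]; nra.
  by rewrite /energy mulr_natl mulr2n lerD.
have dc := nondecreasing_is_cvgn dmono dbd.
have ex n : exists sg, approximant n sg /\ energy sg.2 < d n + n.+1%:R^-1.
  have [|_ [sg h <-] hlt] := @inf_adherent _ (E n) n.+1%:R^-1 _ (iE n); first by rewrite invr_gt0.
  by exists sg.
have [sg Hsg] := choice ex.
pose eps n := 2 * (limn d - d n) + 4 * n.+1%:R^-1.
exists sg, eps; split.
- by move=> n; have [] := Hsg n.
- move=> k n m nm.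
  have [An en] := Hsg n; have [Am em] := Hsg m.
  have Anm := mono _ _ _ nm Am.
  have := d_le _ _ (approximant_mid An Anm).
  have Sn l := approximant_sqint l An; have Sm l := approximant_sqint l Am.
  have Sd l := sqintB mD (Sn l) (Sm l).
  have Ss l := sqintD mD (Sn l) (Sm l).
  have par l : I (fun x => (2^-1 * ((sg n).2 l x + (sg m).2 l x)) ^+ 2) =
     2^-1 * I (fun x => (sg n).2 l x ^+ 2) + 2^-1 * I (fun x => (sg m).2 l x ^+ 2)
     - 4^-1 * I (fun x => ((sg n).2 l x - (sg m).2 l x) ^+ 2).
    rewrite -(IZ mD _ (Sn l).2) -(IZ mD _ (Sm l).2) -(IZ mD _ (Sd l).2).
    have J1 := intgZ mD 2^-1 (Sn l).2; have J2 := intgZ mD 2^-1 (Sm l).2.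
    have J3 := intgZ mD 4^-1 (Sd l).2.
    rewrite -(ID mD J1 J2) -(IB mD (intgD mD J1 J2) J3).
    by apply: eq_I => // x _; field.
  rewrite /energy /= !par => hd.
  have hm := nondecreasing_cvgn_le dmono dc m.
  have v1 : (m.+1%:R^-1 : R) <= n.+1%:R^-1 by rewrite lef_pV2 ?posrE// ler_nat.
  have Dk : I (fun x => ((sg n).2 k x - (sg m).2 k x) ^+ 2) <=
    I (fun x => ((sg n).2 ord0 x - (sg m).2 ord0 x) ^+ 2) +
    I (fun x => ((sg n).2 1 x - (sg m).2 1 x) ^+ 2).
    have [->|->] := ord2P k.
      by rewrite lerDl.
    by rewrite lerDr.
  apply: (le_trans Dk); rewrite /energy in en em; rewrite /eps.
  exact: par_arith hd en em hm v1.
- have -> : (0 : R) = 2 * (limn d - limn d) + 4 * 0 by rewrite subrr !mulr0 addr0.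
  apply: cvgD; apply: cvgM.
  + exact: cvg_cst.
  + by apply: cvgB; [exact: cvg_cst|exact: dc].
  + exact: cvg_cst.
  + exact: cvg_harmonic.
Qed.

End Minimizing.
End Completeness.

Lemma cvg_of_sqr (x e : nat -> R) (l : R) : (forall n, (x n - l) ^+ 2 <= e n) ->
  e @ \oo --> (0 : R) -> x @ \oo --> l.
Proof.
move=> xe ce; apply/cvgrPdist_lt => eps eps0; near=> n.
rewrite -(@ltr_pXn2r _ 2) ?nnegrE ?(ltW eps0)//.
rewrite real_normK ?num_real// -sqrrN opprB; apply: le_lt_trans (xe n) _.
by near: n; apply: (cvgr_lt _ ce); rewrite exprn_gt0.
Unshelve. all: by end_near. Qed.

Lemma L2_cvg_weak (f_ : nat -> plane -> R) (f phi : plane -> R) :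
  (forall n, sqintD2 (f_ n)) -> sqintD2 f -> sqintD2 phi ->
  (fun n => I (fun x => (f_ n x - f x) ^+ 2)) @ \oo --> (0 : R) ->
  (fun n => I (fun x => f_ n x * phi x)) @ \oo --> I (fun x => f x * phi x).
Proof.
move=> Sf_ Sf Sp cv.
pose c := I (fun x => phi x ^+ 2).
apply: (@cvg_of_sqr _ (fun n => I (fun x => (f_ n x - f x) ^+ 2) * c)).
  move=> n; rewrite -(IB mD (sqintM mD (Sf_ n) Sp) (sqintM mD Sf Sp)).
  have -> : I (fun x => f_ n x * phi x - f x * phi x) =
      I (fun x => (f_ n x - f x) * phi x).
    by apply: eq_I => // x _; rewrite mulrBl.
  exact: (cauchy_schwarz_I mD (sqintB mD (Sf_ n) Sf) Sp).
rewrite -(mul0r c); apply: cvgM; [exact: cv|exact: cvg_cst].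
Qed.

Lemma sqint_cont (f : plane -> R) : continuous f -> sqintD2 f.
Proof.
move=> cf; have [M HM] := cont_bounded_cdisk cf.
apply: (sqint_bounded mD fD (M := M)); first exact: cont_measurable_disk.
by move=> x /disk_cdisk; exact: HM.
Qed.

(** The C^1 approximations of almost minimal energy have gradients that converge in
    the mean square, and the uniform convergence of the functions themselves
    identifies the limit as a weak gradient. *)
Lemma lipschitz_gradient (v : plane -> R) (L : R) : 0 <= L -> lip1 L v ->
  exists (sg : nat -> (plane -> R) * ('I_2 -> plane -> R)) (G : 'I_2 -> plane -> R),
  [/\ forall n, approximant v L n (sg n),
      forall k, measurable_fun disk (G k), forall k x, disk x -> `|G k x| <= L,
      forall k, (fun n => I (fun x => ((sg n).2 k x - G k x) ^+ 2)) @ \oo --> (0 : R) &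
      forall k, weak_d k v (G k)].
Proof.
move=> L0 hv.
have [sg [eps [Asg cau ceps]]] := minimizing_sequence L0 hv.
have cg k n : continuous ((sg n).2 k) by have [C _ _] := Asg n; have [_ cg _] := is_C1T C.
have cs n : continuous (sg n).1 by have [C _ _] := Asg n; have [cs _ _] := is_C1T C.
have ex k : exists G : plane -> R, [/\ measurable_fun disk G,
    forall x, disk x -> `|G x| <= L &
    (fun n => I (fun x => ((sg n).2 k x - G x) ^+ 2)) @ \oo --> (0 : R)].
  apply: (L2_complete L0 _ _ (cau k) ceps) => [n|n x _].
    exact: cont_measurable_disk.
  by have [_ bg _] := Asg n; exact: bg.
have [G HG] := choice ex.
exists sg, G; split=> // [k|k x Dx|k|k].
- by have [] := HG k.
- by have [_ + _] := HG k; exact.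
- by have [] := HG k.
have [mG bG cG] := HG k.
have cv := lip1_cont hv.
have SG : sqintD2 (G k) by exact: (sqint_bounded mD fD mG bG).
split; [by apply: cont_loc_integrable => x _; exact: cv|exact: sqint_loc|].
move=> phi T; have [cp _] := test_partial k T.
have cphi : continuous phi by have [s _] := T; exact: Ck_cont (s 0%N).
have Sphi := sqint_cont cphi; have Sp := sqint_cont cp.
have c1 : (fun n => I (fun x => (sg n).1 x * partial k phi x)) @ \oo -->
    I (fun x => v x * partial k phi x).
  apply: L2_cvg_weak => //; [by move=> n; exact: sqint_cont|exact: sqint_cont|].
  have I1 : mu2.-integrable disk (EFin \o (fun=> 1 : R)).
    by apply: cont_intg => x; exact: cvg_cst.
  have lim0 : (fun n : nat => (n.+1%:R^-1 * n.+1%:R^-1) * I (fun=> 1 : R)) @ \oo --> (0 : R).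
    rewrite -[X in _ --> X](mul0r (I (fun=> 1 : R))); apply: cvgM; last exact: cvg_cst.
    by rewrite -[X in _ --> X](mul0r (0 : R)); apply: cvgM; exact: cvg_harmonic.
  apply: (squeeze_cvgr _ (cvg_cst 0) lim0); apply: nearW => n.
  apply/andP; split; first by apply: I_ge0 => x _; exact: sqr_ge0.
  rewrite -(IZ mD _ I1); apply: (le_I mD).
  - exact: (sqintB mD (sqint_cont (cs n)) (sqint_cont cv)).2.
  - exact: intgZ.
  - move=> x _; rewrite mulr1 -(real_normK (num_real _)) expr2.
    by have [_ _ cl] := Asg n; apply: ler_pM.
have c2 : (fun n => - I (fun x => (sg n).2 k x * phi x)) @ \oo -->
    - I (fun x => G k x * phi x).
  apply: cvgN; apply: L2_cvg_weak => // n; exact: sqint_cont.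
have E n : I (fun x => (sg n).1 x * partial k phi x) = - I (fun x => (sg n).2 k x * phi x).
  have [C _ _] := Asg n.
  have [_ _ h] := weak_d_C1 k (is_C1_sub (@subsetT _ disk) C).
  exact: h.
have E' : (fun n => I (fun x => (sg n).1 x * partial k phi x)) =
   (fun n => - I (fun x => (sg n).2 k x * phi x)) by apply/funext.
rewrite E' in c1.
exact: (cvg_unique _ c1 c2).
Qed.

(** * Mean values of the gradient of a harmonic function *)

Section MeanValue.
Implicit Types (p : plane) (s : R).

Definition off p (k : 'I_2) (y : plane) : R := coord k y - coord k p.

Definition dist2 p (y : plane) : R := off p ord0 y ^+ 2 + off p 1 y ^+ 2.

(** Powers of s - |y - p|^2, truncated outside the disk of radius sqrt s around p:
    their Laplacians are combinations of such powers again. *)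
Definition kern m p s (y : plane) : R := ppow m (s - dist2 p y).

Definition kron (k l : 'I_2) : R := (k == l)%:R.

Lemma is_C1_off p k : is_C1 setT (off p k) (fun l _ => kron k l).
Proof.
have [->|->] := ord2P k.
  apply: is_C1_eq (is_C1B (is_C1_fst setT) (is_C1_cst setT p.1)) => l x.
  by rewrite /kron /basis_vec subr0 eq_sym; case: ifP.
apply: is_C1_eq (is_C1B (is_C1_snd setT) (is_C1_cst setT p.2)) => l x.
by rewrite /kron /basis_vec subr0; have [->|->] := ord2P l.
Qed.

Lemma is_C1_dist2 p : is_C1 setT (dist2 p) (fun l y => 2 * off p l y).
Proof.
have C k : is_C1 setT (fun y => off p k y ^+ 2) (fun l y => 2 * (off p k y * kron k l)).
  have := is_C1M (is_C1_off p k) (is_C1_off p k).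
  by apply: is_C1_eq => l y; rewrite mulr_natl mulr2n.
apply: is_C1_eq (is_C1D (C ord0) (C 1)) => l y.
by rewrite /kron; have [->|->] := ord2P l; rewrite /= ?mulr1 ?mulr0 ?addr0 ?add0r.
Qed.

Lemma is_C1_kern m p s : is_C1 setT (kern m.+2 p s)
  (fun l y => - (2 * m.+2%:R) * (off p l y * kern m.+1 p s y)).
Proof.
have c2 : continuous (fun t : R => m.+2%:R * ppow m.+1 t).
  by move=> t; apply: cvgM; [exact: cvg_cst|exact: ppow_cont].
have C1 := is_C1B (is_C1_cst setT s) (is_C1_dist2 p).
apply: is_C1_eq (is_C1_comp C1 c2 (ppow_derive m)) => l y.
by rewrite /kern; ring.
Qed.

Lemma kern_mul m p s y : dist2 p y * kern m.+1 p s y = s * kern m.+1 p s y - kern m.+2 p s y.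
Proof. by rewrite /kern ppowS; ring. Qed.

Definition near_disk p s : set plane := [set y | dist2 p y <= s].

Lemma kern_eq0 m p s y : ~ near_disk p s y -> kern m.+1 p s y = 0.
Proof.
move=> /negP; rewrite -ltNge => h; apply: ppow_eq0.
by rewrite subr_le0 ltW.
Qed.

Lemma dist2_cont p : continuous (dist2 p).
Proof. by have [] := is_C1T (is_C1_dist2 p). Qed.

Lemma near_disk_closed p s : closed (near_disk p s).
Proof.
have -> : near_disk p s = dist2 p @^-1` [set t | t <= s] by [].
by apply: closed_comp; [move=> x _; exact: dist2_cont|exact: closed_le].
Qed.

Lemma kern_cont m p s : continuous (kern m p s).
Proof.
move=> y; apply: (@continuous_comp _ _ _ (fun y => s - dist2 p y) (ppow m)).
  by apply: cvgB; [exact: cvg_cst|exact: dist2_cont].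
exact: ppow_cont.
Qed.

Lemma harmonic_C1 (f : plane -> R) : Ck_on disk 2 f ->
  is_C1 disk f (fun k => partial k f).
Proof.
move=> Cf; apply: Ck_is_C1; case: Cf => cf h; split=> // k.
by have [d [c _]] := h k; split=> //; split.
Qed.

Section Harmonic.
Variable f : plane -> R.
Hypothesis Cf : Ck_on disk 2 f.
Hypothesis Df : forall x, disk x -> \sum_(k < 2) partial k (partial k f) x = 0.

Let C1f := harmonic_C1 Cf.

Let C1df k : is_C1 disk (partial k f) (fun l => partial l (partial k f)).
Proof. by apply: Ck_is_C1; case: Cf => _ /(_ k)[]. Qed.

(** The Laplacian of kern 4 is 48 s kern 2 - 64 kern 3.  The derivative of f along
    k is weakly harmonic, so it is orthogonal to this Laplacian; in the computation
    that derivative falls on the kernel, and only two derivatives of f occur. *)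
Lemma harmonic_kern p s k : near_disk p s `<=` disk ->
  3 * s * I (fun y => partial k f y * kern 2 p s y) =
  4 * I (fun y => partial k f y * kern 3 p s y).
Proof.
move=> ND; have clK := @near_disk_closed p s.
pose N y := -8 * (off p k y * kern 3 p s y).
pose dN l y := -8 * (kron k l * kern 3 p s y) + 48 * (off p k y * (off p l y * kern 2 p s y)).
pose ddN l m y := -8 * (kron k l * (-6 * (off p m y * kern 2 p s y))) +
  48 * (kron k m * (off p l y * kern 2 p s y) + off p k y * (kron l m * kern 2 p s y +
    off p l y * (-4 * (off p m y * kern 1 p s y)))).
have k3 : is_C1 setT (kern 3 p s) (fun l y => -6 * (off p l y * kern 2 p s y)).
  by apply: is_C1_eq (is_C1_kern 1 p s) => l y; ring.
have k2 : is_C1 setT (kern 2 p s) (fun l y => -4 * (off p l y * kern 1 p s y)).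
  by apply: is_C1_eq (is_C1_kern 0 p s) => l y; ring.
have CN : is_C1 setT N dN.
  apply: is_C1_eq (is_C1Z (-8) (is_C1M (is_C1_off p k) k3)) => l y.
  by rewrite /dN; ring.
have CdN l : is_C1 setT (dN l) (ddN l).
  have := is_C1D (is_C1Z (-8) (is_C1Z (kron k l) k3))
    (is_C1Z 48 (is_C1M (is_C1_off p k) (is_C1M (is_C1_off p l) k2))).
  by apply: is_C1_eq => m y; rewrite /ddN; ring.
pose Q y := 48 * s * kern 2 p s y - 64 * kern 3 p s y.
pose dQ l y := 48 * s * (-4 * (off p l y * kern 1 p s y)) - 64 * (-6 * (off p l y * kern 2 p s y)).
have CQ : is_C1 setT Q dQ by exact: is_C1B (is_C1Z _ k2) (is_C1Z _ k3).
have Q0 y : ~ near_disk p s y -> Q y = 0.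
  by move=> h; rewrite /Q !kern_eq0// !mulr0 subr0.
have N0 y : ~ near_disk p s y -> N y = 0.
  by move=> h; rewrite /N !kern_eq0// !mulr0.
have dN0 l y : ~ near_disk p s y -> dN l y = 0.
  by move=> h; rewrite /dN !kern_eq0// !mulr0 addr0.
have trace y : dQ k y = ddN ord0 ord0 y + ddN 1 1 y.
  have h := kern_mul 0 p s y; rewrite /dist2 in h.
  rewrite /dQ /ddN /kron; have [->|->] := ord2P k; rewrite /=.
    have -> : kern 2 p s y = s * kern 1 p s y - (off p ord0 y ^+ 2 + off p 1 y ^+ 2) * kern 1 p s y.
      by rewrite h; ring.
    ring.
  have -> : kern 2 p s y = s * kern 1 p s y - (off p ord0 y ^+ 2 + off p 1 y ^+ 2) * kern 1 p s y.
    by rewrite h; ring.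
  ring.
have cD (phi psi : plane -> R) : {in disk, continuous phi} -> continuous psi ->
    (forall y, ~ near_disk p s y -> psi y = 0) ->
    mu2.-integrable disk (EFin \o (fun y => phi y * psi y)).
  by move=> h1 h2 h3; apply: cont_intg; exact: (cont_cutoff clK ND).
have ibp (phi : plane -> R) gphi F G m : is_C1 disk phi gphi -> is_C1 setT F G ->
    (forall y, ~ near_disk p s y -> F y = 0) ->
    I (fun y => phi y * G m y) = - I (fun y => gphi m y * F y).
  by move=> h1 h2 h3; exact: (integration_by_parts_disk m clK ND h1 h2 h3).
have E : I (fun y => partial k f y * Q y) = 0.
  apply/eqP; rewrite -oppr_eq0 -(ibp _ _ _ _ k C1f CQ Q0); apply/eqP.
  have oK : open (~` near_disk p s) by exact: closed_openC.
  have [cf cdf _] := C1f.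
  have z l y : ~ near_disk p s y -> ddN l l y = 0.
    exact: (is_C1_grad0 oK (is_C1_sub (@subsetT _ _) (CdN l)) (dN0 l)).
  have cdd l : continuous (ddN l l) by have [_ + _] := is_C1T (CdN l); apply.
  have i0 := cD _ _ cf (cdd ord0) (z ord0).
  have i1 := cD _ _ cf (cdd 1) (z 1).
  transitivity (I (fun y => f y * ddN ord0 ord0 y + f y * ddN 1 1 y)).
    by apply: eq_I => // y _; rewrite trace mulrDr.
  rewrite (ID mD i0 i1).
  rewrite (ibp _ _ _ _ ord0 C1f (CdN ord0) (dN0 ord0)).
  rewrite (ibp _ _ _ _ 1 C1f (CdN 1) (dN0 1)).
  rewrite (ibp _ _ _ _ ord0 (C1df ord0) CN N0) (ibp _ _ _ _ 1 (C1df 1) CN N0).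
  rewrite [X in X + _]opprK [X in _ + X]opprK.
  have cN : continuous N by have [] := is_C1T CN.
  have [_ cg0 _] := C1df ord0; have [_ cg1 _] := C1df 1.
  rewrite -(ID mD (cD _ _ (cg0 ord0) cN N0) (cD _ _ (cg1 1) cN N0)).
  rewrite -[RHS](_ : I (fun=> 0) = 0); last by rewrite /Rintegral integral0.
  apply: eq_I => // y Dy; rewrite -mulrDl.
  have := Df Dy; rewrite big_ord_recl big_ord1.
  have -> : lift ord0 ord0 = 1 :> 'I_2 by exact/val_inj.
  by move=> ->; rewrite mul0r.
have [_ cdf _] := C1f.
have i2 := cD _ _ (cdf k) (@kern_cont 2 p s) (fun y => @kern_eq0 1 p s y).
have i3 := cD _ _ (cdf k) (@kern_cont 3 p s) (fun y => @kern_eq0 2 p s y).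
have := E.
have -> : I (fun y => partial k f y * Q y) =
    I (fun y => 48 * s * (partial k f y * kern 2 p s y) - 64 * (partial k f y * kern 3 p s y)).
  by apply: eq_I => // y _; rewrite /Q; ring.
rewrite (IB mD (intgZ mD _ i2) (intgZ mD _ i3)) (IZ mD _ i2) (IZ mD _ i3).
move: (I (fun y => partial k f y * kern 2 p s y)) (I (fun y => partial k f y * kern 3 p s y)) => a b h; lra.
Qed.

End Harmonic.
End MeanValue.

Section MeanValueFormula.
Implicit Types (p : plane) (s : R).

(** The relation of [harmonic_kern]: all that the mean value property requires
    of g. *)
Definition kern_balanced (g : plane -> R) p s0 :=
  forall s, 0 < s -> s <= s0 ->
    3 * s * I (fun y => g y * kern 2 p s y) = 4 * I (fun y => g y * kern 3 p s y).

Section Radial.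
Variables (g : plane -> R) (p : plane) (s0 : R).
Hypothesis cg : {in disk, continuous g}.
Hypothesis ND : near_disk p s0 `<=` disk.
Hypothesis Hg : kern_balanced g p s0.

Let B := near_disk p s0.
Let clB : closed B. Proof. exact: near_disk_closed. Qed.

Let mB : measurable (B : set mplane).
Proof.
rewrite -(setCK B); apply: measurableC; apply: open_measurable_plane.
exact: closed_openC.
Qed.

Let fB : (mu2 B < +oo)%E.
Proof. by apply: le_lt_trans fD; apply: le_measure; rewrite ?inE. Qed.

Lemma near_diskS s t : s <= t -> near_disk p s `<=` near_disk p t.
Proof. by move=> st y; rewrite /near_disk /= => /le_trans; exact. Qed.

Lemma kern_integrable m s : s <= s0 ->
  mu2.-integrable disk (EFin \o (fun y => g y * kern m.+1 p s y)).
Proof.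
move=> ss0; apply: cont_intg; apply: (cont_cutoff clB ND cg).
  exact: kern_cont.
by move=> y nB; apply: kern_eq0 => h; apply: nB; exact: near_diskS h.
Qed.

Let IB_eq m s : s <= s0 ->
  I (fun y => g y * kern m.+1 p s y) = \int[mu2]_(y in B) (g y * kern m.+1 p s y).
Proof.
move=> ss0; rewrite /Rintegral (@integral_support B)//.
move=> y nB; rewrite kern_eq0 ?mulr0//.
by move=> h; apply: nB; exact: near_diskS h.
Qed.

Let bg : exists M, forall y, B y -> `|g y| <= M.
Proof.
have cB : compact B.
  apply: (subclosed_compact clB (ddisk_compact (lexx 1))) => y /ND; exact: ltW.
by apply: cont_bounded_compact => // x /set_mem Bx; apply: cg; rewrite inE; exact: ND.
Qed.

Let mg : measurable_fun (B : set mplane) g.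
Proof.
have h := cont_measurable disk_open cg.
exact: (measurable_funS mD ND h).
Qed.

Let mk m s : measurable_fun (B : set mplane) (kern m p s).
Proof.
have h := cont_measurable (@openT plane) (fun x _ => @kern_cont m p s x).
exact: (measurable_funS measurableT (@subsetT _ B) h).
Qed.

Let dist2_ge0 y : 0 <= dist2 p y.
Proof. by rewrite addr_ge0 ?sqr_ge0. Qed.

(** Differentiation under the integral over a fixed disk, off which all the kernels
    vanish. *)
Lemma radial_derive s : 0 < s -> s < s0 ->
  is_derive s (1 : R) (fun s => \int[mu2]_(y in B) (g y * kern 3 p s y))
    (3 * I (fun y => g y * kern 2 p s y)).
Proof.
move=> sp ss0; have [M HM] := bg.
have M0 : 0 <= `|M| by exact: normr_ge0.
pose F (t : R) y := g y * kern 3 p t y.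
have kb m t y : 0 < t -> t < s0 -> 0 <= kern m p t y <= s0 ^+ m.
  move=> t0 ts; rewrite ppow_ge0 /= lerXn2r ?nnegrE ?le_max ?lexx ?orbT ?(le_trans (ltW t0) (ltW ts))//.
  rewrite ge_max (le_trans (ltW t0) (ltW ts)) andbT.
  by have := dist2_ge0 y; lra.
have dF t y : is_derive t (1 : R) (F ^~ y) (g y * (3 * kern 2 p t y)).
  have d1 : is_derive t (1 : R) (fun t : R => t - dist2 p y) 1.
    have := is_deriveB (is_derive_id t (1 : R)) (is_derive_cst (dist2 p y) t (1 : R)).
    by rewrite subr0.
  have d2 := @is_derive1_comp R (ppow 3) (fun t => t - dist2 p y) t _ _ (ppow_derive 1 _) d1.
  have := is_deriveZ (g y) d2; rewrite mulr1; exact.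
have E t y : partial1of2 F t y = g y * (3 * kern 2 p t y).
  by rewrite partial1of2E; have [] := dF t y.
have Is : `]0, s0[%classic s by rewrite /= in_itv /= sp ss0.
have i1 t : `]0, s0[%classic t -> mu2.-integrable B (EFin \o F t).
  rewrite /= in_itv /= => /andP[t0 ts].
  apply: (@intg_bounded _ _ _ mu2 _ mB _ (`|M| * s0 ^+ 3)) => //.
    by apply: measurable_funM.
  move=> y By; rewrite /F normrM; apply: ler_pM => //.
    exact: le_trans (HM _ By) (ler_norm _).
  by have /andP[k0 k1] := kb 3%N t y t0 ts; rewrite ger0_norm.
have i2 t y : `]0, s0[%classic t -> B y -> derivable (F ^~ y) t 1.
  by move=> _ _; have [] := dF t y.
pose G := fun _ : mplane => `|M| * (3 * s0 ^+ 2).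
have G0 y : 0 <= G y.
  by rewrite mulr_ge0// mulr_ge0// sqr_ge0.
have i3 : mu2.-integrable B (EFin \o G).
  apply: (@intg_bounded _ _ _ mu2 _ mB _ (`|M| * (3 * s0 ^+ 2))) => //.
    exact: measurable_cst.
  by move=> y _; rewrite ger0_norm// G0.
have i4 t y : `]0, s0[%classic t -> B y -> `|partial1of2 F t y| <= G y.
  rewrite /= in_itv /= => /andP[t0 ts] By; rewrite E normrM; apply: ler_pM => //.
    exact: le_trans (HM _ By) (ler_norm _).
  have /andP[k0 k1] := kb 2%N t y t0 ts.
  have e : 0 <= 3 * kern 2 p t y by apply: mulr_ge0.
  rewrite (ger0_norm e); exact: ler_wpM2l.
apply: DeriveDef.
  exact: (@derivable_under_integral _ _ _ mu2 F B mB s _ _ Is i1 i2 G G0 i3 i4).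
rewrite -derive1E (@differentiation_under_integral _ _ _ mu2 F B mB s _ _ Is i1 i2 G G0 i3 i4).
have i := kern_integrable 1 (ltW ss0).
have iB : mu2.-integrable B (EFin \o (fun y => g y * kern 2 p s y)).
  exact: (integrableS mD mB ND i).
rewrite (IB_eq 1 (ltW ss0)) -(IZ mB 3 iB).
by apply: eq_I => // y _; rewrite E; ring.
Qed.

(** By [kern_balanced] the derivative in s of s^(-4) times the integral of g kern 3
    is zero. *)
Lemma radial_constant s1 s2 : 0 < s1 -> s1 <= s2 -> s2 < s0 ->
  I (fun y => g y * kern 3 p s1 y) * s2 ^+ 4 =
  I (fun y => g y * kern 3 p s2 y) * s1 ^+ 4.
Proof.
move=> s10 s12 s20; have s20' : 0 < s2 by exact: lt_le_trans s12.
pose M s := \int[mu2]_(y in B) (g y * kern 3 p s y).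
pose N s := M s * (s^-1) ^+ 4.
have dN s : 0 < s -> s < s0 -> is_derive s (1 : R) N 0.
  move=> sp ss0; have sn0 : s != 0 by rewrite gt_eqF.
  have dV : is_derive s (1 : R) (fun u : R => u^-1) (- s ^- 2).
    have := @is_deriveV R id s 1 1 sn0 (is_derive_id _ _).
    by rewrite /GRing.scale /= mulr1.
  have dX : is_derive s (1 : R) (fun u : R => u^-1 ^+ 4) (4 * s^-1 ^+ 3 * - s ^- 2).
    have d4 : is_derive s^-1 (1 : R) (fun u : R => u ^+ 4) (4 * s^-1 ^+ 3).
      apply: DeriveDef; first exact: exprn_derivable.
      by rewrite exp_derive /GRing.scale /= mulr1.
    exact: (@is_derive1_comp R (fun u : R => u ^+ 4) (fun u : R => u^-1) s _ _ d4 dV).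
  have d := is_deriveM (radial_derive sp ss0) dX.
  apply: is_derive_eq d _; rewrite /GRing.scale /=.
  have H := Hg sp (ltW ss0); rewrite -(IB_eq 2 (ltW ss0)).
  move: H; move: (I (fun y => g y * kern 3 p s y)) (I (fun y => g y * kern 2 p s y)) => a b H.
  have -> : a * (4 * s^-1 ^+ 3 * - s ^- 2) + s^-1 ^+ 4 * (3 * b) =
    s^-1 ^+ 5 * (3 * s * b - 4 * a) by field.
  by rewrite H subrr mulr0.
have pos s : s1 <= s -> 0 < s by exact: lt_le_trans.
have cN : {within `[s1, s2], continuous N}.
  apply: continuous_in_subspaceT => s; rewrite inE /= in_itv /= => /andP[h1 h2].
  apply: differentiable_continuous; apply/derivable1_diffP.
  by have [] := dN s (pos _ h1) (le_lt_trans h2 s20).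
have dN' s : s \in `]s1, s2[ -> is_derive s (1 : R) N (cst 0 s).
  rewrite in_itv /= => /andP[h1 h2]; apply: dN; first by apply: pos; exact: ltW.
  exact: lt_trans h2 s20.
have [c _] := MVT_segment s12 dN' cN.
rewrite mul0r => /eqP; rewrite subr_eq0 => /eqP.
rewrite /N /M -(IB_eq 2 (ltW s20)) -(IB_eq 2 (le_trans s12 (ltW s20))).
move: (I (fun y => g y * kern 3 p s1 y)) (I (fun y => g y * kern 3 p s2 y)) => a b h.
have e1 : a * s2 ^+ 4 = a * s1^-1 ^+ 4 * (s1 ^+ 4 * s2 ^+ 4) by field; rewrite gt_eqF.
by rewrite e1 -h; field; rewrite gt_eqF.
Qed.

End Radial.
End MeanValueFormula.

Section MeanValueProperty.
Implicit Types (p : plane) (s : R).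

Lemma Ck_on_sub (A : set plane) m (f : plane -> R) : Ck_on setT m f -> Ck_on A m f.
Proof.
elim: m f => [|m IH] f [c h]; split=> //; try by move=> x _; apply: c; rewrite inE.
move=> k; have [d C] := h k; split; first by move=> x _; exact: d.
exact: IH.
Qed.

Lemma harmonic_balanced (f : plane -> R) p s0 k : Ck_on disk 2 f ->
  (forall x, disk x -> \sum_(k < 2) partial k (partial k f) x = 0) ->
  near_disk p s0 `<=` disk -> kern_balanced (partial k f) p s0.
Proof.
move=> Cf Df ND s s_gt0 ss0; apply: harmonic_kern => //.
exact: subset_trans (near_diskS ss0) ND.
Qed.

Lemma cst_balanced p s0 : near_disk p s0 `<=` disk -> kern_balanced (fun=> 1) p s0.
Proof.
have P k (x : plane) : partial k fst x = (basis_vec k).1 :> R.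
  exact: (@is_C1_partial setT fst (fun k _ => (basis_vec k).1) k x (is_C1_fst setT) Logic.I).
have -> : (fun=> 1 : R) = partial ord0 (@fst R R).
  by apply/funext => x; rewrite P.
apply: harmonic_balanced; first by apply: Ck_on_sub; exact: smooth_fst.
move=> x _; apply: big1 => k _.
have -> : partial k (@fst R R) = fun=> (basis_vec k).1 by apply/funext.
exact: (@is_C1_partial setT _ _ k x (is_C1_cst setT _) Logic.I).
Qed.

Lemma dist2_small p (V : set plane) : nbhs p V ->
  exists2 s, 0 < s & near_disk p s `<=` V.
Proof.
move=> /nbhs_ballP[d /= d0 H]; exists (d ^+ 2 / 4); first by rewrite divr_gt0// exprn_gt0.
have key (a b : R) : a ^+ 2 + b ^+ 2 <= d ^+ 2 / 4 -> `|a| < d.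
  move=> h; rewrite ltNge; apply/negP => le.
  have := lerXn2r 2 (ltW d0 : d \is Num.nneg) (normr_ge0 a : `|a| \is Num.nneg) le.
  by rewrite real_normK ?num_real// => h2; have := sqr_ge0 b; have := exprn_gt0 2 d0; lra.
move=> y; rewrite /near_disk /= /dist2 /off /coord /= => h.
apply: H; split; rewrite /ball /= distrC; first exact: key h.
by rewrite addrC in h; exact: key h.
Qed.

Section Formula.
Variables (g : plane -> R) (p : plane) (s0 : R).
Hypothesis cg : {in disk, continuous g}.
Hypothesis ND : near_disk p s0 `<=` disk.
Hypothesis Hg : kern_balanced g p s0.

(** The averages of g against the kernels do not depend on the radius, and for small
    radii they are close to g p by continuity. *)
Lemma mean_value s1 : 0 < s1 -> s1 < s0 ->
  I (fun y => g y * kern 3 p s1 y) = g p * I (fun y => 1 * kern 3 p s1 y).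
Proof.
move=> s10 s1s0.
have Dp : disk p.
  apply: ND; rewrite /near_disk /= /dist2 /off !subrr expr0n /= addr0.
  exact: ltW (lt_trans s10 s1s0).
have c1 : {in (disk : set plane), continuous (fun=> 1 : R)} by move=> x _; exact: cvg_cst.
set K := fun s => I (fun y => 1 * kern 3 p s y).
set N := fun s => I (fun y => g y * kern 3 p s y).
have K0 s : 0 <= K s by apply: I_ge0 => y _; rewrite mul1r ppow_ge0.
apply/eqP; rewrite -subr_eq0 -normr_le0; apply/ler_addgt0Pl => e e0; rewrite addr0.
pose e' := e / (K s1 + 1).
have e'0 : 0 < e' by rewrite divr_gt0// ltr_wpDl.
have : nbhs p [set y | `|g p - g y| < e'].
  by have /cvgrPdist_lt/(_ _ e'0) := cg (mem_set Dp).
move=> /dist2_small[t t0 Ht].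
pose s := Num.min s1 t.
have s_gt0 : 0 < s by rewrite lt_min s10.
have ss1 : s <= s1 by rewrite ge_min lexx.
have ss0 : s <= s0 by exact: le_trans ss1 (ltW s1s0).
have i1 := kern_integrable cg ND 2 ss0.
have i2 := kern_integrable c1 ND 2 ss0.
have h1 : `|N s - g p * K s| <= e' * K s.
  rewrite /N /K -(IZ mD (g p) i2) -(IB mD i1 (intgZ mD _ i2)).
  have i3 := intgB mD i1 (intgZ mD (g p) i2).
  apply: le_trans (I_norm mD i3) _; rewrite -(IZ mD e' i2).
  apply: (le_I mD); [|exact: intgZ|].
    exact: (integrable_norm i3).
  move=> y _; have k0 : 0 <= kern 3 p s y by exact: ppow_ge0.
  rewrite !mul1r -mulrBl normrM (ger0_norm k0).
  have [h|h] := pselect (near_disk p t y).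
    apply: ler_wpM2r => //.
    by apply: ltW; rewrite distrC; exact: Ht.
  rewrite kern_eq0 ?mulr0// => h'; apply: h.
  by apply: near_diskS h'; rewrite ge_min lexx orbT.
have rg := radial_constant cg ND Hg s_gt0 ss1 s1s0.
have r1 := radial_constant c1 ND (cst_balanced ND) s_gt0 ss1 s1s0.
rewrite -/(N _) -/(N _) in rg; rewrite -/(K _) -/(K _) in r1.
have s40 : 0 < s ^+ 4 by exact: exprn_gt0.
have s140 : 0 < s1 ^+ 4 by exact: exprn_gt0.
have : `|N s1 - g p * K s1| * s ^+ 4 <= (e' * K s1) * s ^+ 4.
  have E : (N s1 - g p * K s1) * s ^+ 4 = (N s - g p * K s) * s1 ^+ 4.
    by rewrite mulrBl -[X in _ - X]mulrA -r1 -rg; ring.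
  have E2 : e' * K s1 * s ^+ 4 = e' * K s * s1 ^+ 4 by rewrite -mulrA -r1 mulrA.
  rewrite E2 -[X in _ * X <= _](gtr0_norm s40) -normrM E normrM (gtr0_norm s140).
  exact: ler_wpM2r (ltW s140) _ _ h1.
rewrite ler_pM2r// => /le_trans; apply.
rewrite /e' -mulrA ler_piMr ?(ltW e0)// mulrC ler_pdivrMr ?ltr_wpDl//.
by rewrite mul1r lerDl.
Qed.

End Formula.

(** |y|^2 <= (1 + t) |p|^2 + (1 + 1 / t) |y - p|^2, with t = (1 - r) / 2. *)
Lemma near_disk_inside p r : ddisk r p -> r < 1 -> 0 <= r ->
  near_disk p ((1 - r) ^+ 2 / 4) `<=` disk.
Proof.
move=> + r1 r0 y; rewrite /ddisk /rad2 /near_disk /disk /= /dist2 /off /coord /=.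
move: p y => [p1 p2] [y1 y2] /= h1 h2.
pose t := (1 - r) / 2.
have t0 : 0 < t by rewrite /t; lra.
have key (a b : R) : a ^+ 2 <= (1 + t) * b ^+ 2 + (1 + t^-1) * (a - b) ^+ 2.
  have -> : (1 + t) * b ^+ 2 + (1 + t^-1) * (a - b) ^+ 2 = a ^+ 2 + t^-1 * (t * b - (a - b)) ^+ 2.
    by field; rewrite gt_eqF.
  by rewrite lerDl mulr_ge0 ?invr_ge0 ?sqr_ge0 ?ltW.
apply: le_lt_trans (lerD (key y1 p1) (key y2 p2)) _.
have -> : (1 + t) * p1 ^+ 2 + (1 + t^-1) * (y1 - p1) ^+ 2 + ((1 + t) * p2 ^+ 2 + (1 + t^-1) * (y2 - p2) ^+ 2) =
  (1 + t) * (p1 ^+ 2 + p2 ^+ 2) + (1 + t^-1) * ((y1 - p1) ^+ 2 + (y2 - p2) ^+ 2) by ring.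
have t1 : 0 < 1 + t^-1 by rewrite addr_gt0 ?invr_gt0.
apply: (@le_lt_trans _ _ ((1 + t) * r + (1 + t^-1) * t ^+ 2)).
  apply: lerD; first by rewrite ler_pM2l// addr_gt0.
  by rewrite ler_pM2l// /t; move: h2; lra.
have -> : (1 + t) * r + (1 + t^-1) * t ^+ 2 = (1 + t) * r + t ^+ 2 + t by field; rewrite gt_eqF.
rewrite /t; nra.
Qed.

(** On the square of side 2 a around p the kernel is at least (2 a^2)^3. *)
Lemma kern_mass p (a : R) : 0 < a -> near_disk p (4 * a ^+ 2) `<=` disk ->
  32 * a ^+ 8 <= I (fun y => 1 * kern 3 p (4 * a ^+ 2) y).
Proof.
move=> a0 ND; set s := 4 * a ^+ 2.
pose J (b : R) : set (measurableTypeR R) := `[b - a, b + a]%classic.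
pose S := (J p.1 `*` J p.2 : set mplane).
have mJ b : measurable (J b) by exact: measurable_itv.
have mS : measurable S by exact: measurableX.
have SD y : S y -> dist2 p y <= 2 * a ^+ 2.
  rewrite /S /J /= !in_itv /= => -[/andP[h1 h2] /andP[h3 h4]].
  by rewrite /dist2 /off /coord /=; nra.
have SK : S `<=` disk.
  move=> y /SD h; apply: ND; rewrite /near_disk /=; apply: le_trans h _.
  by rewrite ler_pM2r ?exprn_gt0// ler_nat.
have c1 : {in (disk : set plane), continuous (fun=> 1 : R)} by move=> x _; exact: cvg_cst.
have i := kern_integrable c1 ND 2 (lexx _).
rewrite -lee_fin (EFin_I mD i).
have mk := measurable_int _ i.
apply: (@le_trans _ _ (\int[mu2]_(x in S) (1 * kern 3 p s x)%:E)%E); last first.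
  by apply: ge0_subset_integral => // x _; rewrite lee_fin mul1r ppow_ge0.
apply: (@le_trans _ _ (\int[mu2]_(x in S) (cst (8 * a ^+ 6)%:E x))%E).
  have -> : (\int[mu2]_(x in S) (cst (8 * a ^+ 6)%:E x) =
      (8 * a ^+ 6)%:E * (leb (J p.1) * leb (J p.2)))%E.
    by rewrite (integral_cst _ mS); congr (_ * _)%E; exact: product_measure1E.
  rewrite /J !lebesgue_measure_itv/= !lte_fin.
  rewrite !ifT; [|lra|lra].
  rewrite -!EFinD -!EFinM lee_fin.
  have -> : 8 * a ^+ 6 * ((p.1 + a - (p.1 - a)) * (p.2 + a - (p.2 - a))) = 32 * a ^+ 8 by ring.
  exact: lexx.
apply: ge0_le_integral => //.
- by move=> x _; rewrite lee_fin mulr_ge0// exprn_ge0// ltW.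
- exact: (measurable_funS mD SK mk).
- move=> x Sx; rewrite lee_fin mul1r /kern.
  have h : 2 * a ^+ 2 <= s - dist2 p x by have := SD _ Sx; rewrite /s; lra.
  have q0 : 0 <= 2 * a ^+ 2 by rewrite mulr_ge0// sqr_ge0.
  rewrite ppowE ?(le_trans q0)//.
  have -> : 8 * a ^+ 6 = (2 * a ^+ 2) ^+ 3 by ring.
  by rewrite lerXn2r ?nnegrE ?(le_trans q0).
Qed.

(** The kernel of [mean_value] divided by its mass, at a radius that depends on r
    only: its maximum and, by [kern_mass], a lower bound for its mass are explicit. *)
Lemma harmonic_kernel (r : R) : 0 <= r -> r < 1 -> exists2 C, 0 <= C & forall p, ddisk r p ->
  exists phi : plane -> R, [/\ continuous phi, forall x, `|phi x| <= C &
    forall f k, Ck_on disk 2 f ->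
      (forall x, disk x -> \sum_(k < 2) partial k (partial k f) x = 0) ->
      partial k f p = I (fun y => phi y * partial k f y)].
Proof.
move=> r0 r1; pose a := (1 - r) / 8.
have a0 : 0 < a by rewrite /a; lra.
exists (2 * a ^- 2); first by rewrite mulr_ge0// invr_ge0 sqr_ge0.
move=> p rp; pose s0 := (1 - r) ^+ 2 / 4; pose s1 := 4 * a ^+ 2.
have ND : near_disk p s0 `<=` disk by exact: near_disk_inside.
have a20 : 0 < a ^+ 2 by exact: exprn_gt0.
have s10 : 0 < s1 by rewrite mulr_gt0.
have s1s0 : s1 < s0.
  have -> : s0 = 4 * s1 by rewrite /s0 /s1 /a; field.
  lra.
have ND1 : near_disk p s1 `<=` disk := subset_trans (near_diskS (ltW s1s0)) ND.
set K := I (fun y => 1 * kern 3 p s1 y).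
have K1 : 32 * a ^+ 8 <= K := kern_mass a0 ND1.
have a80 : 0 < 32 * a ^+ 8 by rewrite mulr_gt0// exprn_gt0.
have K0 : 0 < K := lt_le_trans a80 K1.
exists (fun y => K^-1 * kern 3 p s1 y); split.
- by move=> y; apply: cvgM; [exact: cvg_cst|exact: kern_cont].
- move=> x; rewrite ger0_norm; last by rewrite mulr_ge0 ?ppow_ge0// invr_ge0 ltW.
  rewrite mulrC ler_pdivrMr//.
  have h : kern 3 p s1 x <= s1 ^+ 3.
    rewrite /kern /ppow lerXn2r ?nnegrE ?le_max ?lexx ?orbT ?(ltW s10)//.
    rewrite ge_max (ltW s10) andbT lerBlDr lerDl.
    by rewrite addr_ge0 ?sqr_ge0.
  apply: le_trans h _.
  have -> : s1 ^+ 3 = 2 * a ^- 2 * (32 * a ^+ 8) by rewrite /s1; field; rewrite gt_eqF.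
  by rewrite ler_pM2l// mulr_gt0// invr_gt0.
- move=> f k Cf Df.
  have C1 : {in disk, continuous (partial k f)}.
    by case: Cf => _ /(_ k)[_ []].
  have i := kern_integrable C1 ND 2 (ltW s1s0).
  have M := mean_value C1 ND (harmonic_balanced k Cf Df ND) s10 s1s0.
  transitivity (I (fun y => K^-1 * (partial k f y * kern 3 p s1 y))).
    by rewrite (IZ mD _ i) M -/K mulrCA mulVf ?mulr1// gt_eqF.
  by apply: eq_I => y _; ring.
Qed.

Lemma harmonic_bound (C : R) p (phi f : plane -> R) k : 0 <= C ->
  continuous phi -> (forall x, `|phi x| <= C) -> sqintD2 (partial k f) ->
  partial k f p = I (fun y => phi y * partial k f y) ->
  `|partial k f p| <= C * (fine (mu2 disk) + I (fun y => partial k f y ^+ 2)).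
Proof.
move=> C0 cphi bphi sf ->.
have ip : mu2.-integrable disk (EFin \o (fun y => phi y * partial k f y)).
  apply: (intgM_bounded mD (M := C)) => //; last exact: sqint_intg.
  exact: cont_measurable_disk.
have i1 : mu2.-integrable disk (EFin \o (fun _ : mplane => 1 : R)).
  by apply: (@intg_bounded _ _ _ mu2 _ mD _ 1) => // x _; rewrite normr1.
have i2 := intgD mD i1 sf.2.
apply: le_trans (I_norm mD ip) _.
have -> : fine (mu2 disk) + I (fun y => partial k f y ^+ 2) = I (fun y => 1 + partial k f y ^+ 2).
  by rewrite (ID mD i1 sf.2) (Rintegral_cst _ mD) mul1r.
rewrite -(IZ mD C i2); apply: (le_I mD _ (intgZ mD C i2)).
  exact: (integrable_norm ip).
move=> y _; rewrite normrM; apply: ler_pM => //.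
have [le1|lt1] := lerP `|partial k f y| 1.
  by apply: le_trans le1 _; rewrite lerDl sqr_ge0.
rewrite -real_normK ?num_real//.
by apply: le_trans (_ : `|partial k f y| ^+ 2 <= _); [rewrite ler_eXnr// ltW|rewrite lerDr].
Qed.

End MeanValueProperty.

(** * Weak limits of harmonic maps *)

Lemma compact_ddisk (K : set plane) : compact K -> K `<=` disk ->
  exists r : R, [/\ 0 <= r, r < 1 & K `<=` ddisk r].
Proof.
move=> cK KD; have [->|/set0P K0] := eqVneq K set0.
  by exists 0; split=> //; exact: ltr01.
have [|c /set_mem Kc Hc] := compact_EVT_max (f := rad2) K0 cK.
  by apply: continuous_subspaceT; exact: cont_rad.
exists (rad2 c); split; first by rewrite addr_ge0 ?sqr_ge0.
  exact: KD.
by move=> x Kx; apply: Hc; rewrite inE.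
Qed.

Section Vector.
Context {n : nat}.
Implicit Types u : plane -> 'rV[R]_n.

Definition dcomp u (i : 'I_n) (k : 'I_2) : plane -> R := partial k (fun y => u y 0 i).

Lemma harmonic_wgrad u : Defs.harmonic u -> is_wgrad u (jacobian_mx u).
Proof.
move=> hu; apply/is_wgradP => i k; have [C _] := hu i.
have := weak_d_C1 k (harmonic_C1 C).
by congr (weak_d _ _ _); apply/funext => x; rewrite mxE.
Qed.

Lemma harmonic_dcomp_ae u i k : Defs.harmonic u ->
  ae_eq mu2 disk (fun x => wgrad u x i k) (dcomp u i k).
Proof.
move=> hu; have := wgrad_ae i k (harmonic_wgrad hu).
by congr (ae_eq _ _ _ _); apply/funext => x; rewrite mxE.
Qed.

Lemma dcomp_cont u i k : Defs.harmonic u -> {in disk, continuous (dcomp u i k)}.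
Proof. by move=> hu; have [C _] := hu i; have [_ + _] := harmonic_C1 C; exact. Qed.

Lemma dcomp_measurable u i k : Defs.harmonic u -> measurable_fun disk (dcomp u i k).
Proof. by move=> hu; apply: cont_measurable; [exact: disk_open|exact: dcomp_cont]. Qed.

Lemma dcomp_sqint u i k : Defs.harmonic u -> W12 u -> sqintD2 (dcomp u i k).
Proof.
move=> hu Wu; apply: (ae_sqint mD _ (harmonic_dcomp_ae i k hu)).
  exact: dcomp_measurable.
exact: W12_sqint.
Qed.

Lemma I_dcomp u i k (phi : plane -> R) : Defs.harmonic u -> W12 u -> measurable_fun disk phi ->
  I (fun x => phi x * wgrad u x i k) = I (fun x => phi x * dcomp u i k x).
Proof.
move=> hu Wu mphi; apply: (ae_eq_I mD).
- by apply: measurable_funM => //; have [] := W12_sqint i k Wu.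
- by apply: measurable_funM => //; exact: dcomp_measurable.
- have := harmonic_dcomp_ae i k hu.
  by apply: filterS => x h Dx; rewrite h.
Qed.

Variables (u_ : nat -> plane -> 'rV[R]_n) (u0 : plane -> 'rV[R]_n) (M : R).
Hypothesis hu : forall j, Defs.harmonic (u_ j).
Hypothesis cu : weak_cvg_W12 u_ u0.
Hypothesis bu : forall j i k, I (fun x => wgrad (u_ j) x i k ^+ 2) <= M.

Let Wu j : W12 (u_ j). Proof. by case: cu. Qed.
Let W0 : W12 u0. Proof. by case: cu. Qed.

Let bdu j i k : I (fun x => dcomp (u_ j) i k x ^+ 2) <= M.
Proof.
suff <- : I (fun x => wgrad (u_ j) x i k ^+ 2) = I (fun x => dcomp (u_ j) i k x ^+ 2) by [].
apply: (ae_eq_I mD).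
- by have [_ /intg_measurable] := W12_sqint i k (Wu j).
- by have [_ /intg_measurable] := dcomp_sqint i k (hu j) (Wu j).
- have := harmonic_dcomp_ae i k (hu j).
  by apply: filterS => x h Dx; rewrite h.
Qed.

Lemma harmonic_gradient_bound r : 0 <= r -> r < 1 ->
  exists B, forall j i k x, ddisk r x -> `|dcomp (u_ j) i k x| <= B.
Proof.
move=> r0 r1; have [C C0 HC] := harmonic_kernel r0 r1.
exists (C * (fine (mu2 disk) + M)) => j i k x rx.
have [phi [cphi bphi Hphi]] := HC x rx; have [Cf Df] := hu j i.
apply: le_trans (harmonic_bound C0 cphi bphi (dcomp_sqint i k (hu j) (Wu j)) (Hphi _ k Cf Df)) _.
by apply: ler_wpM2l => //; rewrite lerD2l; exact: bdu.
Qed.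

(** At x the derivative is an integral of the weak gradient against a fixed bounded
    kernel, to which weak convergence applies. *)
Lemma harmonic_gradient_cvg i k x : disk x ->
  cvg (dcomp (u_ j) i k x @[j --> \oo]).
Proof.
move=> Dx.
have r0 : 0 <= rad2 x by rewrite addr_ge0 ?sqr_ge0.
have [C C0 HC] := harmonic_kernel r0 Dx.
have [phi [cphi bphi Hphi]] := HC x (lexx _).
have mphi : measurable_fun disk phi by exact: cont_measurable_disk.
have := weak_cvg_wgrad (i := i) (k := k) cu mphi (fun x _ => bphi x).
move=> h; apply/cvg_ex; exists (I (fun x => phi x * wgrad u0 x i k)).
have E : (fun j => dcomp (u_ j) i k x) = (fun j => I (fun x => phi x * wgrad (u_ j) x i k)).
  apply/funext => j; rewrite I_dcomp//; have [Cf Df] := hu j i.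
  exact: (Hphi _ k Cf Df).
by rewrite E.
Qed.

Definition limit_gradient i k x : R := lim (dcomp (u_ j) i k x @[j --> \oo]).

Lemma limit_gradient_cvg i k x : disk x ->
  dcomp (u_ j) i k x @[j --> \oo] --> limit_gradient i k x.
Proof. exact: harmonic_gradient_cvg. Qed.

Lemma limit_gradient_measurable i k : measurable_fun disk (limit_gradient i k).
Proof.
apply: (@measurable_fun_cvg _ _ _ _ (fun j => dcomp (u_ j) i k)).
  by move=> j; exact: dcomp_measurable.
by move=> x Dx; exact: limit_gradient_cvg.
Qed.

Lemma limit_gradient_bound i k r B : r < 1 ->
  (forall j i k x, ddisk r x -> `|dcomp (u_ j) i k x| <= B) ->
  forall x, ddisk r x -> `|limit_gradient i k x| <= B.
Proof.
move=> r1 H x rx.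
have h : `|dcomp (u_ j) i k x| @[j --> \oo] --> `|limit_gradient i k x|.
  by apply: cvg_norm; apply: limit_gradient_cvg; exact: ddisk_disk rx.
rewrite -(cvg_lim _ h)//; apply: limr_le; first by apply/cvg_ex; eexists; exact: h.
by apply: nearW => j; exact: H.
Qed.

(** Against a test function, whose support is compact, the gradients converge both
    by dominated convergence, to the integral of the pointwise limit, and weakly, to
    the integral of the weak gradient. *)
Lemma limit_gradient_ae i k :
  ae_eq mu2 disk (limit_gradient i k) (fun x => wgrad u0 x i k).
Proof.
set H := limit_gradient i k; set G := fun x => wgrad u0 x i k.
have mH : measurable_fun disk H by exact: limit_gradient_measurable.
have LH : loc_integrable H.
  split=> // K cK KD; have [r [r0 r1 Kr]] := compact_ddisk cK KD.
  have [B HB] := harmonic_gradient_bound r0 r1.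
  have mK : measurable (K : set mplane) by exact: compact_measurable_plane.
  apply: (@intg_bounded _ _ _ mu2 K mK H B).
  - by apply: le_lt_trans fD; apply: le_measure; rewrite ?inE.
  - exact: measurable_funS mH.
  - by move=> x /Kr rx; exact: limit_gradient_bound HB _ rx.
have LG : loc_integrable G by apply: sqint_loc; exact: W12_sqint.
have LHG := loc_integrableD LH (loc_integrableZ (-1) LG).
suff : ae_eq mu2 disk (fun x => H x + -1 * G x) (cst 0).
  apply: filterS => x h Dx; have /eqP := h Dx.
  by rewrite mulN1r subr_eq0 => /eqP.
apply: vanish_disk LHG _ => f tf.
have [sf [K [cK KD f0]]] := tf.
have cf : continuous f by have [] := is_C1T (smooth_is_C1 sf).
have supp : exists K : set plane, [/\ compact K, K `<=` disk & forall x, ~ K x -> f x = 0].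
  by exists K.
have iH := loc_integrable_test LH cf supp.
have iG := loc_integrable_test LG cf supp.
have -> : I (fun x => (H x + -1 * G x) * f x) = I (fun x => H x * f x - G x * f x).
  by apply: eq_I => x _; ring.
rewrite (IB mD iH iG); apply/eqP; rewrite subr_eq0; apply/eqP.
have [r [r0 r1 Kr]] := compact_ddisk cK KD.
have [B HB] := harmonic_gradient_bound r0 r1.
have [Mf HMf] := cont_bounded_cdisk cf.
have mf := cont_measurable_disk cf.
have c1 : I (fun x => f x * dcomp (u_ j) i k x) @[j --> \oo] --> I (fun x => H x * f x).
  have -> : I (fun x => H x * f x) = I (fun x => f x * H x) by apply: eq_I => x _; rewrite mulrC.
  have cnf : continuous (fun x => B * `|f x|).
    by move=> x; apply: cvgM; [exact: cvg_cst|exact: (cvg_norm (cf x))].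
  refine (proj2 (@I_dominated _ _ _ mu2 disk mD (fun j x => f x * dcomp (u_ j) i k x)
    (fun x => f x * H x) (fun x => B * `|f x|) _ _ _ (cont_intg cnf) _)).
  - by move=> j; apply: measurable_funM => //; exact: dcomp_measurable.
  - exact: measurable_funM.
  - by apply: aeW => x Dx; apply: cvgM; [exact: cvg_cst|exact: limit_gradient_cvg].
  - move=> j x Dx; have [Kx|nKx] := pselect (K x); last by rewrite f0// mul0r normr0 mulr0.
    by rewrite normrM mulrC ler_wpM2r//; exact: HB (Kr _ Kx).
have c2 : I (fun x => f x * dcomp (u_ j) i k x) @[j --> \oo] --> I (fun x => G x * f x).
  have -> : I (fun x => G x * f x) = I (fun x => f x * G x) by apply: eq_I => x _; rewrite mulrC.
  have := weak_cvg_wgrad (i := i) (k := k) cu mf (fun x Dx => HMf x (disk_cdisk Dx)).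
  have -> // : (fun j => I (fun x => f x * wgrad (u_ j) x i k)) = (fun j => I (fun x => f x * dcomp (u_ j) i k x)).
  by apply/funext => j; rewrite I_dcomp.
by rewrite -(cvg_lim _ c1)// -(cvg_lim _ c2).
Qed.

End Vector.

(** * The area integrand *)

Section AreaIntegrand.
Context {n : nat}.
Implicit Types (x y a b : 'I_n -> R) (B E : 'M[R]_(n, 2)).

Definition dot x y : R := \sum_i x i * y i.

Lemma dotC x y : dot x y = dot y x.
Proof. by apply: eq_bigr => i _; rewrite mulrC. Qed.

Lemma dot_linr x y a (s t : R) :
  dot x (fun i => s * y i + t * a i) = s * dot x y + t * dot x a.
Proof. by rewrite /dot !mulr_sumr -big_split; apply: eq_bigr => i _ /=; ring. Qed.

Lemma dot_ge0 x : 0 <= dot x x.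
Proof. by apply: sumr_ge0 => i _; rewrite -expr2 sqr_ge0. Qed.

Lemma dot_quadratic x y (s t : R) :
  dot (fun i => s * x i + t * y i) (fun i => s * x i + t * y i) =
  dot x x * s ^+ 2 + 2 * dot x y * s * t + dot y y * t ^+ 2.
Proof.
rewrite dot_linr (dotC _ x) (dotC _ y) !dot_linr (dotC y x); ring.
Qed.

Lemma dot_cauchy_schwarz x y : dot x y ^+ 2 <= dot x x * dot y y.
Proof. by apply: quadratic_discriminant => s t; rewrite -dot_quadratic dot_ge0. Qed.

(** The squared area of the parallelogram spanned by x and y. *)
Definition gram x y : R := dot x x * dot y y - dot x y ^+ 2.

Lemma gram_ge0 x y : 0 <= gram x y.
Proof. by rewrite subr_ge0 dot_cauchy_schwarz. Qed.

Lemma gramC x y : gram x y = gram y x.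
Proof. by rewrite /gram (dotC y x) mulrC. Qed.

Lemma gram_le x y : gram x y <= dot x x * dot y y.
Proof. by rewrite gerBl sqr_ge0. Qed.

Lemma sqrt_le_of_sqr (p q : R) : 0 <= q -> p <= q ^+ 2 -> Num.sqrt p <= q.
Proof. by move=> q0 h; rewrite -(ger0_norm q0) -sqrtr_sqr ler_sqrt ?sqr_ge0. Qed.

(** For fixed x, gram x is a nonnegative quadratic form; the square root of such a
    form satisfies the triangle inequality. *)
Lemma gram_triangle x y b :
  Num.sqrt (gram x (fun i => y i + b i)) <= Num.sqrt (gram x y) + Num.sqrt (gram x b).
Proof.
pose q := dot x x * dot y b - dot x y * dot x b.
have E s t : gram x (fun i => s * y i + t * b i) =
    gram x y * s ^+ 2 + 2 * q * s * t + gram x b * t ^+ 2.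
  by rewrite /gram dot_quadratic dot_linr /q; ring.
have -> : (fun i => y i + b i) = (fun i => 1 * y i + 1 * b i).
  by apply/funext => i; rewrite !mul1r.
rewrite E; apply: sqrt_le_of_sqr; first by rewrite addr_ge0 ?sqrtr_ge0.
have hq : q ^+ 2 <= gram x y * gram x b.
  by apply: quadratic_discriminant => s t; rewrite -E gram_ge0.
rewrite sqrrD !sqr_sqrtr ?gram_ge0// -sqrtrM ?gram_ge0//.
have h : q <= Num.sqrt (gram x y * gram x b).
  by apply: le_trans (ler_norm _) _; rewrite -sqrtr_sqr ler_wsqrtr.
by rewrite !expr1n !mulr1 mulr2n; move: h; lra.
Qed.

Lemma sqrt_mul_le (p q c : R) : 0 < c -> 0 <= p -> 0 <= q ->
  Num.sqrt (p * q) <= (c * p + c^-1 * q) / 2.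
Proof.
move=> c0 p0 q0; have c'0 : 0 <= c^-1 by rewrite invr_ge0 ltW.
apply: sqrt_le_of_sqr.
  by rewrite divr_ge0// addr_ge0// mulr_ge0// ltW.
have -> : ((c * p + c^-1 * q) / 2) ^+ 2 = p * q + ((c * p - c^-1 * q) / 2) ^+ 2.
  by field; rewrite gt_eqF.
by rewrite lerDl sqr_ge0.
Qed.

Definition jac B : R := Num.sqrt (\det (B^T *m B)).

Let gramE B (j k : 'I_2) : (B^T *m B) j k = dot (B ^~ j) (B ^~ k).
Proof. by rewrite mxE; apply: eq_bigr => i _; rewrite mxE. Qed.

Lemma det_22 (M : 'M[R]_2) : \det M = M 0 0 * M 1 1 - M 0 1 * M 1 0.
Proof.
rewrite (expand_det_row _ ord0) big_ord_recl big_ord1 /cofactor !det_mx11 !mxE /=.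
have e1 : lift ord0 ord0 = 1 :> 'I_2 by exact/val_inj.
have e2 : lift 1 ord0 = 0 :> 'I_2 by exact/val_inj.
rewrite !e1 !e2 /bump /= expr0 expr1; ring.
Qed.

Lemma jacE B : jac B = Num.sqrt (gram (B ^~ ord0) (B ^~ 1)).
Proof. by rewrite /jac det_22 !gramE /gram (dotC (B ^~ 1)) expr2. Qed.

Lemma jac_ge0 B : 0 <= jac B.
Proof. exact: sqrtr_ge0. Qed.

Lemma sqnormE B : sqnorm B = dot (B ^~ ord0) (B ^~ ord0) + dot (B ^~ 1) (B ^~ 1).
Proof.
rewrite /sqnorm /dot -big_split; apply: eq_bigr => i _ /=.
rewrite big_ord_recl big_ord1 !expr2.
by have -> : lift ord0 ord0 = 1 :> 'I_2 by exact/val_inj.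
Qed.

Lemma jac_le_sqnorm B : jac B <= sqnorm B / 2.
Proof.
rewrite jacE sqnormE; apply: le_trans (ler_wsqrtr (gram_le _ _)) _.
apply: le_trans (sqrt_mul_le ltr01 (dot_ge0 _) (dot_ge0 _)) _.
by rewrite invr1 !mul1r.
Qed.

Lemma jac_conformal B : (B^T *m B) 0 0 = (B^T *m B) 1 1 -> (B^T *m B) 0 1 = 0 ->
  sqnorm B = 2 * jac B.
Proof.
rewrite !gramE jacE sqnormE /gram => h1 h2.
have -> : dot (B ^~ ord0) (B ^~ 1) = 0 := h2.
have h1' : dot (B ^~ ord0) (B ^~ ord0) = dot (B ^~ 1) (B ^~ 1) := h1.
by rewrite h1' expr0n subr0 -expr2 sqrtr_sqr ger0_norm ?dot_ge0// mulr_natl mulr2n.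
Qed.

Lemma dotD_le x a : dot (fun i => x i + a i) (fun i => x i + a i) <=
  2 * dot x x + 2 * dot a a.
Proof.
rewrite /dot !mulr_sumr -big_split; apply: ler_sum => i _ /=.
have := sqr_ge0 (x i - a i); nra.
Qed.

(** The two columns are changed one after the other, by [gram_triangle]; the
    increments are products of lengths, split by Young's inequality. *)
Lemma jac_perturbation B E (c : R) : 0 < c ->
  jac (B + E) <= jac B + c * sqnorm B + (c + c^-1) * sqnorm E.
Proof.
move=> c0; rewrite !jacE !sqnormE.
set x := B ^~ ord0; set y := B ^~ 1; set a := E ^~ ord0; set b := E ^~ 1.
have -> : (B + E) ^~ ord0 = (fun i => x i + a i) by apply/funext => i; rewrite mxE.
have -> : (B + E) ^~ 1 = (fun i => y i + b i) by apply/funext => i; rewrite mxE.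
set xa := fun i => x i + a i.
have h1 := gram_triangle xa y b.
have h2 := gram_triangle y x a; rewrite -/xa in h2.
rewrite (gramC y xa) (gramC y x) in h2.
have h3 := le_trans (ler_wsqrtr (gram_le xa b)) (sqrt_mul_le c0 (dot_ge0 xa) (dot_ge0 b)).
have h4 := le_trans (ler_wsqrtr (gram_le y a)) (sqrt_mul_le c0 (dot_ge0 y) (dot_ge0 a)).
have h5 : c * dot xa xa <= c * (2 * dot x x + 2 * dot a a).
  by rewrite ler_pM2l//; exact: dotD_le.
have c'0 : 0 < c^-1 by rewrite invr_gt0.
have k1 : 0 <= c * dot y y by rewrite mulr_ge0 ?dot_ge0 ?ltW.
have k2 : 0 <= c^-1 * dot a a by rewrite mulr_ge0 ?dot_ge0 ?ltW.
have k3 : 0 <= c^-1 * dot b b by rewrite mulr_ge0 ?dot_ge0 ?ltW.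
have k4 : 0 <= c * dot b b by rewrite mulr_ge0 ?dot_ge0 ?ltW.
rewrite !mulrDr !mulrDl.
move: h1 h2 h3 h4 h5 k1 k2 k3 k4; rewrite !mulrDr.
move: (Num.sqrt _) (Num.sqrt (gram xa y)) (Num.sqrt (gram xa b)) (Num.sqrt (gram x y)) (Num.sqrt (gram y a)).
move: (c * dot y y) (c^-1 * dot a a) (c^-1 * dot b b) (c * dot b b) (c * dot xa xa).
by move=> *; lra.
Qed.

End AreaIntegrand.

(** * Area, and competitors with the same boundary values *)

Section Fields.
Context {n : nat}.
Implicit Types (A B G W : plane -> 'M[R]_(n, 2)) (u : plane -> 'rV[R]_n).

Lemma dot_measurable (f g : plane -> 'I_n -> R) :
  (forall i, measurable_fun disk (f ^~ i)) -> (forall i, measurable_fun disk (g ^~ i)) ->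
  measurable_fun disk (fun x => dot (f x) (g x)).
Proof.
move=> mf mg; rewrite /dot.
by apply: measurable_sum => i; exact: measurable_funM.
Qed.

Lemma jac_measurable A : (forall i k, measurable_fun disk (fun x => A x i k)) ->
  measurable_fun disk (fun x => jac (A x)).
Proof.
move=> mA.
have -> : (fun x => jac (A x)) = Num.sqrt \o (fun x => gram ((A x) ^~ ord0) ((A x) ^~ 1)).
  by apply/funext => x; rewrite jacE.
apply: measurableT_comp; first by apply: continuous_measurable_fun; exact: sqrt_continuous.
have md k l : measurable_fun disk (fun x => dot ((A x) ^~ k) ((A x) ^~ l)).
  by apply: dot_measurable.
by apply: measurable_funB; [exact: measurable_funM|exact: measurable_funX].
Qed.

Lemma jac_cvg (A_ : nat -> 'M[R]_(n, 2)) (A : 'M[R]_(n, 2)) :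
  (forall i k, A_ j i k @[j --> \oo] --> A i k) ->
  jac (A_ j) @[j --> \oo] --> jac A.
Proof.
move=> h; rewrite jacE.
have -> : (fun j => jac (A_ j)) = (fun j => Num.sqrt (gram ((A_ j) ^~ ord0) ((A_ j) ^~ 1))).
  by apply/funext => j; rewrite jacE.
have hd k l : dot ((A_ j) ^~ k) ((A_ j) ^~ l) @[j --> \oo] --> dot (A ^~ k) (A ^~ l).
  by apply: cvg_big => [|i _]; [exact: add_continuous|apply: cvgM; exact: h].
apply: continuous_cvg; first exact: sqrt_continuous.
apply: cvgB; first by apply: cvgM.
by rewrite expr2; under eq_fun do rewrite expr2; apply: cvgM.
Qed.

Lemma sqnorm_bound (A : 'M[R]_(n, 2)) (b : R) : 0 <= b -> (forall i k, `|A i k| <= b) ->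
  sqnorm A <= (2 * n)%:R * b ^+ 2.
Proof.
move=> b0 h; rewrite /sqnorm.
apply: (@le_trans _ _ (\sum_(i < n) \sum_(k < 2) b ^+ 2)).
  apply: ler_sum => i _; apply: ler_sum => k _.
  by rewrite -real_normK ?num_real// lerXn2r.
by rewrite !sumr_const !card_ord -mulrnA mulr_natl.
Qed.

Lemma jac_intg A : (forall i k, sqintD2 (fun x => A x i k)) ->
  mu2.-integrable disk (EFin \o (fun x => jac (A x))).
Proof.
move=> sA; apply: (intg_le mD _ _ (intg_sqnorm sA)).
  by apply: jac_measurable => i k; have [] := sA i k.
move=> x _; rewrite ger0_norm ?jac_ge0//; apply: le_trans (jac_le_sqnorm _) _.
by have := sqnorm_ge0 (A x); lra.
Qed.

Lemma ae_jac A B : (forall i k, ae_eq mu2 disk (fun x => A x i k) (fun x => B x i k)) ->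
  ae_eq mu2 disk (fun x => jac (A x)) (fun x => jac (B x)).
Proof.
move=> /ae_eq_family; apply: filterS => x h Dx; congr jac.
by apply/matrixP => i k; exact: h.
Qed.

Lemma area_wgrad u G : is_wgrad u G -> (forall i k, sqintD2 (fun x => G x i k)) ->
  area u = (I (fun x => jac (G x)))%:E.
Proof.
move=> uG sG; rewrite (EFin_I mD (jac_intg sG)) /area.
have mG i k : measurable_fun disk (fun x => G x i k) by have [] := sG i k.
have /is_wgradP uW := wgrad_is uG.
have mW i k : measurable_fun disk (fun x => wgrad u x i k) by have [_ []] := uW i k.
apply: ge0_ae_eq_integral => //.
- by apply/measurable_EFinP; exact: jac_measurable.
- by apply/measurable_EFinP; exact: jac_measurable.
- by move=> x _; rewrite lee_fin jac_ge0.
have := ae_jac (fun i k => wgrad_ae i k uG).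
by apply: filterS => x h Dx; rewrite /= -h.
Qed.

Lemma weak_d_W12 u G : (forall i, sqintD2 (fun x => u x 0 i)) ->
  is_wgrad u G -> (forall i k, sqintD2 (fun x => G x i k)) -> W12 u.
Proof.
move=> su uG sG; split; last by exists G; split=> // i k; exact: sG.
by move=> i j; rewrite (ord1 i); exact: su.
Qed.

Lemma within_entries (A : set plane) u :
  (forall i x, A x -> u y 0 i @[y --> within A (nbhs x)] --> u x 0 i) ->
  {within A, continuous u}.
Proof.
move=> h; apply/subspace_continuousP => x Ax V [P nP sPV].
suff : \forall y \near within A (nbhs x), forall j, P 0 j (u y 0 j).
  by apply: filterS => y hy; apply: sPV => i j; rewrite (ord1 i).
by apply: filter_forall => j; apply: h => //; exact: nP.
Qed.

Section Perturbation.
Variables (z : 'I_n -> plane -> R) (w : 'I_n -> 'I_2 -> plane -> R) (r : R).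
Hypothesis Cz : forall i, is_C1 setT (z i) (w i).
Hypothesis r1 : r < 1.
Hypothesis z0 : forall i x, ~ ddisk r x -> z i x = 0.

Definition row_map x : 'rV[R]_n := \row_i z i x.
Definition row_grad x : 'M[R]_(n, 2) := \matrix_(i, k) w i k x.

Let cz i : continuous (z i). Proof. by have [] := is_C1T (Cz i). Qed.
Let cw i k : continuous (w i k). Proof. by have [] := is_C1T (Cz i). Qed.

Lemma row_map_wgrad : is_wgrad row_map row_grad.
Proof.
apply/is_wgradP => i k.
have := weak_d_C1 k (is_C1_sub (@subsetT _ disk) (Cz i)).
by congr (weak_d _ _ _); apply/funext => x; rewrite mxE.
Qed.

Lemma row_grad_sqint i k : sqintD2 (fun x => row_grad x i k).
Proof.
have -> : (fun x => row_grad x i k) = w i k by apply/funext => x; rewrite mxE.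
exact: sqint_cont.
Qed.

Lemma row_map_W12 : W12 row_map.
Proof.
apply: weak_d_W12 row_map_wgrad row_grad_sqint => i.
have -> : (fun x => row_map x 0 i) = z i by apply/funext => x; rewrite mxE.
exact: sqint_cont.
Qed.

Lemma row_grad0 x : ~ ddisk r x -> row_grad x = 0.
Proof.
move=> nx; apply/matrixP => i k; rewrite !mxE.
have oC : open (~` ddisk r) by apply: closed_openC; exact: ddisk_closed.
exact: (is_C1_grad0 oC (is_C1_sub (@subsetT _ _) (Cz i)) (z0 i)).
Qed.

Lemma spans_perturbation (c u : plane -> 'rV[R]_n) :
  spans c u -> spans c (fun x => u x + row_map x).
Proof.
move=> [cu Wu [phi [cphi sphi mphi uphi]]]; split.
- apply: within_entries => i x Dx.
  have -> : (fun y => (u y + row_map y) 0 i) = (fun y => u y 0 i + z i y).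
    by apply/funext => y; rewrite !mxE.
  rewrite !mxE; apply: cvgD.
    move/subspace_continuousP : cu => /(_ x Dx) h.
    exact: (cvg_comp _ _ h (@coord_continuous _ _ _ 0 i (u x))).
  by apply: cvg_within_filter; exact: cz.
- have := W12_lin 1 Wu row_map_W12.
  by congr W12; apply/funext => x; rewrite scale1r.
- exists phi; split=> // x cx; rewrite -uphi//.
  suff -> : row_map x = 0 by rewrite addr0.
  apply/rowP => i; rewrite !mxE; apply: z0; rewrite /ddisk /rad2 /= => h.
  by move: cx h; rewrite /circle /= => ->; rewrite leNgt r1.
Qed.

End Perturbation.

End Fields.

(** * Compactly supported variations of a weak limit *)

Section InteriorMinimality.

Context {n : nat}.
Variables (c_ u_ : nat -> plane -> 'rV[R]_n) (u0 : plane -> 'rV[R]_n) (M : R).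
Hypothesis mu_ : forall j, douglas_minimizer (c_ j) (u_ j).
Hypothesis cu : weak_cvg_W12 u_ u0.
Hypothesis bu : forall j i k, I (fun x => wgrad (u_ j) x i k ^+ 2) <= M.

Variables (z : 'I_n -> plane -> R) (w : 'I_n -> 'I_2 -> plane -> R) (r : R).
Hypothesis Cz : forall i, is_C1 setT (z i) (w i).
Hypothesis r0 : 0 <= r.
Hypothesis r1 : r < 1.
Hypothesis z0 : forall i x, ~ ddisk r x -> z i x = 0.

Let hu j : Defs.harmonic (u_ j). Proof. by case: (mu_ j). Qed.
Let Wu j : W12 (u_ j). Proof. by case: cu. Qed.
Let W0 : W12 u0. Proof. by case: cu. Qed.
Let W := row_grad w.
Let A j := jacobian_mx (u_ j).
Let H x : 'M[R]_(n, 2) := \matrix_(i, k) limit_gradient u_ i k x.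

Let AE j i k : (fun x => A j x i k) = dcomp (u_ j) i k.
Proof. by apply/funext => x; rewrite mxE. Qed.

Let HE i k : (fun x => H x i k) = limit_gradient u_ i k.
Proof. by apply/funext => x; rewrite mxE. Qed.

Let sA j i k : sqintD2 (fun x => A j x i k).
Proof. by rewrite AE; exact: dcomp_sqint. Qed.

Let sW i k : sqintD2 (fun x => W x i k).
Proof. exact: (row_grad_sqint Cz). Qed.

Let sAW j i k : sqintD2 (fun x => (A j x + W x) i k).
Proof.
have -> : (fun x => (A j x + W x) i k) = (fun x => A j x i k + W x i k).
  by apply/funext => x; rewrite mxE.
exact: (sqintD mD (sA j i k) (sW i k)).
Qed.

Let s0 i k : sqintD2 (fun x => wgrad u0 x i k).
Proof. exact: W12_sqint. Qed.

Let s0W i k : sqintD2 (fun x => (wgrad u0 x + W x) i k).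
Proof.
have -> : (fun x => (wgrad u0 x + W x) i k) = (fun x => wgrad u0 x i k + W x i k).
  by apply/funext => x; rewrite mxE.
exact: (sqintD mD (s0 i k) (sW i k)).
Qed.

Lemma perturbation_ge0 j : 0 <= I (fun x => jac (A j x + W x) - jac (A j x)).
Proof.
have [su _ _ min] := mu_ j.
have := min _ (spans_perturbation Cz r1 z0 su).
rewrite (area_wgrad (harmonic_wgrad (hu j)) (sA j)).
have G : is_wgrad (fun x => u_ j x + row_map z x) (fun x => A j x + W x).
  have := is_wgrad_lin 1 (harmonic_wgrad (hu j)) (row_map_wgrad Cz).
  by congr is_wgrad; apply/funext => x; rewrite scale1r.
rewrite (area_wgrad G (sAW j)) lee_fin => h.
by rewrite (IB mD (jac_intg (sAW j)) (jac_intg (sA j))) subr_ge0.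
Qed.

(** The two areas agree off the support of z, and on it the gradients of all the u_j
    have a common bound. *)
Lemma perturbation_dominated : exists g : plane -> R,
  mu2.-integrable disk (EFin \o g) /\
  forall j x, disk x -> `|jac (A j x + W x) - jac (A j x)| <= g x.
Proof.
have [B HB] := harmonic_gradient_bound hu cu bu r0 r1.
pose b x : R := \sum_i \sum_k `|w i k x|.
have cw i k : continuous (w i k) by have [] := is_C1T (Cz i).
have cb : continuous b.
  move=> x; apply: cvg_big => [|i _]; first exact: add_continuous.
  apply: cvg_big => [|k _]; first exact: add_continuous.
  exact: cvg_norm (cw i k x).
have b0 x : 0 <= b x by apply: sumr_ge0 => i _; apply: sumr_ge0.
have wb i k x : `|w i k x| <= b x.
  rewrite /b (bigD1 i)//= (bigD1 k)//= -addrA lerDl addr_ge0//.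
    by apply: sumr_ge0.
  by apply: sumr_ge0 => *; apply: sumr_ge0.
exists (fun x => (2 * n)%:R * (`|B| + b x) ^+ 2); split.
  apply: cont_intg => x; apply: cvgM; first exact: cvg_cst.
  by apply: (@cont_sqr (fun y => `|B| + b y)) => y; apply: cvgD; [exact: cvg_cst|exact: cb].
move=> j x Dx; have [rx|nrx] := pselect (ddisk r x); last first.
  rewrite /W (row_grad0 Cz z0 nrx) addr0 subrr normr0.
  by rewrite mulr_ge0// sqr_ge0.
have p0 : 0 <= `|B| + b x by rewrite addr_ge0.
have Ab i k : `|A j x i k| <= `|B|.
  have -> : A j x i k = dcomp (u_ j) i k x by rewrite mxE.
  exact: le_trans (HB j i k x rx) (ler_norm _).
have h1 : sqnorm (A j x) <= (2 * n)%:R * (`|B| + b x) ^+ 2.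
  by apply: sqnorm_bound => // i k; apply: le_trans (Ab i k) _; rewrite lerDl.
have h2 : sqnorm (A j x + W x) <= (2 * n)%:R * (`|B| + b x) ^+ 2.
  apply: sqnorm_bound => // i k; rewrite mxE; apply: le_trans (ler_normD _ _) _.
  by apply: lerD; [exact: Ab|rewrite mxE].
have h3 := jac_le_sqnorm (A j x); have h4 := jac_le_sqnorm (A j x + W x).
have h5 := jac_ge0 (A j x); have h6 := jac_ge0 (A j x + W x).
by rewrite ler_norml; apply/andP; split; lra.
Qed.

(** The increase of area from u_j to u_j + z is nonnegative, and it passes to the
    limit by dominated convergence since the gradients converge pointwise. *)
Lemma interior_minimality :
  I (fun x => jac (wgrad u0 x)) <= I (fun x => jac (wgrad u0 x + W x)).
Proof.
have [g [ig dg]] := perturbation_dominated.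
have mH i k : measurable_fun disk (fun x => H x i k).
  by rewrite HE; exact: (limit_gradient_measurable hu cu).
have mHW i k : measurable_fun disk (fun x => (H x + W x) i k).
  have -> : (fun x => (H x + W x) i k) = (fun x => H x i k + W x i k).
    by apply/funext => x; rewrite mxE.
  by apply: measurable_funD => //; have [] := sW i k.
have mjA j : measurable_fun disk (fun x => jac (A j x + W x) - jac (A j x)).
  apply: measurable_funB; apply: jac_measurable => i k.
    by have [] := sAW j i k.
  by have [] := sA j i k.
have mjH : measurable_fun disk (fun x => jac (H x + W x) - jac (H x)).
  by apply: measurable_funB; exact: jac_measurable.
have cD x : disk x -> (jac (A j x + W x) - jac (A j x)) @[j --> \oo] -->
    jac (H x + W x) - jac (H x).
  move=> Dx.
  have cA i k : A j x i k @[j --> \oo] --> H x i k.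
    have : dcomp (u_ j) i k x @[j --> \oo] --> limit_gradient u_ i k x.
      by apply: limit_gradient_cvg hu cu _ _ _ Dx.
    rewrite mxE; have -> // : (fun j => A j x i k) = (fun j => dcomp (u_ j) i k x).
    by apply/funext => j; rewrite mxE.
  apply: cvgB; last exact: jac_cvg.
  apply: jac_cvg => i k; rewrite mxE.
  have -> : (fun j => (A j x + W x) i k) = (fun j => A j x i k + W x i k).
    by apply/funext => j; rewrite mxE.
  by apply: cvgD; [exact: cA|exact: cvg_cst].
have lim0 : 0 <= I (fun x => jac (H x + W x) - jac (H x)).
  have c : (fun j => I (fun x => jac (A j x + W x) - jac (A j x))) @ \oo -->
      I (fun x => jac (H x + W x) - jac (H x)).
    refine (proj2 (@I_dominated _ _ _ mu2 disk mD (fun j x => jac (A j x + W x) - jac (A j x))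
      (fun x => jac (H x + W x) - jac (H x)) g mjA mjH _ ig dg)).
    by apply: aeW => x Dx; exact: cD.
  rewrite -(cvg_lim _ c)//; apply: limr_ge; first by apply/cvg_ex; eexists; exact: c.
  by apply: nearW => j; exact: perturbation_ge0.
have ijG := jac_intg s0; have ijGW := jac_intg s0W.
rewrite -subr_ge0 -(IB mD ijGW ijG).
suff <- : I (fun x => jac (H x + W x) - jac (H x)) =
  I (fun x => jac (wgrad u0 x + W x) - jac (wgrad u0 x)) by [].
apply: (ae_eq_I mD mjH).
  by apply: measurable_funB; apply: jac_measurable => i k; [have [] := s0W i k|have [] := s0 i k].
have /ae_eq_family : forall i k, ae_eq mu2 disk (fun x => H x i k) (fun x => wgrad u0 x i k).
  by move=> i k; rewrite HE; exact: (limit_gradient_ae hu cu bu).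
apply: filterS => x h Dx.
by have -> : H x = wgrad u0 x by apply/matrixP => i k; exact: h.
Qed.

End InteriorMinimality.

(** * Lipschitz maps and the energy of the minimizers *)

Section Maps.
Context {n : nat}.
Implicit Types (u : plane -> 'rV[R]_n) (G : plane -> 'M[R]_(n, 2)) (L : R).

Lemma entry_le_norm (x : 'rV[R]_n) i : `|x 0 i| <= `|x|.
Proof.
rewrite [leRHS]/Num.norm /= mx_normrE; apply/bigmax_geP; right => /=.
by exists (0, i).
Qed.

Lemma mcshane_map (A : set plane) u : A !=set0 -> [lipschitz u x | x in A] ->
  exists L (F : plane -> 'rV[R]_n), [/\ 0 <= L, forall i, lip1 L (fun x => F x 0 i) &
    forall x, A x -> F x = u x].
Proof.
move=> A0 /lipschitz_const[L L1 HL].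
have L0 : 0 <= L by exact: le_trans ler01 L1.
have ex i : exists F, lip1 L F /\ forall x, A x -> F x = u x 0 i.
  apply: mcshane => // x y Ax Ay.
  have := le_trans (HL x y Ax Ay) (ler_wpM2l L0 (norm_dist1 x y)).
  by apply: le_trans; have := entry_le_norm (u x - u y) i; rewrite !mxE.
have [F HF] := choice ex.
exists L, (fun x => \row_i F i x); split=> //.
  by move=> i x y; rewrite !mxE; have [h _] := HF i; exact: h.
by move=> x Ax; apply/rowP => i; rewrite mxE; have [_ h] := HF i; exact: h.
Qed.

Lemma lipschitz_map_gradient u L : 0 <= L -> (forall i, lip1 L (fun x => u x 0 i)) ->
  exists (sg : 'I_n -> nat -> (plane -> R) * ('I_2 -> plane -> R)) G,
  [/\ forall i m, approximant (fun x => u x 0 i) L m (sg i m),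
      forall i k, sqintD2 (fun x => G x i k),
      forall i k x, disk x -> `|G x i k| <= L,
      forall i k, (fun m => I (fun x => ((sg i m).2 k x - G x i k) ^+ 2)) @ \oo --> (0 : R) &
      is_wgrad u G].
Proof.
move=> L0 Lu.
have ex i : exists p : (nat -> (plane -> R) * ('I_2 -> plane -> R)) * ('I_2 -> plane -> R),
  [/\ forall m, approximant (fun x => u x 0 i) L m (p.1 m),
      forall k, measurable_fun disk (p.2 k), forall k x, disk x -> `|p.2 k x| <= L,
      forall k, (fun m => I (fun x => ((p.1 m).2 k x - p.2 k x) ^+ 2)) @ \oo --> (0 : R) &
      forall k, weak_d k (fun x => u x 0 i) (p.2 k)].
  by have [sg [G h]] := lipschitz_gradient L0 (Lu i); exists (sg, G).
have [p Hp] := choice ex.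
have E i k : (fun x => (\matrix_(i, k) (p i).2 k x : 'M[R]_(n, 2)) i k) = (p i).2 k.
  by apply/funext => x; rewrite mxE.
exists (fun i => (p i).1), (fun x => \matrix_(i, k) (p i).2 k x); split.
- by move=> i m; have [h _ _ _ _] := Hp i; exact: h.
- move=> i k; rewrite E; have [_ h1 h2 _ _] := Hp i.
  exact: sqint_bounded fD (h1 k) (h2 k).
- by move=> i k x Dx; rewrite mxE; have [_ _ h _ _] := Hp i; exact: h.
- move=> i k; have [_ _ _ h _] := Hp i; have := h k.
  by under [in X in _ -> X]eq_fun do under eq_fun do rewrite mxE.
- by apply/is_wgradP => i k; rewrite E; have [_ _ _ _ h] := Hp i.
Qed.

Lemma is_wgrad_eq u u' G : (forall x, disk x -> u x = u' x) -> is_wgrad u G -> is_wgrad u' G.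
Proof.
move=> e uG i k; have [[m1 l1] lG h] := uG i k; split=> //.
  split.
    apply: (@eq_measurable_fun _ _ _ _ _ (fun x => u x 0 i)) m1 => x /set_mem Dx.
    by rewrite e.
  move=> K cK KD; apply: (eq_intg (compact_measurable_plane cK) _ (l1 K cK KD)) => x Kx.
  by rewrite e//; exact: KD.
move=> f tf; rewrite -h//; apply: eq_I => x Dx.
by rewrite e.
Qed.

Lemma lipschitz_map_W12 u L G : (forall i, lip1 L (fun x => u x 0 i)) ->
  is_wgrad u G -> (forall i k, sqintD2 (fun x => G x i k)) -> W12 u.
Proof.
move=> Lu uG sG; apply: weak_d_W12 uG sG => i.
by apply: sqint_cont; exact: lip1_cont.
Qed.

Lemma lipschitz_map_area u L G : 0 <= L -> is_wgrad u G ->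
  (forall i k, sqintD2 (fun x => G x i k)) -> (forall i k x, disk x -> `|G x i k| <= L) ->
  (area u <= ((2 * n)%:R * L ^+ 2 * fine (mu2 disk))%:E)%E.
Proof.
move=> L0 uG sG bG; rewrite (area_wgrad uG sG) lee_fin -(Rintegral_cst _ mD).
apply: (le_I mD (jac_intg sG)).
  by apply: (@intg_bounded _ _ _ mu2 _ mD _ `|(2 * n)%:R * L ^+ 2|) => // x _.
move=> x Dx; have h := sqnorm_bound L0 (fun i k => bG i k x Dx).
by have := jac_le_sqnorm (G x); have := sqnorm_ge0 (G x); lra.
Qed.

(** For a conformal map |Du|^2 is twice the area integrand. *)
Lemma conformal_energy u (C : R) i k : W12 u -> Defs.harmonic u -> weakly_conformal u ->
  (area u <= C%:E)%E -> I (fun x => wgrad u x i k ^+ 2) <= 2 * C.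
Proof.
move=> Wu hu ku.
have sA i' k' : sqintD2 (fun x => jacobian_mx u x i' k').
  have -> : (fun x => jacobian_mx u x i' k') = dcomp u i' k'.
    by apply/funext => x; rewrite mxE.
  exact: dcomp_sqint.
rewrite (area_wgrad (harmonic_wgrad hu) sA) lee_fin => h.
apply: le_trans (_ : 2 * I (fun x => jac (jacobian_mx u x)) <= _); last by rewrite ler_pM2l.
have -> : I (fun x => wgrad u x i k ^+ 2) = I (fun x => jacobian_mx u x i k ^+ 2).
  apply: (ae_eq_I mD).
  - by have [_ /intg_measurable] := W12_sqint i k Wu.
  - by have [_ /intg_measurable] := sA i k.
  - have := wgrad_ae i k (harmonic_wgrad hu).
    by apply: filterS => x e Dx; rewrite e.
have ij := jac_intg sA.
rewrite -(IZ mD _ ij); apply: (le_I mD (sA i k).2 (intgZ mD _ ij)) => x Dx.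
have [e1 e2] := ku x Dx.
by rewrite -(jac_conformal e1 e2); exact: entry_le_sqnorm.
Qed.

End Maps.

Let circle0 : (@circle R) !=set0.
Proof. by exists (1, 0); rewrite /circle /= expr1n expr0n addr0. Qed.

Lemma weakly_monotone_id : weakly_monotone (@id plane).
Proof. by exists id; split=> [t||]; [exact: cvg_id|by []|left; split]. Qed.

Lemma spans_self n (c u : plane -> 'rV[R]_n) : {within cdisk, continuous u} -> W12 u ->
  (forall x, circle x -> u x = c x) -> spans c u.
Proof.
move=> cu Wu uc; split=> //; exists id; split=> //.
- by apply: continuous_subspaceT => x; exact: cvg_id.
- by apply/seteqP; split=> [x [y cy <-]//|x cx]; exists x.
- exact: weakly_monotone_id.
Qed.

(** McShane extensions of the two components of gamma, together with the functions
    e x.1 and e x.2, have a Lipschitz constant that does not depend on e <= 1. *)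
Lemma lifted_curve_competitor (gamma : plane -> plane) :
  [lipschitz gamma x | x in circle] ->
  exists C, forall e : R, 0 < e <= 1 -> exists2 u, spans (lifted_curve gamma e) u &
    (area u <= C%:E)%E.
Proof.
move=> /lipschitz_const[L L1 HL].
have L0 : 0 <= L := le_trans ler01 L1.
have lipc (p : plane -> R) : (forall x, `|p x| <= `|x|) -> (forall x y, p (x - y) = p x - p y) ->
    exists F, lip1 L F /\ forall x, circle x -> F x = p (gamma x).
  move=> pn pB; apply: mcshane => // x y cx cy; rewrite -pB.
  apply: le_trans (pn _) _; apply: le_trans (HL x y cx cy) _.
  by apply: ler_wpM2l => //; exact: norm_dist1.
have [F1 [lF1 eF1]] : exists F, lip1 L F /\ forall x, circle x -> F x = (gamma x).1.
  by apply: (lipc fst) => // x; rewrite {2}/Num.norm /= le_max lexx.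
have [F2 [lF2 eF2]] : exists F, lip1 L F /\ forall x, circle x -> F x = (gamma x).2.
  by apply: (lipc snd) => // x; rewrite {2}/Num.norm /= le_max lexx orbT.
exists ((2 * 4)%:R * L ^+ 2 * fine (mu2 disk)) => e /andP[e0 e1].
pose u := lifted_curve (fun x => (F1 x, F2 x)) e.
have lu i : lip1 L (fun x => u x 0 i).
  have lip_small (a : R) (x y : plane) : `|a| <= dist1 x y -> `|e * a| <= L * dist1 x y.
    move=> h; rewrite normrM (gtr0_norm e0); apply: ler_pM => //; first exact: ltW.
    exact: le_trans e1 L1.
  move=> x y; rewrite !mxE; case: i => [[|[|[|[|]]]]] //= _.
  - by rewrite -mulrBr; apply: lip_small; rewrite lerDl.
  - by rewrite -mulrBr; apply: lip_small; rewrite lerDr.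
have [_ [G [_ sG bG _ uG]]] := lipschitz_map_gradient L0 lu.
exists u; last exact: lipschitz_map_area L0 uG sG bG.
apply: spans_self.
- apply: within_entries => i x _; apply: cvg_within_filter.
  exact: (lip1_cont (lu i)).
- exact: lipschitz_map_W12 lu uG sG.
- by move=> x cx; apply/rowP => i; rewrite !mxE eF1// eF2.
Qed.

Lemma minimizers_energy_bound (gamma : plane -> plane) (eps : nat -> R)
    (u : nat -> plane -> 'rV[R]_4) : [lipschitz gamma x | x in circle] ->
  (forall j, 0 < eps j <= 1) ->
  (forall j, douglas_minimizer (lifted_curve gamma (eps j)) (u j)) ->
  exists M, forall j i k, I (fun x => wgrad (u j) x i k ^+ 2) <= M.
Proof.
move=> /lifted_curve_competitor[C HC] e01 du; exists (2 * C) => j i k.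
have [[_ Wu _] hu ku min] := du j.
have [v sv av] := HC _ (e01 j).
exact: (conformal_energy i k Wu hu ku (le_trans (min v sv) av)).
Qed.

(** * Approximation of competitors with the same trace *)

Section TraceApproximation.

Let C := ([set` `[0, 2 * pi]%R] : set (measurableTypeR R)).
Let mC : measurable C. Proof. exact: measurable_itv. Qed.

Let cintC (H : plane -> R) : continuous H -> leb.-integrable C (EFin \o (fun t => H (angle t))).
Proof. by move=> cH; apply: cont_itv_intg; exact: angle_cont. Qed.

Lemma L2_cvg0B (a b : nat -> plane -> R) :
  (forall m, sqintD2 (a m)) -> (forall m, sqintD2 (b m)) ->
  (fun m => I (fun x => a m x ^+ 2)) @ \oo --> (0 : R) ->
  (fun m => I (fun x => b m x ^+ 2)) @ \oo --> (0 : R) ->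
  (fun m => I (fun x => (a m x - b m x) ^+ 2)) @ \oo --> (0 : R).
Proof.
move=> sa sb ca cb.
have c2 : (fun m => 2 * I (fun x => a m x ^+ 2) + 2 * I (fun x => b m x ^+ 2)) @ \oo --> (0 : R).
  rewrite -[X in _ --> X](_ : 2 * 0 + 2 * 0 = 0 :> R); last by rewrite !mulr0 addr0.
  by apply: cvgD; apply: cvgM => //; exact: cvg_cst.
apply: (squeeze_cvgr _ (cvg_cst 0) c2); apply: nearW => m; apply/andP; split.
  by apply: I_ge0 => x _; exact: sqr_ge0.
have i1 := intgZ mD 2 (sa m).2; have i2 := intgZ mD 2 (sb m).2.
rewrite -(IZ mD 2 (sa m).2) -(IZ mD 2 (sb m).2) -(ID mD i1 i2).
apply: (le_I mD (sqintB mD (sa m) (sb m)).2 (intgD mD i1 i2)) => x _.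
by have := sqr_ge0 (a m x + b m x); lra.
Qed.

Lemma circle_cvg0 n (s : nat -> plane -> R) (w : nat -> plane -> 'rV[R]_n)
    (v : plane -> 'rV[R]_n) i :
  (forall m, continuous (s m)) -> (forall m j, continuous (fun x => w m x 0 j)) ->
  (forall j, continuous (fun x => v x 0 j)) ->
  (forall m x, `|s m x - v x 0 i| <= m.+1%:R^-1) ->
  (fun m => circle_dist2 (w m) v) @ \oo --> 0%E ->
  (fun m => fine (circle_int (fun x => (s m x - w m x 0 i) ^+ 2))) @ \oo --> (0 : R).
Proof.
move=> cs cw cv sv cwv.
pose d m (x : plane) := sqnorm (w m x - v x).
have cd m : continuous (d m).
  move=> x; apply: cvg_big => [|i' _]; first exact: add_continuous.
  apply: cvg_big => [|j _]; first exact: add_continuous.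
  have -> : (fun y => (w m y - v y) i' j ^+ 2) = (fun y => (w m y 0 j - v y 0 j) ^+ 2).
    by apply/funext => y; rewrite (ord1 i') !mxE.
  have -> : (w m x - v x) i' j ^+ 2 = (w m x 0 j - v x 0 j) ^+ 2.
    by rewrite (ord1 i') !mxE.
  by apply: (@cont_sqr (fun y => w m y 0 j - v y 0 j)) => y; apply: cvgB; [exact: cw|exact: cv].
have cwv' : (fun m => fine (circle_dist2 (w m) v)) @ \oo --> (0 : R) by exact: fine_cvg cwv.
have c1 : (fun m : nat => m.+1%:R^-1 ^+ 2) @ \oo --> (0 : R).
  rewrite -[X in _ --> X](_ : 0 * 0 = 0 :> R); last by rewrite mulr0.
  by under eq_fun do rewrite expr2; apply: cvgM; exact: cvg_harmonic.
pose K := fine (leb C).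
have c2 : (fun m : nat => (2 * m.+1%:R^-1 ^+ 2) * K + 2 * fine (circle_dist2 (w m) v)) @ \oo --> (0 : R).
  rewrite -[X in _ --> X](_ : (2 * 0) * K + 2 * 0 = 0 :> R); last by rewrite !mulr0 mul0r addr0.
  apply: cvgD; last by apply: cvgM; [exact: cvg_cst|exact: cwv'].
  by apply: cvgM; [apply: cvgM; [exact: cvg_cst|exact: c1]|exact: cvg_cst].
apply: (squeeze_cvgr _ (cvg_cst 0) c2); apply: nearW => m; apply/andP; split.
  by apply: fine_ge0; apply: circle_int_ge0 => x; exact: sqr_ge0.
have csw : continuous (fun x => (s m x - w m x 0 i) ^+ 2).
  by apply: cont_sqr => x; apply: cvgB; [exact: cs|exact: cw].
pose q := 2 * m.+1%:R^-1 ^+ 2 : R.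
have iq : leb.-integrable C (EFin \o (fun t => q)).
  by apply: (@cintC (fun=> q)) => x; exact: cvg_cst.
have id2 := intgZ mC 2 (cintC (cd m)).
rewrite -(Rintegral_cst _ mC).
have -> : 2 * fine (circle_dist2 (w m) v) = \int[leb]_(t in C) (2 * d m (angle t)).
  by rewrite (IZ mC 2 (cintC (cd m))).
rewrite -(ID mC iq id2).
apply: (le_I mC (cintC csw) (intgD mC iq id2)) => t _.
have h1 := entry_le_sqnorm (w m (angle t) - v (angle t)) 0 i.
rewrite !mxE in h1.
have h2 : (s m (angle t) - v (angle t) 0 i) ^+ 2 <= m.+1%:R^-1 ^+ 2.
  by rewrite -real_normK ?num_real// lerXn2r// nnegrE.
exact: sqr_triangle2 h2 h1.
Qed.

End TraceApproximation.

Section TraceGradient.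

Context {n : nat}.
Variables (u0 v : plane -> 'rV[R]_n).
Hypothesis tr : is_trace u0 v.

Lemma smooth_map_wgrad (w : plane -> 'rV[R]_n) :
  (forall i, smooth_on setT (fun x => w x 0 i)) ->
  is_wgrad w (jacobian_mx w) /\ W12 w.
Proof.
move=> sw.
have C i : is_C1 setT (fun x => w x 0 i) (dcomp w i) by exact: smooth_is_C1.
have E : row_map (fun i x => w x 0 i) = w.
  by apply/funext => x; apply/rowP => i; rewrite mxE.
have E2 : row_grad (dcomp w) = jacobian_mx w.
  by apply/funext => x; apply/matrixP => i k; rewrite !mxE.
by have := row_map_wgrad C; have := row_map_W12 C; rewrite E E2.
Qed.

(** The weak gradient is additive, and the norm of W^{1,2} bounds its entries. *)
Lemma trace_gradient_cvg (w : nat -> plane -> 'rV[R]_n) i k :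
  (forall m i, smooth_on setT (fun x => w m x 0 i)) ->
  (fun m => W12norm (fun x => w m x - u0 x)) @ \oo --> (0 : R) ->
  (fun m => I (fun x => (dcomp (w m) i k x - wgrad u0 x i k) ^+ 2)) @ \oo --> (0 : R).
Proof.
move=> sw cw; have [W0 _ _] := tr.
have c2 : (fun m => W12norm (fun x => w m x - u0 x) ^+ 2) @ \oo --> (0 : R).
  rewrite -[X in _ --> X](_ : 0 * 0 = 0 :> R); last by rewrite mulr0.
  by under eq_fun do rewrite expr2; apply: cvgM.
apply: (squeeze_cvgr _ (cvg_cst 0) c2); apply: nearW => m; apply/andP; split.
  by apply: I_ge0 => x _; exact: sqr_ge0.
have [gw Ww] := smooth_map_wgrad (sw m).
have Eu : (fun x => -1 *: u0 x + w m x) = (fun x => w m x - u0 x).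
  by apply/funext => x; rewrite scaleN1r addrC.
have Wd : W12 (fun x => w m x - u0 x) by rewrite -Eu; exact: W12_lin.
have gd : is_wgrad (fun x => w m x - u0 x) (fun x => jacobian_mx (w m) x - wgrad u0 x).
  rewrite -Eu; have := is_wgrad_lin (-1) (W12_wgrad W0) gw.
  by congr is_wgrad; apply/funext => x; rewrite scaleN1r addrC.
apply: le_trans (W12norm_ge i k Wd).
suff -> : I (fun x => wgrad (fun y => w m y - u0 y) x i k ^+ 2) =
    I (fun x => (dcomp (w m) i k x - wgrad u0 x i k) ^+ 2) by [].
apply: (ae_eq_I mD).
- by have [_ /intg_measurable] := W12_sqint i k Wd.
- have [m0 _] := W12_sqint i k W0.
  apply: measurable_funX; apply: measurable_funB => //; apply: cont_measurable_disk.
  by have [_ + _] := is_C1T (smooth_is_C1 (sw m i)); apply.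
- have := wgrad_ae i k gd.
  by apply: filterS => x h Dx; rewrite h// !mxE.
Qed.

(** Smoothings of v minus the smooth approximations of u0 have gradients that tend to
    Dv - Du0 and boundary values that tend to zero, so that [zero_trace_approx]
    applies in every component. *)
Lemma trace_variation : [lipschitz v x | x in cdisk] ->
  exists G, [/\ is_wgrad v G, forall i k, sqintD2 (fun x => G x i k) &
    forall e : R, 0 < e -> exists (z : 'I_n -> plane -> R) w (r : R),
      [/\ forall i, is_C1 setT (z i) (w i), 0 <= r < 1,
          forall i x, ~ ddisk r x -> z i x = 0 &
          forall i k, I (fun x => (G x i k - wgrad u0 x i k - w i k x) ^+ 2) < e]].
Proof.
have [W0 _ [w [sw cw tw]]] := tr.
have cd0 : @cdisk R !=set0 by exists (0, 0); rewrite /cdisk /= expr0n addr0 ler01.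
move=> /(mcshane_map cd0)[L [F [L0 lF eF]]].
have [sg [G [asg sG _ cG gF]]] := lipschitz_map_gradient L0 lF.
exists G; split=> //.
  by apply: is_wgrad_eq gF => x Dx; apply: eF; exact: disk_cdisk.
move=> e e0.
pose f i m x := (sg i m).1 x - w m x 0 i.
pose g i m k x := (sg i m).2 k x - dcomp (w m) i k x.
have Cw m i : is_C1 setT (fun x => w m x 0 i) (dcomp (w m) i) by exact: smooth_is_C1.
have Cf i m : is_C1 setT (f i m) (g i m).
  by have [Cs _ _] := asg i m; exact: is_C1B.
have cwm m i : continuous (fun x => w m x 0 i) by have [] := is_C1T (Cw m i).
have cdw m i k : continuous (dcomp (w m) i k) by have [] := is_C1T (Cw m i).
have csg i m k : continuous ((sg i m).2 k).
  by have [Cs _ _] := asg i m; have [] := is_C1T Cs.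
have cs i m : continuous (sg i m).1.
  by have [Cs _ _] := asg i m; have [] := is_C1T Cs.
have s0 i k : sqintD2 (fun x => wgrad u0 x i k) by exact: W12_sqint.
pose h i k x := G x i k - wgrad u0 x i k.
have sh i k : sqintD2 (h i k) by exact: sqintB.
have cgh i k : (fun m => I (fun x => (g i m k x - h i k x) ^+ 2)) @ \oo --> (0 : R).
  have c := @L2_cvg0B (fun m x => (sg i m).2 k x - G x i k)
    (fun m x => dcomp (w m) i k x - wgrad u0 x i k)
    (fun m => sqintB mD (sqint_cont (csg i m k)) (sG i k))
    (fun m => sqintB mD (sqint_cont (cdw m i k)) (s0 i k)) (cG i k) (trace_gradient_cvg i k sw cw).
  have -> // : (fun m => I (fun x => (g i m k x - h i k x) ^+ 2)) =
    (fun m => I (fun x => ((sg i m).2 k x - G x i k - (dcomp (w m) i k x - wgrad u0 x i k)) ^+ 2)).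
  by apply/funext => m; apply: eq_I => x _; rewrite /g /h; ring.
have tF : (fun m => circle_dist2 (w m) F) @ \oo --> 0%E.
  have -> // : (fun m => circle_dist2 (w m) F) = (fun m => circle_dist2 (w m) v).
  apply/funext => m; rewrite /circle_dist2; apply: eq_integral => t _.
  by rewrite eF// /cdisk /angle /= cos2Dsin2.
have ccirc i : (fun m => fine (circle_int (fun x => f i m x ^+ 2))) @ \oo --> (0 : R).
  apply: (circle_cvg0 (v := F)) tF => //.
  - by move=> j; exact: lip1_cont (lF j).
  - by move=> m x; have [_ _] := asg i m; exact.
have ex i : exists p : (plane -> R) * ('I_2 -> plane -> R) * R,
    [/\ is_C1 setT p.1.1 p.1.2, p.2 < 1, forall x, ~ ddisk p.2 x -> p.1.1 x = 0 &
        forall k, I (fun x => (h i k x - p.1.2 k x) ^+ 2) < e].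
  have [z [w' [r hz]]] := zero_trace_approx e0 (Cf i) (sh i) (cgh i) (ccirc i).
  by exists (z, w', r).
have [p Hp] := choice ex.
pose r := \big[Num.max/0]_i (p i).2.
have r_ge i : (p i).2 <= r by exact: le_bigmax.
exists (fun i => (p i).1.1), (fun i => (p i).1.2), r; split.
- by move=> i; have [] := Hp i.
- apply/andP; split; first exact: bigmax_ge_id.
  by apply/bigmax_ltP; split=> // i _; have [] := Hp i.
- move=> i x nx; have [_ _ + _] := Hp i; apply => hx; apply: nx.
  exact: le_trans hx (r_ge i).
- by move=> i k; have [_ _ _] := Hp i; exact.
Qed.

End TraceGradient.

(** * Minimality of the limit *)

Section Minimality.
Context {n : nat}.

Lemma area_perturbation (A E : plane -> 'M[R]_(n, 2)) (c e : R) :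
  0 < c -> (forall i k, sqintD2 (fun x => A x i k)) ->
  (forall i k, sqintD2 (fun x => E x i k)) ->
  (forall i k, \int[mu2]_(x in disk) (E x i k ^+ 2) < e) ->
  \int[mu2]_(x in disk) jac (A x + E x) <=
  \int[mu2]_(x in disk) jac (A x) +
  c * \int[mu2]_(x in disk) sqnorm (A x) +
  (c + c^-1) * ((2 * n)%:R * e).
Proof.
move=> c0 sA sE Ee.
have sAE i k : sqintD2 (fun x => (A x + E x) i k).
  have -> : (fun x => (A x + E x) i k) = (fun x => A x i k + E x i k).
    by apply/funext => x; rewrite mxE.
  exact: sqintD.
have ij := jac_intg sA; have iq := intg_sqnorm sA; have iE := intg_sqnorm sE.
have i1 := intgZ mD c iq; have i2 := intgZ mD (c + c^-1) iE.
have i3 := intgD mD ij i1; have i4 := intgD mD i3 i2.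
apply: le_trans (_ : \int[mu2]_(x in disk) (jac (A x) + c * sqnorm (A x) +
    (c + c^-1) * sqnorm (E x)) <= _).
  by apply: (le_I mD (jac_intg sAE) i4) => x _; exact: jac_perturbation.
rewrite (ID mD i3 i2) (ID mD ij i1) (IZ mD c iq) (IZ mD _ iE) lerD2l.
apply: ler_wpM2l; first by rewrite ltW// addr_gt0// invr_gt0.
have iEk i k : mu2.-integrable disk (EFin \o (fun x => E x i k ^+ 2)) by case: (sE i k).
have sumE : \int[mu2]_(x in disk) sqnorm (E x) =
    \sum_i \sum_k \int[mu2]_(x in disk) (E x i k ^+ 2).
  rewrite /sqnorm (I_sum _ mD (fun i => (I_sum _ mD (iEk i)).1)).2.
  by apply: eq_bigr => i _; rewrite (I_sum _ mD (iEk i)).2.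
rewrite sumE; apply: (@le_trans _ _ (\sum_(i < n) \sum_(k < 2) e)).
  by apply: ler_sum => i _; apply: ler_sum => k _; exact: ltW.
by rewrite !sumr_const !card_ord -mulrnA mulr_natl.
Qed.

(** Variations whose gradient is within c^2 of Dv - Du0 in the mean square give
    area u0 <= area v + O(c). *)
Theorem weak_limit_minimality (c_ u : nat -> plane -> 'rV[R]_n) (u0 v : plane -> 'rV[R]_n) (M : R) :
  (forall j, douglas_minimizer (c_ j) (u j)) -> weak_cvg_W12 u u0 ->
  (forall j i k, I (fun x => wgrad (u j) x i k ^+ 2) <= M) ->
  [lipschitz v x | x in cdisk] -> is_trace u0 v -> (area u0 <= area v)%E.
Proof.
move=> du cu bu lv tr.
have [_ W0 _] := cu.
have [G [vG sG approx]] := trace_variation tr lv.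
have s0 i k := W12_sqint i k W0.
rewrite (area_wgrad (W12_wgrad W0) s0) (area_wgrad vG sG) lee_fin.
set A0 := Rintegral _ _ _; set Av := Rintegral _ _ _.
set S := \int[mu2]_(x in disk) sqnorm (G x).
have S0 : 0 <= S by apply: I_ge0 => x _; exact: sqnorm_ge0.
have key c : 0 < c -> c <= 1 -> A0 <= Av + c * (S + (4 * n)%:R).
  move=> c0 c1; have c20 : 0 < c ^+ 2 by exact: exprn_gt0.
  have [z [w [r [Cz /andP[r0 r1] z0 ze]]]] := approx _ c20.
  have min := interior_minimality du cu bu Cz r0 r1 z0.
  pose E x := wgrad u0 x + row_grad w x - G x.
  have EE i k : (fun x => E x i k) = (fun x => wgrad u0 x i k + row_grad w x i k - G x i k).
    by apply/funext => x; rewrite !mxE.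
  have sE i k : sqintD2 (fun x => E x i k).
    by rewrite EE; apply: sqintB => //; apply: sqintD => //; exact: row_grad_sqint Cz i k.
  have Ee i k : \int[mu2]_(x in disk) (E x i k ^+ 2) < c ^+ 2.
    apply: le_lt_trans (ze i k); rewrite le_eqVlt; apply/orP; left; apply/eqP.
    by apply: eq_I => x _; rewrite !mxE; ring.
  have := area_perturbation c0 sG sE Ee.
  have -> : (fun x => jac (G x + E x)) = (fun x => jac (wgrad u0 x + row_grad w x)).
    by apply/funext => x; congr jac; rewrite /E addrC subrK.
  move=> /(le_trans min) /le_trans; apply.
  rewrite -/S -/Av -addrA lerD2l mulrDr lerD2l.
  have -> : (c + c^-1) * ((2 * n)%:R * c ^+ 2) = c * ((2 * n)%:R * (c ^+ 2 + 1)).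
    by field; rewrite gt_eqF.
  rewrite ler_pM2l// (_ : (4 * n)%:R = (2 * n)%:R * 2 :> R); last by rewrite -natrM mulnAC.
  apply: ler_wpM2l => //; rewrite (_ : 2 = 1 + 1 :> R)// lerD2r.
  by rewrite expr_le1// ltW.
apply/ler_addgt0Pr => e e0.
pose c := Num.min 1 (e / (S + (4 * n)%:R + 1)).
have S16 : 0 < S + (4 * n)%:R + 1 by rewrite ltr_wpDl// addr_ge0.
have c0 : 0 < c by rewrite lt_min ltr01 divr_gt0.
apply: le_trans (key c c0 _) _; first by rewrite ge_min lexx.
rewrite lerD2l; apply: (@le_trans _ _ (c * (S + (4 * n)%:R + 1))).
  by rewrite ler_pM2l// lerDl.
by rewrite -ler_pdivlMr// ge_min lexx orbT.
Qed.

End Minimality.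

End Plane.

Theorem proposition3p5 (R : realType) (gamma : R * R -> R * R)
    (eps : nat -> R) (u : nat -> R * R -> 'rV[R]_4) (u0 : R * R -> 'rV[R]_4) :
  [lipschitz gamma x | x in circle] ->
  (forall j, 0 < eps j <= 1) ->
  nonincreasing_seq eps ->
  eps @ \oo --> (0 : R) ->
  (forall j, douglas_minimizer (lifted_curve gamma (eps j)) (u j)) ->
  weak_cvg_W12 u u0 ->
  forall v : R * R -> 'rV[R]_4,
    [lipschitz v x | x in cdisk] ->
    is_trace u0 v ->
    (area u0 <= area v)%E.
Proof.
move=> lg e01 _ _ du cu v lv tr.
have [M bu] := minimizers_energy_bound lg e01 du.
exact: weak_limit_minimality du cu bu lv tr.
Qed.
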